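(* Let $n\ge 2$ and $k\ge 1$ be integers and let $i_1\le i_2\le\cdots\le i_p$ be positive integers such that $i_1+i_2+\cdots+i_p=k$. Write $\lambda^*_m=\lambda^*_m(n)$ and $\mu^*_m=\mu^*_m(n)$. 1) We have $$\lambda^*_{k}(n)^{n/2}\le \lambda^*_{i_1}(n)^{n/2}+\lambda^*_{i_2}(n)^{n/2}+\cdots+\lambda^*_{i_p}(n)^{n/2}\qquad (D)$$ and $$\mu^*_{k}(n)^{n/2}\ge \mu^*_{i_1}(n)^{n/2}+\mu^*_{i_2}(n)^{n/2}+\cdots+\mu^*_{i_p}(n)^{n/2}.\qquad (N)$$ 2) If equality holds in (D), then for every $\varepsilon>0$ there exist $p$ mutually disjoint domains $A_1,\dots,A_p$ in $\mathbb{R}^n$ such that (i) $\lambda_k(A_1\cup\cdots\cup A_p)\le(1+\varepsilon)\lambda^*_k$; (ii) for all $j\le p$, $\lambda^*_{i_j}\le\lambda_{i_j}(A_j)\,|A_j|^{2/n}\le(1+\varepsilon)\lambda^*_{i_j}$; (iii) $|A_1|+\cdots+|A_p|=1$ and, for all $j\le p$, $\dfrac{\lambda^*_{i_j}}{(1+\varepsilon)\lambda^*_k}\le|A_j|^{2/n}\le\dfrac{(1+\varepsilon)\lambda^*_{i_j}}{\lambda^*_k}$. 3) If equality holds in (N), then for every $\varepsilon\in(0,1)$ there exist $p$ mutually disjoint domains $A_1,\dots,A_p$ in $\mathbb{R}^n$ such that (i) $\mu_k(A_1\cup\cdots\cup A_p)\ge(1-\varepsilon)\mu^*_k$; (ii)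 for all $j\le p$, $(1-\varepsilon)\mu^*_{i_j}\le\mu_{i_j}(A_j)\,|A_j|^{2/n}\le\mu^*_{i_j}$; (iii) $|A_1|+\cdots+|A_p|=1$ and, for all $j\le p$, $\dfrac{(1-\varepsilon)\mu^*_{i_j}}{\mu^*_k}\le|A_j|^{2/n}\le\dfrac{\mu^*_{i_j}}{(1-\varepsilon)\mu^*_k}$.
   Context: ''Domain'' means a bounded open subset of $\mathbb{R}^n$ ($n\ge2$) with sufficiently regular boundary (e.g. Lipschitz, so that the Neumann spectrum is discrete); domains are not required to be connected. $|\Omega|$ denotes the volume of $\Omega$. $0<\lambda_1(\Omega)\le\lambda_2(\Omega)\le\cdots$ are the eigenvalues of the (positive) Laplacian on $\Omega$ with Dirichlet boundary conditions, and $0=\mu_0(\Omega)\le\mu_1(\Omega)\le\mu_2(\Omega)\le\cdots$ those with Neumann boundary conditions, each repeated according to multiplicity (Dirichlet numbering starts at $1$, Neumann numbering starts at $0$). The spectrum of a disjoint union of domains is the re-ordered union (with multiplicity) of the spectra of its pieces. Define $$\lambda^*_k(n)=\inf\{\lambda_k(\Omega):\Omega\subset\mathbb{R}^n,\ |\Omega|=1\},\qquad \mu^*_k(n)=\sup\{\mu_k(\Omega):\Omega\subset\mathbb{R}^n,\ |\Omega|=1\},$$ the infimum and supremum being over domains. *)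

(* Defs.v *)
From HB Require Import structures.
From mathcomp Require Import all_boot all_order all_algebra.
From mathcomp Require Import all_classical all_reals all_analysis.

Set Implicit Arguments.
Unset Strict Implicit.
Unset Printing Implicit Defensive.

Import Order.TTheory GRing.Theory Num.Theory.
Import numFieldNormedType.Exports.

Local Open Scope classical_set_scope.
Local Open Scope ring_scope.

(* The product of the Borel sigma-algebras of the coordinates, as the library
   does for [n.-tuple T]; it coincides with the Borel sigma-algebra. *)
Section measurable_rV.
Context (R : realType) (n : nat).

Let coord (i : 'I_n) (x : 'rV[R]_n) : R := x ord0 i.

Let rV_set0 : g_sigma_preimage coord set0.
Proof. exact: sigma_algebra0. Qed.

Let rV_setC A : g_sigma_preimage coord A -> g_sigma_preimage coord (~` A).
Proof. exact: sigma_algebraC. Qed.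

Let rV_bigcup (F : (set 'rV[R]_n)^nat) :
  (forall i, g_sigma_preimage coord (F i)) ->
  g_sigma_preimage coord (\bigcup_i (F i)).
Proof. exact: sigma_algebra_bigcup. Qed.

HB.instance Definition _ := @isMeasurable.Build default_measure_display
  'rV[R]_n (g_sigma_preimage coord) rV_set0 rV_setC rV_bigcup.

Lemma measurable_coord_rV (i : 'I_n) :
  measurable_fun setT (fun x : 'rV[R]_n => x ord0 i).
Proof.
move=> _ Y mY; rewrite setTI; apply: sub_sigma_algebra => /=.
rewrite -bigcup_seq/=; exists i => /=; first by rewrite mem_index_enum.
by exists Y => //; rewrite setTI.
Qed.

Lemma measurable_fun_rV d (T : measurableType d) (f : T -> 'rV[R]_n) :
  (forall i, measurable_fun setT (fun x => f x ord0 i)) -> measurable_fun setT f.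
Proof.
move=> mf; apply: (@measurability _ _ _ _ _ _
  (\big[setU/set0]_(i < n) preimage_set_system setT (coord i) measurable)).
  by [].
move=> _ [B + <-]; rewrite -bigcup_seq/= => -[i /= _ [C mC <-]].
by have := mf i measurableT C mC; rewrite !setTI.
Qed.

End measurable_rV.

Section rV_cons_measure.
Context (R : realType) (n : nat).

Definition rV_cons (p : measurableTypeR R * 'rV[R]_n) : 'rV[R]_n.+1 :=
  \row_i if unlift ord0 i is Some j then p.2 ord0 j else p.1.

Let rV_uncons (x : 'rV[R]_n.+1) : measurableTypeR R * 'rV[R]_n :=
  (x ord0 ord0, \row_j x ord0 (lift ord0 j)).

Let rV_consE0 p : rV_cons p ord0 ord0 = p.1.
Proof. by rewrite mxE unlift_none. Qed.

Let rV_consES p j : rV_cons p ord0 (lift ord0 j) = p.2 ord0 j.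
Proof. by rewrite mxE liftK. Qed.

Let rV_consK : cancel rV_cons rV_uncons.
Proof.
move=> [t y]; rewrite /rV_uncons rV_consE0/=; congr pair.
by apply/rowP => j; rewrite mxE rV_consES.
Qed.

Lemma measurable_rV_cons : measurable_fun setT rV_cons.
Proof.
apply: measurable_fun_rV => i; case: (unliftP ord0 i) => [j|] ->.
- under eq_fun do rewrite rV_consES.
  exact: (measurableT_comp (measurable_coord_rV j) measurable_snd).
- by under eq_fun do rewrite rV_consE0; exact: measurable_fst.
Qed.

HB.instance Definition _ := isMeasurableFun.Build _ _ _ _ rV_cons
  measurable_rV_cons.

Let measurable_rV_uncons : measurable_fun setT rV_uncons.
Proof.
apply: measurable_fun_pair; first exact: measurable_coord_rV.
apply: measurable_fun_rV => j.
by under eq_fun do rewrite mxE; exact: measurable_coord_rV.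
Qed.

Definition rV_cons_measure (m : {sigma_finite_measure set 'rV[R]_n -> \bar R}) :
    set 'rV[R]_n.+1 -> \bar R :=
  pushforward (@lebesgue_measure R \x m)%E rV_cons.

Variable m : {sigma_finite_measure set 'rV[R]_n -> \bar R}.

Let rV_cons_measure0 : rV_cons_measure m set0 = 0%E.
Proof. exact: measure0. Qed.

Let rV_cons_measure_ge0 A : (0 <= rV_cons_measure m A)%E.
Proof. exact: measure_ge0. Qed.

Let rV_cons_measure_sigma_additive : semi_sigma_additive (rV_cons_measure m).
Proof. exact: measure_semi_sigma_additive. Qed.

HB.instance Definition _ := isMeasure.Build _ _ _ (rV_cons_measure m)
  rV_cons_measure0 rV_cons_measure_ge0 rV_cons_measure_sigma_additive.

Let rV_cons_measure_sigma_finite : sigma_finite setT (rV_cons_measure m).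
Proof.
have /sigma_finiteP[F [TF ndF Foo]] := sigma_finiteT (@lebesgue_measure R).
have /sigma_finiteP[G [TG ndG Goo]] := sigma_finiteT m.
exists (fun k => rV_uncons @^-1` (F k `*` G k)).
  rewrite -preimage_bigcup -(preimage_setT rV_uncons); congr (_ @^-1` _).
  rewrite -setXTT TF TG predeqE => -[x y]; split.
    move=> [/= [a _ Fax] [b _ Gby]]; exists (maxn a b) => //; split.
    - by move: x Fax; exact/subsetPset/ndF/leq_maxl.
    - by move: y Gby; exact/subsetPset/ndG/leq_maxr.
  by move=> [a _ []/= ? ?]; split; exists a.
move=> k; have [mF Fk] := Foo k; have [mG Gk] := Goo k; split.
  by rewrite -[X in measurable X]setTI; apply: measurable_rV_uncons => //;
    exact: measurableX.
rewrite /rV_cons_measure /pushforward -comp_preimage.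
rewrite (_ : _ \o _ = id); last by apply/funext => p; exact: rV_consK.
by rewrite preimage_id product_measure1E// lte_mul_pinfty// ge0_fin_numE.
Qed.

HB.instance Definition _ := Measure_isSigmaFinite.Build _ _ _
  (rV_cons_measure m) rV_cons_measure_sigma_finite.

End rV_cons_measure.

(* n-dimensional Lebesgue measure, as an iterated product. *)
Fixpoint lebesgue_rV (R : realType) (n : nat) :
    {sigma_finite_measure set 'rV[R]_n -> \bar R} :=
  if n is n'.+1 then rV_cons_measure (lebesgue_rV R n') else dirac (0 : 'rV[R]_0).

Section sobolev.
Context (R : realType) (n : nat).
Implicit Types (U : set 'rV[R]_n) (u v f : 'rV[R]_n -> R).

Definition partial (i : 'I_n) f : 'rV[R]_n -> R := 'D_(delta_mx ord0 i) f.

Definition smooth f := forall s : seq 'I_n,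
  continuous (foldr partial f s) /\
  forall i x, derivable (foldr partial f s) x (delta_mx ord0 i).

Definition support f : set 'rV[R]_n := closure [set x | f x != 0].

Definition test_function U f :=
  [/\ smooth f, compact (support f) & support f `<=` U].

Definition L2 U u := measurable_fun U u /\
  (lebesgue_rV R n).-integrable U (fun x => (u x ^+ 2)%:E).

Definition L2dot U u v : R := \int[lebesgue_rV R n]_(x in U) (u x * v x).

Definition L2sqdist U u v : R := \int[lebesgue_rV R n]_(x in U) ((u x - v x) ^+ 2).

Definition weak_gradient U u (g : 'I_n -> 'rV[R]_n -> R) :=
  forall phi, test_function U phi ->
  forall i, L2dot U u (partial i phi) = - L2dot U (g i) phi.

(* A Sobolev function is represented together with its weak gradient [g],
   which [u] determines almost everywhere. *)
Definition H1 U u (g : 'I_n -> 'rV[R]_n -> R) :=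
  [/\ L2 U u, forall i, L2 U (g i) & weak_gradient U u g].

Definition H1_0 U u (g : 'I_n -> 'rV[R]_n -> R) := H1 U u g /\
  exists2 phi : ('rV[R]_n -> R)^nat, forall k, test_function U (phi k) &
    (fun k => L2sqdist U u (phi k) + \sum_i L2sqdist U (g i) (partial i (phi k)))
      @ \oo --> (0 : R).

End sobolev.

Inductive boundary_condition := Dirichlet | Neumann.

Section eigenvalues.
Context (R : realType) (n : nat) (bc : boundary_condition).
Implicit Types (U : set 'rV[R]_n) (u v : 'rV[R]_n -> R).

Definition form_domain U u (g : 'I_n -> 'rV[R]_n -> R) :=
  match bc with Dirichlet => H1_0 U u g | Neumann => H1 U u g end.

(* Weak form of [- Delta u = t u] in [U] with [u = 0] (Dirichlet) or
   [du/dnu = 0] (Neumann) on the boundary; [u = 0] is not excluded here. *)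
Definition eigenfunction U (t : R) u := exists2 g, form_domain U u g &
  forall v h, form_domain U v h ->
    \sum_i L2dot U (g i) (h i) = t * L2dot U u v.

(* Linear independence as elements of L^2, i.e. modulo equality a.e. on [U]. *)
Definition L2_free U m (u : 'I_m -> 'rV[R]_n -> R) := forall c : 'I_m -> R,
  {ae lebesgue_rV R n, forall x, U x -> \sum_a c a * u a x = 0} ->
  forall a, c a = 0.

(* Since eigenspaces of distinct eigenvalues are L^2-orthogonal, this says that
   the multiplicities of the eigenvalues [<= t] add up to at least [m]. *)
Definition eigenvalue_count_ge U (m : nat) (t : R) :=
  exists (s : 'I_m -> R) (u : 'I_m -> 'rV[R]_n -> R),
    (forall a, s a <= t /\ eigenfunction U (s a) (u a)) /\ L2_free U u.

(* The [m]-th smallest eigenvalue ([m >= 1]), counted with multiplicity: for a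
   discrete spectrum the set below is the closed half-line starting there. *)
Definition nth_eigenvalue U (m : nat) : R := inf [set t | eigenvalue_count_ge U m t].

End eigenvalues.

(* Dirichlet eigenvalues are numbered from 1, Neumann eigenvalues from 0. *)
Definition dirichlet_eigenvalue (R : realType) (n k : nat) (U : set 'rV[R]_n) : R :=
  nth_eigenvalue Dirichlet U k.

Definition neumann_eigenvalue (R : realType) (n k : nat) (U : set 'rV[R]_n) : R :=
  nth_eigenvalue Neumann U k.+1.

Section domains.
Context (R : realType) (n : nat).
Implicit Types U : set 'rV[R]_n.

(* "Sufficiently regular boundary" is read as Lipschitz. Near each boundary point
   and in suitable orthonormal coordinates [y = x *m Q], [U] is the set of points
   lying on one side of the graph [y_i = gamma (y_j)_(j <> i)] of a Lipschitz
   function [gamma]. *)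
Definition lipschitz_boundary U :=
  forall x0, closure U x0 -> ~ U° x0 ->
  exists (Q : 'M[R]_n) (i : 'I_n) (gamma : 'rV[R]_n.-1 -> R) (L : R),
    [/\ Q *m Q^T = 1%:M, L.-lipschitz gamma &
        \forall x \near x0, U x <-> gamma (col' i (x *m Q)) < (x *m Q) ord0 i].

Definition domain U := [/\ open U, bounded_set U & lipschitz_boundary U].

Definition volume U : R := fine (lebesgue_rV R n U).

Definition unit_domains : set (set 'rV[R]_n) :=
  [set U | domain U /\ lebesgue_rV R n U = 1%E].

End domains.
Arguments unit_domains R n : clear implicits.

(* The two sets are nonempty and bounded (Faber-Krahn type lower bounds for
   lambda_k, Kroger's upper bound for mu_k), so real-valued [inf] and [sup] are
   the genuine extrema. *)
Definition lambda_star (R : realType) (n k : nat) : R :=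
  inf [set dirichlet_eigenvalue k U | U in unit_domains R n].

Definition mu_star (R : realType) (n k : nat) : R :=
  sup [set neumann_eigenvalue k U | U in unit_domains R n].

(* Main.v *)
From HB Require Import structures.
From mathcomp Require Import all_boot all_order all_algebra.
From mathcomp Require Import all_classical all_reals all_analysis.
From mathcomp Require Import measurable_realfun ring lra zify.
Require Import Defs.

(** The Dirichlet and Neumann eigenvalues are those of the energy, the integral of the
    squared gradient, relative to the mass, the integral of the square, on the form
    domains H^1_0 and H^1. Everything rests on their min-max description.

    Rescale domains U_1, ..., U_p of volume 1 to volumes w_1, ..., w_p with sum 1, and
    place the copies A_j far apart; the union has volume 1. Scaling multiplies the
    eigenvalues by w_j ^ (- 2 / n). If the i_j-th Dirichlet eigenvalue of every A_j is
    at most t, then the eigenfunctions of the pieces, extended by zero, span a space of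
    dimension i_1 + ... + i_p = k on which the energy is at most t times the mass, so
    the k-th eigenvalue of the union is at most t. Let U_j be almost optimal for
    lambda^*_(i_j). The numbers lambda^*_(i_j) / w_j ^ (2 / n) are all equal to one
    level S exactly when w_j is proportional to lambda^*_(i_j) ^ (n / 2), and then
    S ^ (n / 2) is the sum of the lambda^*_(i_j) ^ (n / 2). Hence lambda^*_k <= S, which
    is (D). If equality holds then S = lambda^*_k, and the configuration just built has
    the properties claimed in part 2, since w_j ^ (2 / n) = lambda^*_(i_j) / S.

    The Neumann case is dual. Being orthogonal on every piece to its i_j lowest
    eigenfunctions amounts to k linear conditions, so every space of dimension k + 1
    contains a nonzero function that satisfies them; if the i_j-th Neumann eigenvalue
    of every A_j (numbered from 0) is at least t, then its energy is at least t times
    its mass. So the k-th Neumann eigenvalue of the union is at least t. These two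
    arguments are [dirichlet_configuration] and [neumann_configuration].

    Two things have to be provided. The first is the min-max principle itself,
    [exists_eigensystem] and [eigensystem_lower_bound], which follows by the direct
    method from completeness and compactness of the form domains. Compactness means
    that the mass is controlled by finitely many functionals up to a small multiple of
    the energy. It comes from the Poincare inequality on the cubes of a fine grid,
    [grid_poincare], which rests on the absolute continuity of Sobolev functions along
    almost every segment, [H1_translate_ae]. A function of H^1_0 extends by zero to the
    whole space. For H^1 only the cubes inside the domain are available; what remains is
    a thin layer near the boundary, and translating it inwards along Lipschitz charts
    shows that it carries little mass ([strip_estimate], [thin_layer_domain]).

    The second is that the extremal values are positive and finite: a uniform lower
    bound for Dirichlet eigenvalues ([faber_krahn]), a uniform upper bound for Neumann
    eigenvalues, obtained by averaging over the translates of a bump ([kroger_bound]),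
    and the unit cube as a competitor, with a positive first Neumann eigenvalue
    ([unit_cube_domain], [mu_star_gt0]). *)

Set Implicit Arguments.
Unset Strict Implicit.
Unset Printing Implicit Defensive.

Import Order.TTheory GRing.Theory Num.Theory.
Import numFieldNormedType.Exports.

Local Open Scope classical_set_scope.
Local Open Scope ring_scope.

(** * Abstract spectral theory of a pair of quadratic forms *)

Section semi_inner_products.
Context {R : realType} {V : lmodType R}.
Implicit Types (D : V -> Prop) (f : V -> V -> R).

Definition subspace_on D := D 0 /\ forall c x y, D x -> D y -> D (c *: x + y).

Definition functional_on D (l : V -> R) :=
  forall c x y, D x -> D y -> l (c *: x + y) = c * l x + l y.

(** Nonnegativity and linearity are only required on [D], whereas symmetry is
    required everywhere: the integrals that define the forms make sense, but are
    linear, only for square integrable arguments. *)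
Definition form_on D f := [/\ forall x y, f x y = f y x,
  forall x, D x -> 0 <= f x x & forall z, D z -> functional_on D (f^~ z)].

Section subspace.
Variables (D : V -> Prop) (sD : subspace_on D).

Lemma subspaceD x y : D x -> D y -> D (x + y).
Proof. by move=> Dx Dy; rewrite -[x]scale1r; apply: sD.2. Qed.

Lemma subspaceZ c x : D x -> D (c *: x).
Proof. by move=> Dx; rewrite -[_ *: _]addr0; apply: sD.2 => //; apply: sD.1. Qed.

Lemma subspaceN x : D x -> D (- x).
Proof. by move=> Dx; rewrite -scaleN1r; exact: subspaceZ. Qed.

Lemma subspaceB x y : D x -> D y -> D (x - y).
Proof. by move=> Dx Dy; apply: subspaceD => //; exact: subspaceN. Qed.

Lemma subspace_sum I (r : seq I) (P : pred I) (c : I -> R) (v : I -> V) :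
  (forall i, P i -> D (v i)) -> D (\sum_(i <- r | P i) c i *: v i).
Proof.
move=> Dv; elim/big_rec: _ => [|i x Pi Dx]; first exact: sD.1.
by apply: sD.2 => //; exact: Dv.
Qed.

Section functional.
Variables (l : V -> R) (ll : functional_on D l).

Lemma functional0 : l 0 = 0.
Proof.
have := ll (-1) sD.1 sD.1; rewrite scaler0 addr0 => ->; ring.
Qed.

Lemma functionalD x y : D x -> D y -> l (x + y) = l x + l y.
Proof. by move=> Dx Dy; rewrite -[x in LHS]scale1r ll// mul1r. Qed.

Lemma functionalZ c x : D x -> l (c *: x) = c * l x.
Proof.
by move=> Dx; rewrite -[c *: x]addr0 (ll _ _ sD.1)// functional0 addr0.
Qed.

Lemma functionalB x y : D x -> D y -> l (x - y) = l x - l y.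
Proof.
move=> Dx Dy; rewrite functionalD//; last exact: subspaceN.
by rewrite -scaleN1r functionalZ// mulN1r.
Qed.

Lemma functional_sum I (r : seq I) (P : pred I) (c : I -> R) (v : I -> V) :
  (forall i, P i -> D (v i)) ->
  l (\sum_(i <- r | P i) c i *: v i) = \sum_(i <- r | P i) c i * l (v i).
Proof.
move=> Dv; elim: r => [|i r IH]; first by rewrite !big_nil functional0.
rewrite !big_cons; case: ifPn => // Pi.
by rewrite ll ?IH//; [exact: Dv | exact: subspace_sum].
Qed.

End functional.

Section form.
Variables (f : V -> V -> R) (ff : form_on D f).

Let fl z (Dz : D z) : functional_on D (f^~ z).
Proof. by case: ff => _ _ /(_ z Dz). Qed.

Lemma formC x y : f x y = f y x.
Proof. by case: ff => /(_ x y). Qed.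

Lemma form_ge0 x : D x -> 0 <= f x x.
Proof. by case: ff => _ /(_ x). Qed.

Lemma form_funr z : D z -> functional_on D (f z).
Proof. by move=> Dz c x y Dx Dy; rewrite !(formC z) fl. Qed.

Lemma formDZ t x y : D x -> D y ->
  f (x + t *: y) (x + t *: y) = f x x + 2 * t * f x y + t ^+ 2 * f y y.
Proof.
move=> Dx Dy; have Dty := subspaceZ t Dy; have Dxy := subspaceD Dx Dty.
rewrite (functionalD (fl Dxy))// (functionalZ (fl Dxy))//.
rewrite (functionalD (form_funr Dx))// (functionalZ (form_funr Dx))//.
rewrite (functionalD (form_funr Dy))// (functionalZ (form_funr Dy))//.
by rewrite (formC y x); ring.
Qed.

Lemma formD x y : D x -> D y -> f (x + y) (x + y) = f x x + 2 * f x y + f y y.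
Proof. by move=> Dx Dy; have := formDZ 1 Dx Dy; rewrite scale1r => ->; ring. Qed.

Lemma formB x y : D x -> D y -> f (x - y) (x - y) = f x x - 2 * f x y + f y y.
Proof. by move=> Dx Dy; have := formDZ (-1) Dx Dy; rewrite scaleN1r => ->; ring. Qed.

Lemma formZZ t x : D x -> f (t *: x) (t *: x) = t ^+ 2 * f x x.
Proof.
by move=> Dx; rewrite (functionalZ (fl (subspaceZ t Dx)))//
  (functionalZ (form_funr Dx))// mulrA.
Qed.

Lemma form_CauchySchwarz x y : D x -> D y -> f x y ^+ 2 <= f x x * f y y.
Proof.
move=> Dx Dy.
have H t : 0 <= f x x + 2 * t * f x y + t ^+ 2 * f y y.
  by rewrite -formDZ//; apply: form_ge0; apply: subspaceD => //; exact: subspaceZ.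
have [y0|y0] := eqVneq (f y y) 0; last first.
  have {}y0 : 0 < f y y by rewrite lt_neqAle eq_sym y0 form_ge0.
  have := H (- (f x y / f y y)); rewrite -(ler_pM2r y0) mul0r.
  have -> : (f x x + 2 * - (f x y / f y y) * f x y + (- (f x y / f y y)) ^+ 2 * f y y)
     * f y y = f x x * f y y - f x y ^+ 2 by field; rewrite gt_eqF.
  by rewrite subr_ge0.
have [->|xy0] := eqVneq (f x y) 0; first by rewrite y0 mulr0 expr0n.
have := H (- (f x x + 1) / (2 * f x y)); rewrite y0 mulr0 addr0.
have -> : f x x + 2 * (- (f x x + 1) / (2 * f x y)) * f x y = -1 by field.
by move=> H1; exfalso; move: H1; apply/negP; rewrite -ltNge ltrN10.
Qed.

(** Weighted triangle inequality: it lets the value of a form pass to the limit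
    along a sequence that converges for that form. *)
Lemma form_le_perturb t x y : 0 < t -> D x -> D y ->
  f y y <= (1 + t) * f x x + (1 + t^-1) * f (x - y) (x - y).
Proof.
move=> t0 Dx Dy; have ti0 : 0 < t^-1 by rewrite invr_gt0.
have Dz := subspaceB Dx Dy.
have {1 2}-> : y = x - (x - y) by rewrite opprB addrC subrK.
rewrite formB//; set z := x - y in Dz *.
have := form_ge0 (subspaceD (subspaceZ t Dx) Dz).
have -> : t *: x + z = z + t *: x by rewrite addrC.
rewrite formDZ// (formC z x) => H.
have : 0 <= t^-1 * (f z z + 2 * t * f x z + t ^+ 2 * f x x).
  by apply: mulr_ge0 => //; exact: ltW.
have -> : t^-1 * (f z z + 2 * t * f x z + t ^+ 2 * f x x) =
  t^-1 * f z z + 2 * f x z + t * f x x by field; rewrite gt_eqF.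
lra.
Qed.

Lemma form_parallelogram x y : D x -> D y ->
  f (x - y) (x - y) + f (x + y) (x + y) = 2 * f x x + 2 * f y y.
Proof. by move=> Dx Dy; rewrite formB// formD//; ring. Qed.

End form.
End subspace.
End semi_inner_products.

(** An ultrafilter replaces the successive extractions of subsequences: along it
    every bounded sequence converges. *)
Lemma bounded_ultra_cvg {R : realType} (F : set_system nat) (r : nat -> R) (M : R) :
  UltraFilter F -> (forall k, `|r k| <= M) ->
  exists p, forall e : R, 0 < e -> F [set k | `|r k - p| < e].
Proof.
move=> UF rM; have PF := @ultra_proper _ _ UF.
have [|p [_ clp]] := @segment_compact R (- M) M (r @ F) _.
  by apply: (@filterE _ F) => k /=; rewrite in_itv/= -ler_norml.
exists p => e e0; have [//|FC] := in_ultra_setVsetC [set k | `|r k - p| < e] UF.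
have [|y [/= ye py]] := clp [set y | ~ `|y - p| < e] (ball p e) _ (nbhsx_ballx _ _ e0).
  exact: FC.
by case: ye; rewrite distrC; exact: py.
Qed.

Section spectral.
Context {R : realType} {V : lmodType R} (D : V -> Prop) (a b : V -> V -> R).
Hypotheses (sD : subspace_on D) (fa : form_on D a) (fb : form_on D b).

(** The form domain is complete for the graph norm [a + b]. *)
Definition form_complete := forall x : nat -> V, (forall i, D (x i)) ->
  (forall e, 0 < e -> exists N, forall i j, (N <= i)%N -> (N <= j)%N ->
     a (x i - x j) (x i - x j) + b (x i - x j) (x i - x j) <= e) ->
  exists2 y, D y & forall e, 0 < e -> exists N, forall i, (N <= i)%N ->
     a (x i - y) (x i - y) + b (x i - y) (x i - y) <= e.

(** Compactness of the embedding of the form domain into the space normed by [b], in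
    a form without sequences: up to an error that is small for the graph norm, [b]
    is controlled by finitely many bounded functionals. *)
Definition form_compact := forall e, 0 < e ->
  exists (N : nat) (l : 'I_N -> V -> R) (K : R), [/\ 0 <= K,
    forall i, functional_on D (l i),
    forall i x, D x -> l i x ^+ 2 <= K * b x x &
    forall x, D x -> b x x <= \sum_i l i x ^+ 2 + e * (a x x + b x x)].

(** A space of dimension [m] modulo the kernel of [b] on which the Rayleigh quotient
    is at most [C]. By the min-max principle this says that the [m]-th eigenvalue is
    at most [C]. *)
Definition trial_space m C := exists v : 'I_m -> V, (forall i, D (v i)) /\
  forall c : 'I_m -> R, let x := \sum_i c i *: v i in
    a x x <= C * b x x /\ (b x x = 0 -> forall i, c i = 0).

(** The last condition says that the system exhausts the bottom of the spectrum: no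
    vector [b]-orthogonal to it has a Rayleigh quotient smaller than one of the [s
    j]. *)
Definition eigensystem m (s : 'I_m -> R) (u : 'I_m -> V) :=
  [/\ forall j, D (u j),
      forall j v, D v -> a (u j) v = s j * b (u j) v,
      forall i j, b (u i) (u j) = (i == j)%:R &
      forall v, D v -> (forall j, b (u j) v = 0) -> forall j, s j * b v v <= a v v].

Hypotheses (cplt : form_complete) (cpct : form_compact).

(** On a set of large measure for the ultrafilter, each of the finitely many
    functionals given by compactness is almost constant. *)
Lemma bounded_energy_cauchy (x : nat -> V) (M : R) (F : set_system nat) :
  UltraFilter F -> (forall k, D (x k)) -> (forall k, a (x k) (x k) + b (x k) (x k) <= M) ->
  forall e, 0 < e -> exists2 A, F A & forall i j, A i -> A j -> b (x i - x j) (x i - x j) <= e.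
Proof.
move=> UF Dx xM e e0; have PF := @ultra_proper _ _ UF.
have M0 : 0 <= M by apply: le_trans (xM 0%N); rewrite addr_ge0 ?(form_ge0 fa) ?(form_ge0 fb).
have e'0 : 0 < e / (8 * (M + 1)) by rewrite divr_gt0// mulr_gt0//; lra.
have [N [l [K [K0 ll lK bl]]]] := cpct e'0.
have le2 i k : l i (x k) ^+ 2 <= K * M.
  apply: le_trans (lK i _ (Dx k)) _; rewrite ler_wpM2l//.
  by apply: le_trans (xM k); rewrite lerDr (form_ge0 fa).
have lb i k : `|l i (x k)| <= K * M + 1.
  have := le2 i k; rewrite -real_normK ?num_real// => H.
  have n0 := normr_ge0 (l i (x k)); nra.
have [p Hp] := choice (fun i => bounded_ultra_cvg UF (lb i)).
pose d := Num.sqrt (e / (8 * (N%:R + 1))).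
have N1 : 0 < N%:R + 1 :> R by rewrite ltr_wpDl.
have d2 : d ^+ 2 = e / (8 * (N%:R + 1)).
  by rewrite sqr_sqrtr// divr_ge0// ltW// mulr_gt0.
have d0 : 0 < d by rewrite sqrtr_gt0 divr_gt0// mulr_gt0.
exists (\bigcap_i [set k | `|l i (x k) - p i| < d]).
  have : F [set k | forall i, `|l i (x k) - p i| < d].
    by apply: (@filter_forall _ _ (fun i => [set k | `|l i (x k) - p i| < d])) => i;
      exact: Hp.
  by apply: filterS => k /= Hk i _; exact: Hk.
move=> i j Ai Aj; have Dij := subspaceB sD (Dx i) (Dx j).
apply: le_trans (bl _ Dij) _.
have E4 : a (x i - x j) (x i - x j) + b (x i - x j) (x i - x j) <= 4 * M.
  have := form_parallelogram sD fa (Dx i) (Dx j).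
  have := form_parallelogram sD fb (Dx i) (Dx j).
  have := form_ge0 fa (subspaceD sD (Dx i) (Dx j)).
  have := form_ge0 fb (subspaceD sD (Dx i) (Dx j)).
  have := xM i; have := xM j; lra.
have h1 : \sum_i0 l i0 (x i - x j) ^+ 2 <= \sum_(i0 < N) (4 * d ^+ 2).
  apply: ler_sum => q _; rewrite (functionalB sD (ll q))//.
  have := Ai q I; have := Aj q I; rewrite /= !ltr_norml => /andP[? ?] /andP[? ?]; nra.
move: h1; rewrite sumr_const card_ord d2 -mulr_natl => h1.
have h2 : N%:R * (4 * (e / (8 * (N%:R + 1)))) <= e / 2.
  have -> : N%:R * (4 * (e / (8 * (N%:R + 1)))) = e / 2 * (N%:R / (N%:R + 1)).
    by field; rewrite gt_eqF.
  by rewrite ger_pMr ?divr_gt0// ler_pdivrMr// mul1r lerDl.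
have h3 : e / (8 * (M + 1)) * (a (x i - x j) (x i - x j) + b (x i - x j) (x i - x j))
    <= e / 2.
  apply: (@le_trans _ _ (e / (8 * (M + 1)) * (4 * M))).
    by rewrite ler_wpM2l// ltW.
  have -> : e / (8 * (M + 1)) * (4 * M) = e / 2 * (M / (M + 1)).
    by field; rewrite gt_eqF//; lra.
  rewrite ger_pMr ?divr_gt0//; rewrite ler_pdivrMr ?mul1r; lra.
lra.
Qed.

Section minimizer.
Variable W : V -> Prop.
Hypotheses (sW : subspace_on W) (WD : forall x, W x -> D x).
Hypothesis clW : forall (x : nat -> V) y, (forall i, W (x i)) -> D y ->
  (forall e, 0 < e -> exists N, forall i, (N <= i)%N -> b (x i - y) (x i - y) <= e) ->
  W y.

Lemma form_on_sub f : form_on D f -> form_on W f.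
Proof.
move=> [fC f0 fl]; split=> // [x /WD|z /WD Dz c x y /WD Dx /WD Dy]; first exact: f0.
exact: fl.
Qed.

(** The direct method. A minimizing sequence is Cauchy for [b] by compactness; the
    parallelogram identity and minimality make it Cauchy for [a] too, so it
    converges by completeness. The Euler-Lagrange equation is the case of equality
    in the Cauchy-Schwarz inequality for the nonnegative form [a - s b]. *)
Lemma exists_minimizer w : W w -> 0 < b w w ->
  exists s y, [/\ W y, b y y = 1, 0 <= s, forall v, W v -> s * b v v <= a v v &
    forall v, W v -> a y v = s * b y v].
Proof.
move=> Ww bw0.
pose S := [set r | exists x, [/\ W x, b x x = 1 & a x x = r]].
have normalize v : W v -> 0 < b v v -> S (a v v / b v v).
  move=> Wv bv0; have Dv := WD Wv; exists ((Num.sqrt (b v v))^-1 *: v).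
  have sq : (Num.sqrt (b v v))^-1 ^+ 2 = (b v v)^-1 by rewrite exprVn sqr_sqrtr// ltW.
  split; first exact: subspaceZ.
    by rewrite (formZZ sD fb)// sq mulVf// gt_eqF.
  by rewrite (formZZ sD fa)// sq mulrC.
have S0 : S !=set0 by exists (a w w / b w w); exact: normalize.
have lbS : lbound S 0 by move=> _ [x [Wx _ <-]]; apply/(form_ge0 fa)/WD.
have infS : has_inf S by split=> //; exists 0.
pose s := inf S; have s0 : 0 <= s by apply: lb_le_inf.
have sab v : W v -> s * b v v <= a v v.
  move=> Wv; have := form_ge0 fb (WD Wv); rewrite le_eqVlt => /predU1P[<-|bv0].
    by rewrite mulr0 (form_ge0 fa)//; exact: WD.
  by rewrite -ler_pdivlMr//; apply: ge_inf; [exists 0|exact: normalize].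
pose eps (k : nat) : R := k.+1%:R^-1.
have eps0 k : 0 < eps k by rewrite invr_gt0.
have /choice[x xP] : forall k : nat, exists x, [/\ W x, b x x = 1 & a x x < s + eps k].
  move=> k; have [|_ [x [Wx bx <-]] ax] := @inf_adherent _ S (eps k) _ infS.
    exact: eps0.
  by exists x.
have Wx k : W (x k) by case: (xP k).
have Dx k : D (x k) by exact: WD.
have bx k : b (x k) (x k) = 1 by case: (xP k).
have ax k : a (x k) (x k) < s + eps k by case: (xP k).
have [F [UF subF]] := ultraFilterLemma (@eventually_filter).
have PF := @ultra_proper _ _ UF.
have EM k : a (x k) (x k) + b (x k) (x k) <= s + 2.
  rewrite bx; have := ax k; have : eps k <= 1 by rewrite invf_le1// ler1n.
  lra.
have eps_le i j : (i <= j)%N -> eps j <= eps i.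
  by move=> ij; rewrite lef_pV2 ?posrE// ler_nat.
have /choice[A AP] : forall k : nat, exists A, F A /\
    forall i j, A i -> A j -> b (x i - x j) (x i - x j) <= eps k.
  by move=> k; have [A FA HA] := bounded_energy_cauchy UF Dx EM (eps0 k); exists A.
(* a subsequence whose tails stay in the sets where the functionals are almost
   constant *)
have /choice[q qP] : forall k : nat, exists q, (k <= q)%N /\
    forall j, (j <= k)%N -> A j q.
  move=> k; have : F [set q | (k <= q)%N /\ forall j : 'I_k.+1, A j q].
    apply: filterI; first by apply: subF; exact: nbhs_infty_ge.
    by apply: (@filter_forall _ _ (fun j : 'I_k.+1 => A j)) => j; case: (AP j).
  move=> /filter_ex[q [kq Aq]]; exists q; split=> // j jk.
  by have := Aq (Ordinal (jk : (j < k.+1)%N)).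
have bcau k i j : (k <= i)%N -> (k <= j)%N ->
    b (x (q i) - x (q j)) (x (q i) - x (q j)) <= eps k.
  by move=> ki kj; apply: (AP k).2; [exact: (qP i).2|exact: (qP j).2].
have acau k i j : (k <= i)%N -> (k <= j)%N ->
    a (x (q i) - x (q j)) (x (q i) - x (q j)) <= (4 + s) * eps k.
  move=> ki kj; have := form_parallelogram sD fa (Dx (q i)) (Dx (q j)).
  have := form_parallelogram sD fb (Dx (q i)) (Dx (q j)).
  have := sab _ (subspaceD sW (Wx (q i)) (Wx (q j))).
  have := bcau _ _ _ ki kj.
  have := le_trans (ltW (ax (q i))) (lerD (lexx s) (eps_le _ _ (leq_trans ki (qP i).1))).
  have := le_trans (ltW (ax (q j))) (lerD (lexx s) (eps_le _ _ (leq_trans kj (qP j).1))).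
  rewrite !bx; set X := b (_ - _) _; set Y := b (_ + _) _.
  move=> h1 h2 h3 h4 h5 h6; have : s * X <= s * eps k by rewrite ler_wpM2l.
  have Y4 : Y = 4 - X by lra.
  rewrite Y4 mulrBr in h4; lra.
have small (C e : R) : 0 < e -> exists k, C * eps k <= e.
  move=> e0; exists (Num.truncn (`|C| / e)); rewrite ler_pdivrMr//.
  have := Num.Theory.truncnS_gt (`|C| / e).
  rewrite ltr_pdivrMr// => /ltW /(le_trans (ler_norm C)).
  by rewrite mulrC.
have [|y Dy yP] := cplt (fun i => Dx (q i)).
  move=> e e0; have [k ke] := small (5 + s) e e0; exists k => i j ki kj.
  apply: le_trans ke; have := bcau _ _ _ ki kj; have := acau _ _ _ ki kj; lra.
have byP e : 0 < e -> exists N, forall i, (N <= i)%N ->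
    b (x (q i) - y) (x (q i) - y) <= e.
  move=> /yP[N NP]; exists N => i /NP; apply: le_trans; rewrite lerDr.
  by rewrite (form_ge0 fa)//; exact: subspaceB.
have Wy : W y by apply: (clW _ Dy byP) => i; exact: Wx.
have negE (f : V -> V -> R) : form_on D f -> forall u v, D u -> D v -> f (u - v) (u - v) = f (v - u) (v - u).
  by move=> ff u v Du Dv; rewrite !(formB sD ff)// (formC ff v u); ring.
(* the values of both forms at the limit, up to an error that tends to 0 with t *)
have lim t : 0 < t -> [/\ a y y <= (1 + t) * (s + t) + t, b y y <= (1 + t) + t &
    1 <= (1 + t) * b y y + t].
  move=> t0; have [N NP] := yP (t / (1 + t^-1)) ltac:(by rewrite divr_gt0// addr_gt0 ?invr_gt0).
  have [k kt] := small 1 t t0; rewrite mul1r in kt.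
  pose i := maxn N k; have ti0 : 0 < 1 + t^-1 by rewrite addr_gt0 ?invr_gt0.
  have := NP i (leq_maxl _ _).
  set da := a (_ - _) _; set db := b (_ - _) _; rewrite ler_pdivlMr// => Ndab.
  have da0 : 0 <= (1 + t^-1) * da.
    by apply: mulr_ge0; [exact: ltW | apply: (form_ge0 fa); apply: subspaceB].
  have db0 : 0 <= (1 + t^-1) * db.
    by apply: mulr_ge0; [exact: ltW | apply: (form_ge0 fb); apply: subspaceB].
  have h1 := form_le_perturb sD fa t0 (Dx (q i)) Dy.
  have h2 := form_le_perturb sD fb t0 (Dx (q i)) Dy.
  have h3 := form_le_perturb sD fb t0 Dy (Dx (q i)).
  rewrite (negE b fb)// -/db in h3; rewrite -/da in h1; rewrite -/db bx in h2; rewrite bx in h3.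
  have h4 : a (x (q i)) (x (q i)) <= s + t.
    apply: le_trans (ltW (ax _)) _; rewrite lerD2l; apply: le_trans kt.
    by apply: eps_le; apply: leq_trans (qP i).1; exact: leq_maxr.
  have h5 : (1 + t) * a (x (q i)) (x (q i)) <= (1 + t) * (s + t).
    by rewrite ler_pM2l//; lra.
  split; lra.
have by1 : b y y = 1.
  apply/eqP; rewrite eq_le; apply/andP; split; apply/ler_addgt0Pr => e e0.
    have [] := lim (e / 2) ltac:(lra); lra.
  have [|_ h1 h2] := lim (Num.min (e / 4) 1) _.
    by rewrite lt_min ltr01 andbT; lra.
  have m1 : Num.min (e / 4) 1 <= e / 4 by rewrite ge_min lexx.
  have m2 : Num.min (e / 4) 1 <= 1 by rewrite ge_min lexx orbT.
  have m0 : 0 <= Num.min (e / 4) 1 by rewrite le_min ler01 andbT; lra.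
  move: (Num.min _ _) h1 h2 m1 m2 m0 => t; move: (b y y) => z; nra.
have ays : a y y = s.
  apply/eqP; rewrite eq_le; apply/andP; split; last first.
    by have := sab _ Wy; rewrite by1 mulr1.
  apply/ler_addgt0Pr => e e0.
  pose t := Num.min (e / (3 + s)) 1.
  have s30 : 0 < 3 + s by lra.
  have [|h1 _ _] := lim t _.
    by rewrite lt_min ltr01 andbT divr_gt0.
  have m1 : t * (3 + s) <= e by rewrite -ler_pdivlMr// ge_min lexx.
  have m2 : t <= 1 by rewrite ge_min lexx orbT.
  have m0 : 0 <= t by rewrite le_min ler01 andbT divr_ge0// ltW.
  move: t h1 m1 m2 m0 => t; move: (a y y) => z; nra.
exists s, y; split=> // v Wv.
(* the form a - s b is nonnegative on W and vanishes at y *)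
have [aC a0 al] := form_on_sub fa; have [bC b0 bl] := form_on_sub fb.
have fW : form_on W (fun u v => a u v - s * b u v).
  split=> [u z|u Wu|z Wz c u z' Wu Wz']; first by rewrite aC bC.
    by rewrite subr_ge0 sab.
  by rewrite al// bl//; ring.
have := form_CauchySchwarz sW fW Wy Wv; rewrite ays by1 mulr1 subrr mul0r => H.
have : (a y v - s * b y v) ^+ 2 == 0 by rewrite eq_le H sqr_ge0.
by rewrite sqrf_eq0 subr_eq0 => /eqP.
Qed.

End minimizer.

Section eigensystem_theory.
Variables (m : nat) (s : 'I_m -> R) (u : 'I_m -> V).
Hypothesis es : eigensystem s u.

Lemma eigensystem_coord c j : b (u j) (\sum_i c i *: u i) = c j.
Proof.
case: es => Du _ ub _; rewrite (functional_sum sD (form_funr fb (Du j)))//.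
rewrite (bigD1 j)//= big1 ?addr0 ?ub ?eqxx ?mulr1// => i ij.
by rewrite ub eq_sym (negbTE ij) mulr0.
Qed.

Lemma eigensystem_span c z : D z ->
  b (\sum_i c i *: u i) z = \sum_i c i * b (u i) z /\
  a (\sum_i c i *: u i) z = \sum_i c i * s i * b (u i) z.
Proof.
case: es => Du ua _ _ Dz; have [_ _ /(_ z Dz) bl] := fb.
have [_ _ /(_ z Dz) al] := fa.
rewrite (functional_sum sD bl)// (functional_sum sD al)//; split=> //.
by apply: eq_bigr => i _; rewrite ua// mulrA.
Qed.

(** Minimizing over this subspace produces the next eigenvector. *)
Definition eigen_perp v := D v /\ forall j, b (u j) v = 0.

Lemma eigen_perp_subspace : subspace_on eigen_perp.
Proof.
case: es => Du _ _ _; split; first by split; [exact: sD.1 | move=> j;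
  rewrite (functional0 sD (form_funr fb (Du j)))].
move=> c x y [Dx bx] [Dy by_]; split=> [|j]; first exact: sD.2.
by rewrite (form_funr fb (Du j))// bx by_ mulr0 addr0.
Qed.

Lemma eigen_perp_proj v : D v -> eigen_perp (v - \sum_i b (u i) v *: u i).
Proof.
case: (es) => Du _ _ _ Dv.
have Dp : D (\sum_i b (u i) v *: u i) by exact: subspace_sum.
split=> [|j]; first exact: subspaceB.
by rewrite (functionalB sD (form_funr fb (Du j)))// eigensystem_coord subrr.
Qed.

(** The span of the eigensystem and of [v] is a trial space: [a] and [b] are
    diagonal on it, and each [s j] is at most the quotient of [v], because [v] is
    orthogonal to the system. *)
Lemma trial_space_extend v C : eigen_perp v -> 0 < b v v -> a v v <= C * b v v ->
  trial_space m.+1 C.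
Proof.
move=> [Dv uv] bv0 vC; case: (es) => Du ua ub sab.
exists (fun i => if unlift ord_max i is Some j then u j else v); split.
  by move=> i; case: (unliftP ord_max i).
move=> c x.
pose p := \sum_i c (lift ord_max i) *: u i; pose d := c ord_max.
have xE : x = p + d *: v.
  rewrite /x big_ord_recr/= unlift_none; congr (_ + _).
  apply: eq_bigr => i _; have -> : widen_ord (leqnSn m) i = lift ord_max i.
    by apply/val_inj; rewrite /= /bump leqNgt ltn_ord.
  by rewrite liftK.
have Dp : D p by exact: subspace_sum.
have [bpv apv] := eigensystem_span (fun i => c (lift ord_max i)) Dv.
have [bpp app] := eigensystem_span (fun i => c (lift ord_max i)) Dp.
have bxx : b x x = \sum_i c (lift ord_max i) ^+ 2 + d ^+ 2 * b v v.
  rewrite xE (formDZ sD fb)// -/p in bpv bpp *.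
  rewrite bpv big1 => [|i _]; last by rewrite uv mulr0.
  rewrite bpp mulr0 addr0; congr (_ + _); apply: eq_bigr => i _.
  by rewrite eigensystem_coord expr2.
have axx : a x x = \sum_i c (lift ord_max i) ^+ 2 * s i + d ^+ 2 * a v v.
  rewrite xE (formDZ sD fa)// -/p in apv app *.
  rewrite apv big1 => [|i _]; last by rewrite uv mulr0.
  rewrite app mulr0 addr0; congr (_ + _); apply: eq_bigr => i _.
  by rewrite eigensystem_coord mulrAC expr2.
have S0 : 0 <= \sum_i c (lift ord_max i) ^+ 2 by apply: sumr_ge0 => i _; exact: sqr_ge0.
have d0 := sqr_ge0 d; split.
  rewrite axx bxx mulrDr lerD//; last by rewrite mulrCA ler_wpM2l.
  rewrite mulr_sumr ler_sum// => i _; rewrite mulrC ler_wpM2r ?sqr_ge0//.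
  by rewrite -(ler_pM2r bv0); apply: le_trans vC; exact: sab.
rewrite bxx => /eqP; rewrite paddr_eq0//; last by rewrite mulr_ge0// ltW.
rewrite mulf_eq0 (gt_eqF bv0) orbF sqrf_eq0 => /andP[+ /eqP d_eq0].
rewrite psumr_eq0; last by move=> i _; exact: sqr_ge0.
move=> /allP c0 i; case: (unliftP ord_max i) => [j ->|->//].
by apply/eqP; rewrite -sqrf_eq0; apply: (implyP (c0 j (mem_index_enum _))).
Qed.

End eigensystem_theory.

Lemma trial_space_leq m k C : (m <= k)%N -> trial_space k C -> trial_space m C.
Proof.
move=> mk [v [Dv vC]]; exists (fun i => v (widen_ord mk i)); split=> // c x.
pose c' (i : 'I_k) := if insub (val i) is Some j then c j else 0.
have c'E i : c' (widen_ord mk i) = c i.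
  by rewrite /c'/= insubT//= => im; congr c; exact/val_inj.
have xE : x = \sum_i c' i *: v i.
  rewrite (bigID (fun i : 'I_k => (i < m)%N))/= [X in _ + X]big1 ?addr0.
    rewrite (big_ord_narrow mk); apply: eq_bigr => i _.
    by rewrite -[in LHS]c'E; congr (_ *: v _); exact/val_inj.
  move=> i im; rewrite /c'; case: insubP => [j|_]; last by rewrite scale0r.
  by rewrite (negbTE im).
have [h1 h2] := vC c'; rewrite -xE in h1 h2; split=> // bx i.
by rewrite -c'E h2.
Qed.

(** A homogeneous linear system of [m] equations in [m + 1] unknowns has a nonzero
    solution. *)
Lemma trial_space_meet m C (l : 'I_m -> V -> R) :
  (forall j, functional_on D (l j)) -> trial_space m.+1 C ->
  exists x, [/\ D x, forall j, l j x = 0, 0 < b x x & a x x <= C * b x x].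
Proof.
move=> ll [v [Dv vC]].
pose A : 'M[R]_(m.+1, m) := \matrix_(i, j) l j (v i).
have : kermx A != 0 :> 'M[R]_m.+1.
  rewrite kermx_eq0 -row_leq_rank -ltnNge ltnS; exact: rank_leq_col.
move=> /rowV0Pn[c /sub_kermxP cA] c0.
exists (\sum_i c ord0 i *: v i); have [h1 h2] := vC (c ord0).
have Dx : D (\sum_i c ord0 i *: v i) by exact: subspace_sum.
split=> //.
  move=> j; rewrite (functional_sum sD (ll j))//.
  have := congr1 (fun M : 'M[R]_(1, m) => M ord0 j) cA; rewrite !mxE => cAj.
  rewrite -[RHS]cAj; by apply: eq_bigr => i _; rewrite !mxE.
rewrite lt_neqAle (form_ge0 fb)// andbT eq_sym; apply/eqP => /h2 c00.
by case/negP: c0; apply/eqP/rowP => i; rewrite c00 !mxE.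
Qed.

(** Induction on [m]: minimize the Rayleigh quotient on the orthogonal of the
    eigensystem found so far. The minimizer satisfies the eigenvalue equation
    against every vector, since its equation against the earlier eigenvectors is
    trivially true, and the minimum is at most [C] because the trial space meets
    that orthogonal. *)
Theorem exists_eigensystem m C : trial_space m C ->
  exists (s : 'I_m -> R) (u : 'I_m -> V), eigensystem s u /\ forall j, s j <= C.
Proof.
elim: m => [|m IH] tC.
  exists (fun _ => 0), (fun _ => 0); split=> [|[]//].
  by split=> [[]|[]|[]|? ? ? []]//.
have [s [u [es sC]]] := IH (trial_space_leq (leqnSn m) tC).
case: (es) => Du ua ub sab.
have [w [Dw uw bw0 _]] := trial_space_meet (fun j => form_funr fb (Du j)) tC.
have clW (x : nat -> V) y : (forall i, eigen_perp u (x i)) -> D y ->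
    (forall e, 0 < e -> exists N, forall i, (N <= i)%N -> b (x i - y) (x i - y) <= e) ->
    eigen_perp u y.
  move=> Wx Dy xy; split=> // j.
  suff : b (u j) y ^+ 2 <= 0 by rewrite le_eqVlt ltNge sqr_ge0 orbF sqrf_eq0 => /eqP.
  apply/ler_addgt0Pr => e e0; rewrite add0r.
  have [N /(_ N (leqnn _))] := xy e e0; apply: le_trans.
  have [Dx ux] := Wx N.
  have := form_CauchySchwarz sD fb (Du j) (subspaceB sD Dx Dy).
  by rewrite ub eqxx mul1r (functionalB sD (form_funr fb (Du j)))// ux sub0r sqrrN.
have [|s' [y [[Dy uy] by1 s'0 s'ab ay]]] :=
  exists_minimizer (eigen_perp_subspace es) (fun x => @proj1 _ _) clW _ bw0.
  by [].
have s's j : s j <= s'.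
  by have := sab _ Dy uy j; rewrite ay// by1 !mulr1.
have s'C : s' <= C.
  have [x [Dx ux bx0 ax]] := trial_space_meet (fun j => form_funr fb (Du j)) tC.
  by rewrite -(ler_pM2r bx0); apply: le_trans ax; exact: s'ab.
exists (fun i => if unlift ord_max i is Some j then s j else s').
exists (fun i => if unlift ord_max i is Some j then u j else y); split; last first.
  by move=> i; case: (unliftP ord_max i).
split=> [i|i v Dv|i j|v Dv vu i].
- by case: (unliftP ord_max i).
- case: (unliftP ord_max i) => [j _|_]; first exact: ua.
  have [Dv0 uv0] := eigen_perp_proj es Dv.
  set p := \sum_i _ in Dv0 uv0; have Dp : D p by exact: subspace_sum.
  have -> : v = (v - p) + p by rewrite subrK.
  rewrite (functionalD (form_funr fa Dy))// (functionalD (form_funr fb Dy))//.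
  rewrite ay// (formC fa y p) (formC fb y p).
  have [-> ->] := eigensystem_span es (fun i => b (u i) v) Dy.
  by rewrite !big1 ?addr0// => k _; rewrite uy mulr0.
- case: (unliftP ord_max i) => [i' ->|->]; case: (unliftP ord_max j) => [j' ->|->].
  + by rewrite ub (inj_eq lift_inj).
  + by rewrite uy eq_sym (negbTE (neq_lift _ _)).
  + by rewrite (formC fb) uy (negbTE (neq_lift _ _)).
  + by rewrite by1 eqxx.
have uv j : b (u j) v = 0 by have := vu (lift ord_max j); rewrite liftK.
case: (unliftP ord_max i) => [j _|_]; first exact: sab.
exact: s'ab.
Qed.

End spectral.

(** * Boxes and Lebesgue measure on row vectors *)

Section boxes.
Context (R : realType).

Lemma coord_le_norm n (x : 'rV[R]_n) i : `|x ord0 i| <= `|x|.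
Proof.
by rewrite [leRHS]mx_normrE; apply: (le_bigmax _ (fun ij => `|x ij.1 ij.2|) (ord0, i)).
Qed.

Lemma norm_le_coord n (x : 'rV[R]_n) (r : R) : 0 <= r ->
  (forall i, `|x ord0 i| <= r) -> `|x| <= r.
Proof.
move=> r0 xr; rewrite [leLHS]mx_normrE; apply/bigmax_leP; split=> // -[i j] _ /=.
by rewrite ord1.
Qed.

Definition boxset n (A : 'I_n -> set R) : set 'rV[R]_n :=
  [set x | forall i, A i (x ord0 i)].

Definition open_box n (a b : 'I_n -> R) : set 'rV[R]_n :=
  boxset (fun i => `]a i, b i[%classic).

Lemma boxsetE n (A : 'I_n -> set R) :
  boxset A = \bigcap_(i in [set: 'I_n]) ((fun x : 'rV[R]_n => x ord0 i) @^-1` A i).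
Proof. by apply/seteqP; split=> x /= Ax i; [move=> _; exact: Ax | exact: (Ax i I)]. Qed.

Lemma measurable_coord_preimage n (i : 'I_n) (Y : set R) : measurable Y ->
  measurable ((fun x : 'rV[R]_n => x ord0 i) @^-1` Y).
Proof. by move=> mY; have := measurable_coord_rV i measurableT mY; rewrite setTI. Qed.

Lemma measurable_boxset n (A : 'I_n -> set R) : (forall i, measurable (A i)) ->
  measurable (boxset A).
Proof.
move=> mA; rewrite boxsetE; apply: fin_bigcap_measurable => // i _.
exact: measurable_coord_preimage.
Qed.

Lemma lebesgue_boxset n (A : 'I_n -> set R) (l : 'I_n -> R) :
  (forall i, measurable (A i)) ->
  (forall i, lebesgue_measure (A i) = (l i)%:E :> \bar R) ->
  lebesgue_rV R n (boxset A) = (\prod_i l i)%:E.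
Proof.
elim: n A l => [|n IH] A l mA lA.
  rewrite /= big_ord0 /dirac/= indicE mem_set// => -[]//.
rewrite big_ord_recl EFinM -lA -(IH (fun i => A (lift ord0 i)))//.
rewrite -product_measure1E; [|exact: mA|by apply: measurable_boxset => i; exact: mA].
rewrite /= /rV_cons_measure /pushforward; congr (_ _).
apply/seteqP; split=> -[t y] /=.
  move=> Ax; split; first by have := Ax ord0; rewrite /rV_cons mxE unlift_none.
  by move=> i; have := Ax (lift ord0 i); rewrite /rV_cons mxE liftK.
move=> [At Ay] i; rewrite /rV_cons mxE; case: (unliftP ord0 i) => [j|] ->//.
Qed.

Lemma lebesgue_itvoo (a b : R) :
  lebesgue_measure `]a, b[%classic = (Num.max (b - a) 0)%:E :> \bar R.
Proof.
rewrite lebesgue_measure_itv/= lte_fin; case: ltP => ab.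
  by rewrite -EFinB max_l// subr_ge0 ltW.
by rewrite max_r// subr_le0.
Qed.

Lemma lebesgue_open_box n (a b : 'I_n -> R) :
  lebesgue_rV R n (open_box a b) = (\prod_i Num.max (b i - a i) 0)%:E.
Proof. by apply: lebesgue_boxset => i; [exact: measurable_itv | exact: lebesgue_itvoo]. Qed.

Lemma measurable_open_box n (a b : 'I_n -> R) : measurable (open_box a b).
Proof. by apply: measurable_boxset => i; exact: measurable_itv. Qed.

Definition open_boxes n : set (set 'rV[R]_n) := [set B | exists a b, B = open_box a b].

Lemma setI_closed_open_boxes n : setI_closed (@open_boxes n).
Proof.
move=> _ _ [a [b ->]] [c [d ->]].
exists (fun i => Num.max (a i) (c i)), (fun i => Num.min (b i) (d i)).
apply/seteqP; split=> x /=.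
  move=> [xab xcd] i; have := xab i; have := xcd i; rewrite /= !in_itv/=.
  by rewrite gt_max lt_min => /andP[-> ->] /andP[-> ->].
by move=> H; split=> i; have := H i; rewrite /= !in_itv/= gt_max lt_min;
  move=> /andP[/andP[h1 h2] /andP[h3 h4]]; apply/andP.
Qed.

Lemma cover_open_boxes n :
  \bigcup_k open_box (fun _ : 'I_n => - k%:R) (fun _ => k%:R) = setT :> set 'rV[R]_n.
Proof.
apply/seteqP; split=> // x _; exists (Num.truncn `|x|).+1 => // i /=.
rewrite in_itv/= -ltr_norml; apply: le_lt_trans (Num.Theory.truncnS_gt _).
exact: coord_le_norm.
Qed.

Lemma measurable_rV_open_boxes n :
  measurable = <<s @open_boxes n >> :> set (set 'rV[R]_n).
Proof.
apply/seteqP; split; last first.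
  apply: smallest_sub; first exact: sigma_algebra_measurable.
  by move=> _ [a [b ->]]; exact: measurable_open_box.
apply: smallest_sub; first exact: smallest_sigma_algebra.
rewrite -bigcup_seq/= => A [i /= _ [Y mY <-]]; rewrite setTI.
pose S := [set Y : set R | <<s @open_boxes n >>
  ((fun x : 'rV[R]_n => x ord0 i) @^-1` Y)].
suff : measurable `<=` S by exact.
have sS : sigma_algebra setT S.
  split; rewrite /S/=.
  - by rewrite preimage_set0; exact: sigma_algebra0.
  - by move=> B SB; rewrite setTD preimage_setC; exact: sigma_algebraC.
  - by move=> F SF; rewrite preimage_bigcup; exact: sigma_algebra_bigcup.
rewrite [X in X `<=` _](measurable_realfun.RGenOpens.measurableE R); apply: smallest_sub => // _ [a [b ->]].
rewrite /S/=.
have -> : (fun x : 'rV[R]_n => x ord0 i) @^-1` `]a, b[%classic =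
  \bigcup_k open_box (fun j => if j == i then a else - k%:R)
                     (fun j => if j == i then b else k%:R).
  apply/seteqP; split=> x /=.
    move=> xab; exists (Num.truncn `|x|).+1 => // j /=; case: eqP => [->//|_].
    rewrite in_itv/= -ltr_norml; apply: le_lt_trans (Num.Theory.truncnS_gt _).
    exact: coord_le_norm.
  by move=> [k _ /(_ i)]/=; rewrite eqxx.
apply: sigma_algebra_bigcup => k; apply: sub_sigma_algebra.
by exists (fun j => if j == i then a else - k%:R), (fun j => if j == i then b else k%:R).
Qed.

(** Open boxes form a pi-system that generates the sigma-algebra, so they determine
    the measure. The scaling and translation rules for Lebesgue measure are read off
    from boxes in this way. *)
Lemma lebesgue_rV_unique n (m : {measure set 'rV[R]_n -> \bar R}) :
  (forall a b, m (open_box a b) = (\prod_i Num.max (b i - a i) 0)%:E) ->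
  forall A, measurable A -> m A = lebesgue_rV R n A.
Proof.
move=> mE A mA; apply: (measure_unique (@open_boxes n)
  (fun k => open_box (fun _ => - k%:R) (fun _ => k%:R))) => //.
- exact: measurable_rV_open_boxes.
- exact: setI_closed_open_boxes.
- by move=> k; exists (fun=> - k%:R), (fun=> k%:R).
- exact: cover_open_boxes.
- by move=> _ [a [b ->]]; rewrite mE; exact/esym/lebesgue_open_box.
- by move=> k; rewrite mE ltry.
Qed.

End boxes.

Section topology_rV.
Context (R : realType) (n : nat).

Lemma ball_rV (x y : 'rV[R]_n) (e : R) : 0 < e ->
  (ball x e y <-> forall i, `|x ord0 i - y ord0 i| < e).
Proof.
move=> e0; split=> [[_ xy] i|xy]; first exact: xy.
by split=> // i j; rewrite ord1; exact: xy.
Qed.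

(** The measurable structure is the product one, so this needs an argument: an open
    set is the union of the countably many boxes with rational centre and radius [1
    / k] that it contains. *)
Lemma open_measurable_rV (U : set 'rV[R]_n) : open U -> measurable U.
Proof.
move=> oU.
pose B (q : 'rV[rat]_n * nat) : set 'rV[R]_n :=
  open_box (fun i => ratr (q.1 ord0 i) - q.2.+1%:R^-1)
           (fun i => ratr (q.1 ord0 i) + q.2.+1%:R^-1).
have -> : U = \bigcup_(q in [set q | B q `<=` U]) B q.
  apply/seteqP; split=> [x Ux|x [q BU /BU]//].
  have /nbhs_ballP[e /= e0 eU] := open_nbhs_nbhs (conj oU Ux).
  pose k := Num.truncn (2 / e); have k2 : 2 * k.+1%:R^-1 < e.
    have := Num.Theory.truncnS_gt (2 / e); rewrite -/k ltr_pdivrMr// => H.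
    by rewrite ltr_pdivrMr// mulrC.
  have k0 : 0 < k.+1%:R^-1 :> R by rewrite invr_gt0.
  have /choice[q qP] : forall i : 'I_n, exists q : rat,
      ratr q \in `](x ord0 i), (x ord0 i + k.+1%:R^-1)[.
    by move=> i; apply: rat_in_itvoo; rewrite ltrDl.
  exists (\row_i q i, k).
    move=> y By; apply: eU; apply/ball_rV => // i.
    have := By i; have := qP i; rewrite /= !in_itv/= !mxE => /andP[h1 h2] /andP[h3 h4].
    rewrite ltr_norml; move: k2 h1 h2 h3 h4.
    by move: (_^-1) => z *; apply/andP; split; lra.
  move=> i; have := qP i; rewrite /= !in_itv/= !mxE => /andP[h1 h2].
  by rewrite ltrBlDr h2/= (lt_trans h1)// ltrDl.
rewrite bigcup_mkcond; apply: countable_bigcupT_measurable => //.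
by move=> q; case: ifPn => // _; exact: measurable_open_box.
Qed.

End topology_rV.

Section affine.
Context (R : realType) (n : nat) (t : R) (z : 'rV[R]_n).
Local Notation mu := (lebesgue_rV R n).

Definition affine (x : 'rV[R]_n) : 'rV[R]_n := t *: x + z.

Lemma measurable_affine : measurable_fun setT affine.
Proof.
apply: measurable_fun_rV => i; under eq_fun do rewrite !mxE.
apply: measurable_funD => //; apply: measurable_funM => //.
exact: measurable_coord_rV.
Qed.

Hypothesis t0 : 0 < t.

Lemma affine_open_box (a b : 'I_n -> R) : affine @^-1` open_box a b =
  open_box (fun i => (a i - z ord0 i) / t) (fun i => (b i - z ord0 i) / t).
Proof.
apply/seteqP; split=> x /= xab i; have := xab i; rewrite /= !in_itv/= !mxE.
  by move=> /andP[h1 h2]; rewrite ltr_pdivrMr// ltr_pdivlMr// ltrBlDr ltrBrDr mulrC h1 h2.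
by rewrite ltr_pdivrMr// ltr_pdivlMr// ltrBlDr ltrBrDr mulrC.
Qed.

Lemma lebesgue_affine A : measurable A ->
  mu (affine @^-1` A) = ((t ^+ n)^-1%:E * mu A)%E.
Proof.
move=> mA.
have tn0 : 0 < t ^+ n by rewrite exprn_gt0.
pose m : {measure set 'rV[R]_n -> \bar R} := mscale (NngNum (ltW tn0))
  (measure_function_pushforward__canonical__measure_function_Measure mu measurable_affine).
suff <- : m A = mu A.
  change (mu (affine @^-1` A) = (t ^+ n)^-1%:E * ((t ^+ n)%:E * mu (affine @^-1` A)))%E.
  by rewrite muleA -EFinM mulVf ?mul1e// gt_eqF.
apply: lebesgue_rV_unique => // a b.
change ((t ^+ n)%:E * mu (affine @^-1` open_box a b) =
  (\prod_i Num.max (b i - a i) 0)%:E)%E.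
rewrite affine_open_box lebesgue_open_box -EFinM; congr EFin.
have -> : t ^+ n = \prod_(i < n) t by rewrite prodr_const card_ord.
rewrite -big_split/=; apply: eq_bigr => i _.
rewrite maxr_pMr ?(ltW t0)// mulr0; congr Num.max; field.
by rewrite gt_eqF.
Qed.

Lemma ge0_integral_affine (f : 'rV[R]_n -> \bar R) : measurable_fun setT f ->
  (forall x, (0 <= f x)%E) ->
  (\int[mu]_x f (affine x) = (t ^+ n)^-1%:E * \int[mu]_x f x)%E.
Proof.
move=> mf f0.
have tn0 : 0 <= (t ^+ n)^-1 by rewrite invr_ge0 exprn_ge0// ltW.
have := @ge0_integral_pushforward _ _ _ _ R _ measurable_affine mu setT f measurableT mf
  (fun y _ => f0 y).
rewrite preimage_setT => <-.
rewrite -(ge0_integral_mscale _ _ (NngNum tn0))//.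
apply: eq_measure_integral => [|maff A mA _]; first exact: measurable_affine.
exact: lebesgue_affine.
Qed.

End affine.

(** * Square integrable functions *)

Lemma fun_linE (T : Type) (R : realType) (c : R) (u v : T -> R) x :
  (c *: u + v) x = c * u x + v x.
Proof. by []. Qed.

Section L2_theory.
Context (R : realType) (n : nat) (U : set 'rV[R]_n) (mU : measurable U).
Local Notation mu := (lebesgue_rV R n).
Implicit Types u v w : 'rV[R]_n -> R.

Lemma L2_measurable u : L2 U u -> measurable_fun U u.
Proof. by case. Qed.

Lemma L2_lty u : L2 U u -> (\int[mu]_(x in U) (u x ^+ 2)%:E < +oo)%E.
Proof. by move=> [_ /integrable_lty]; exact. Qed.

Lemma measurable_sqr u : measurable_fun U u ->
  measurable_fun U (fun x => (u x ^+ 2)%:E).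
Proof. by move=> mu_; apply/measurable_EFinP; exact: measurable_funX. Qed.

Lemma L2P u : measurable_fun U u -> (\int[mu]_(x in U) (u x ^+ 2)%:E < +oo)%E ->
  L2 U u.
Proof.
move=> mu_ lt; split=> //; apply/integrableP; split; first exact: measurable_sqr.
by under eq_integral do rewrite gee0_abs ?lee_fin ?sqr_ge0//.
Qed.

Lemma L2M_integrable u v : L2 U u -> L2 U v ->
  mu.-integrable U (fun x => (u x * v x)%:E).
Proof.
move=> [mu_ iu] [mv iv].
apply: (@le_integrable _ _ _ _ _ mU _ (fun x => (u x ^+ 2)%:E + (v x ^+ 2)%:E)%E).
- by apply/measurable_EFinP; exact: measurable_funM.
- move=> x Ux; rewrite -EFinD !abse_EFin lee_fin.
  rewrite [leRHS]ger0_norm ?addr_ge0 ?sqr_ge0// normrM.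
  have := sqr_ge0 (`|u x| - `|v x|); rewrite sqrrB !real_normK ?num_real//.
  have := sqr_ge0 (u x); have := sqr_ge0 (v x); lra.
- exact: integrableD.
Qed.

Lemma L2_lin (c : R) u v : L2 U u -> L2 U v -> L2 U (c *: u + v).
Proof.
move=> u2 v2; have [mu_ _] := u2; have [mv _] := v2.
have mcuv : measurable_fun U (c *: u + v).
  by apply: measurable_funD => //; apply: measurable_funM.
split=> //.
have -> : (fun x => ((c *: u + v) x ^+ 2)%:E) =
   (fun x => (c ^+ 2)%:E * (u x * u x)%:E +
             ((2 * c)%:E * (u x * v x)%:E + (v x * v x)%:E))%E.
  apply/funext => x; rewrite -!EFinM -!EFinD; congr EFin.
  rewrite fun_linE; ring.
by apply: integrableD => //; [|apply: integrableD => //]; try apply: integrableZl => //;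
  exact: L2M_integrable.
Qed.

Lemma L2_0 : L2 U (0 : 'rV[R]_n -> R).
Proof.
split; first exact: measurable_cst.
by under eq_fun do rewrite expr0n/=; exact: integrable0.
Qed.

Lemma L2Z (c : R) u : L2 U u -> L2 U (c *: u).
Proof. by move=> u2; rewrite -[c *: u]addr0; exact: L2_lin L2_0. Qed.

Lemma L2D u v : L2 U u -> L2 U v -> L2 U (u + v).
Proof. by move=> u2 v2; rewrite -[u]scale1r; exact: L2_lin. Qed.

Lemma L2B u v : L2 U u -> L2 U v -> L2 U (u - v).
Proof. by move=> u2 v2; rewrite addrC -scaleN1r; exact: L2_lin. Qed.

Lemma L2dotC u v : L2dot U u v = L2dot U v u.
Proof. by apply: eq_Rintegral => x _; rewrite mulrC. Qed.

Lemma L2dot_ge0 u : 0 <= L2dot U u u.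
Proof. by apply: Rintegral_ge0 => x _; rewrite -expr2 sqr_ge0. Qed.

Lemma L2dot_lin c u v w : L2 U u -> L2 U v -> L2 U w ->
  L2dot U (c *: u + v) w = c * L2dot U u w + L2dot U v w.
Proof.
move=> u2 v2 w2; rewrite /L2dot -RintegralZl//; last exact: L2M_integrable.
rewrite -RintegralD//; last exact: L2M_integrable.
  apply: eq_Rintegral => x _; rewrite fun_linE; ring.
have -> : EFin \o (fun x => c * (u x * w x)) = (fun x => c%:E * (u x * w x)%:E)%E.
  by apply/funext => x /=; rewrite EFinM.
by apply: integrableZl => //; exact: L2M_integrable.
Qed.

Lemma L2dotE u : L2 U u -> (L2dot U u u)%:E = (\int[mu]_(x in U) (u x ^+ 2)%:E)%E.
Proof.
move=> u2; rewrite /L2dot /Rintegral.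
under eq_integral do rewrite -expr2.
rewrite fineK// ge0_fin_numE; first exact: L2_lty.
by apply: integral_ge0 => x _; rewrite lee_fin sqr_ge0.
Qed.

Lemma L2_form : form_on (L2 U) (@L2dot R n U).
Proof.
split=> [u v|u _|w w2 c u v u2 v2]; [exact: L2dotC|exact: L2dot_ge0|].
exact: L2dot_lin.
Qed.

Lemma L2_subspace : subspace_on (L2 U).
Proof. by split; [exact: L2_0 | move=> *; exact: L2_lin]. Qed.

Lemma L2sqdistE u v : L2sqdist U u v = L2dot U (u - v) (u - v).
Proof. by apply: eq_Rintegral => x _; rewrite expr2. Qed.

(** Elements of [L2] are functions, not classes, so the inner product is only
    semidefinite; this lemma identifies its kernel. *)
Lemma L2dot_eq0P u : L2 U u -> L2dot U u u = 0 <-> {ae mu, forall x, U x -> u x = 0}.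
Proof.
move=> u2; have [mu_ _] := u2; have H := L2dotE u2.
have E : (\int[mu]_(x in U) (u x ^+ 2)%:E = \int[mu]_(x in U) `|(u x ^+ 2)%:E|)%E.
  by apply: eq_integral => x _; rewrite gee0_abs ?lee_fin ?sqr_ge0.
have A := ae_eq_integral_abs mu mU (measurable_sqr mu_).
split=> [u0|ae0].
  have /A : (\int[mu]_(x in U) `|(u x ^+ 2)%:E|)%E = 0 by rewrite -E -H u0.
  apply: filterS => x /= + Ux => /(_ Ux) [] /eqP.
  by rewrite sqrf_eq0 => /eqP.
apply: EFin_inj; rewrite H E; apply/A; apply: filterS ae0 => x /= + Ux => /(_ Ux) ->.
by rewrite expr0n.
Qed.

End L2_theory.

Section L2_restriction.
Context (R : realType) (n : nat) (U V : set 'rV[R]_n).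
Hypotheses (mU : measurable U) (mV : measurable V) (VU : V `<=` U).
Local Notation mu := (lebesgue_rV R n).
Implicit Types u v w : 'rV[R]_n -> R.

Lemma L2_restr u : L2 U u -> L2 V u.
Proof.
by move=> [mu_ iu]; split; [exact: measurable_funS mu_ | exact: integrableS iu].
Qed.

Lemma L2dot_extl u w : L2dot U (u \_ V) w = L2dot V u w.
Proof.
rewrite /L2dot -[in RHS](setIidr VU) Rintegral_mkcondr; apply: eq_Rintegral => x _.
by rewrite /patch; case: ifPn => // _; rewrite /= mul0r.
Qed.

Lemma L2_ext u : L2 V u -> L2 U (u \_ V).
Proof.
move=> [mu_ iu]; split.
  apply: measurable_funS measurableT _ _ => //.
  exact/(measurable_restrictT _ mV).
have -> : (fun x => ((u \_ V) x ^+ 2)%:E) = (fun x => (u x ^+ 2)%:E) \_ V.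
  by apply/funext => x; rewrite /patch; case: ifPn => // _; rewrite /= expr0n.
apply: (@integrableS _ _ _ mu setT) => //.
exact/(integrable_mkcond _ mV).
Qed.

Lemma L2dot_le u : L2 U u -> L2dot V u u <= L2dot U u u.
Proof.
move=> u2; rewrite -lee_fin !L2dotE//; last exact: L2_restr.
apply: ge0_subset_integral => //; first by apply: measurable_sqr; case: u2.
by move=> x _; rewrite lee_fin sqr_ge0.
Qed.

End L2_restriction.

Lemma L2_cst_finite (R : realType) n (A : set 'rV[R]_n) (m : R) :
  measurable A -> lebesgue_rV R n A = m%:E ->
  L2 A (cst 1 : _ -> R) /\ L2dot A (cst 1) (cst 1) = m.
Proof.
move=> mA Am.
have L1 : L2 A (cst 1 : _ -> R).
  split=> //; apply/integrableP; split.
    by apply/measurable_EFinP; apply: measurable_funX; exact: measurable_cst.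
  under eq_integral do rewrite /= expr1n normr1.
  by rewrite integral_cst// mul1e [X in (X < _)%E]Am ltry.
split=> //; apply/EFin_inj; rewrite (L2dotE mA L1).
under eq_integral do rewrite /= expr1n.
by rewrite integral_cst// mul1e [LHS]Am.
Qed.

(** Increments of size at most [sqrt S / 2 ^ m] are summable, and the tail of the
    geometric series bounds the distance to the limit. Applied pointwise to a fast
    Cauchy sequence of functions. *)
Lemma summable_increments_cvg (R : realType) (f : nat -> R) (S : R) :
  (forall m, 4 ^+ m * (f m.+1 - f m) ^+ 2 <= S) ->
  cvgn f /\ forall m, 4 ^+ m * (limn f - f m) ^+ 2 <= 4 * S.
Proof.
move=> fS; have S0 : 0 <= S by apply: le_trans (fS 0%N); rewrite mulr_ge0 ?sqr_ge0.
have h2 m : (2^-1 : R) ^+ m * 2 ^+ m = 1 by rewrite -exprMn mulVf ?expr1n.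
have h0 m : 0 < (2^-1 : R) ^+ m by rewrite exprn_gt0.
have df m : `|f m.+1 - f m| <= Num.sqrt S * 2^-1 ^+ m.
  rewrite -ler_sqr ?nnegrE ?normr_ge0 ?mulr_ge0 ?sqrtr_ge0 ?(ltW (h0 m))//.
  rewrite real_normK ?num_real// exprMn sqr_sqrtr//.
  have := fS m; have -> : 4 ^+ m = (2 ^+ m) ^+ 2 :> R by rewrite exprAC; congr (_ ^+ _); rewrite -natrX.
  move: (h2 m) (h0 m); set a := _^-1 ^+ m; set b := 2 ^+ m => ab a0 H.
  have : a ^+ 2 * (b ^+ 2 * (f m.+1 - f m) ^+ 2) <= a ^+ 2 * S.
    by rewrite ler_wpM2l ?sqr_ge0.
  have -> : a ^+ 2 * (b ^+ 2 * (f m.+1 - f m) ^+ 2) = (a * b) ^+ 2 * (f m.+1 - f m) ^+ 2.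
    by ring.
  by rewrite ab expr1n mul1r [a ^+ 2 * S]mulrC.
have cf : cvgn f.
  have -> : f = (fun=> f 0%N) + series (telescope f).
    by apply/funext => k; rewrite telescopeK addrC subrK.
  apply: is_cvgD; first exact: is_cvg_cst.
  apply: normed_cvg.
  apply: (@series_le_cvg _ _ (geometric (Num.sqrt S) 2^-1)) => [m|m|m|].
  - exact: normr_ge0.
  - by rewrite /geometric/= mulr_ge0 ?sqrtr_ge0// ltW.
  - exact: df.
  - by apply: is_cvg_geometric_series; rewrite ger0_norm ?invr_ge0// invf_lt1// ltr1n.
split=> // m.
have dj j : `|f (m + j)%N - f m| <= Num.sqrt S * 2^-1 ^+ m * (2 - 2 * 2^-1 ^+ j).
  elim: j => [|j IH]; first by rewrite addn0 subrr normr0 expr0 mulr1 subrr mulr0.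
  rewrite addnS -(subrKA (f (m + j)%N)); apply: le_trans (ler_normD _ _) _.
  apply: le_trans (lerD (df _) IH) _; rewrite exprD exprS.
  by rewrite le_eqVlt; apply/orP; left; apply/eqP; field.
have db l : (m <= l)%N -> `|f l - f m| <= Num.sqrt S * 2^-1 ^+ m * 2.
  move=> ml; rewrite -(subnKC ml); apply: le_trans (dj _) _.
  rewrite ler_wpM2l ?mulr_ge0 ?sqrtr_ge0 ?(ltW (h0 m))//.
  by rewrite lerBlDr lerDl mulr_ge0// ltW.
have lb : `|limn f - f m| <= Num.sqrt S * 2^-1 ^+ m * 2.
  have cc : (fun l => `|f l - f m|) @ \oo --> `|limn f - f m|.
    by apply: cvg_norm; apply: cvgB => //; exact: cvg_cst.
  apply: (cvgr_to_le cc); exists m => // l /= ml; exact: db.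
have -> : 4 ^+ m = (2 ^+ m) ^+ 2 :> R by rewrite exprAC; congr (_ ^+ _); rewrite -natrX.
rewrite -exprMn -real_normK ?num_real// normrM ger0_norm ?exprn_ge0//.
have : 2 ^+ m * `|limn f - f m| <= Num.sqrt S * 2.
  apply: le_trans (ler_wpM2l _ lb) _; first by rewrite exprn_ge0.
  have -> : 2 ^+ m * (Num.sqrt S * 2^-1 ^+ m * 2) = Num.sqrt S * 2 * (2^-1 ^+ m * 2 ^+ m).
    by ring.
  by rewrite h2 mulr1.
rewrite -ler_sqr ?nnegrE ?mulr_ge0 ?sqrtr_ge0 ?exprn_ge0//.
by move=> /le_trans -> //; rewrite exprMn sqr_sqrtr// mulrC -natrX.
Qed.

Section L2_complete.
Context (R : realType) (n : nat) (U : set 'rV[R]_n) (mU : measurable U).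
Local Notation mu := (lebesgue_rV R n).
Local Notation dist u v := (L2dot U (u - v) (u - v)).

(** Riesz-Fischer. Along a subsequence whose increments decay geometrically, the sum
    of the weighted squared increments is integrable, hence finite almost
    everywhere; the sequence converges there, and the same sum dominates the squared
    distance to the limit. *)
Lemma L2_complete (u : nat -> 'rV[R]_n -> R) : (forall k, L2 U (u k)) ->
  (forall e : R, 0 < e -> exists N, forall i j, (N <= i)%N -> (N <= j)%N ->
     dist (u i) (u j) <= e) ->
  exists2 v, L2 U v & forall e : R, 0 < e -> exists N, forall i, (N <= i)%N ->
     dist (u i) v <= e.
Proof.
move=> u2 cau.
(* with increments 8 ^ -m in squared norm, the weights 4 ^ m still leave a
   convergent sum *)
pose ep (m : nat) : R := (8 ^+ m)^-1.
have ep0 m : 0 < ep m by rewrite invr_gt0 exprn_gt0.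
have /choice[K0 K0P] := fun m => cau (ep m) (ep0 m).
pose K m := (\max_(l < m.+1) K0 l)%N.
have K0K l m : (l <= m)%N -> (K0 l <= K m)%N.
  by move=> lm; rewrite /K -ltnS in lm *; exact: (leq_bigmax (Ordinal lm)).
pose f m := u (K m).
have f2 m : L2 U (f m) by exact: u2.
have fd m i : (K m <= i)%N -> dist (u i) (f m) <= ep m.
  move=> Ki; apply: K0P; first exact: leq_trans (K0K _ _ (leqnn _)) Ki.
  exact: K0K.
have ff m l : (m <= l)%N -> dist (f l) (f m) <= ep m.
  by move=> ml; apply: K0P; exact: K0K.
have mf m : measurable_fun U (f m) by case: (f2 m).
pose S x := (\sum_(0 <= m <oo) (4 ^+ m * (f m.+1 x - f m x) ^+ 2)%:E)%E.
have term0 m x : (0 <= (4 ^+ m * (f m.+1 x - f m x) ^+ 2)%:E :> \bar R)%E.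
  by rewrite lee_fin mulr_ge0 ?sqr_ge0.
have mterm m : measurable_fun U (fun x => (4 ^+ m * (f m.+1 x - f m x) ^+ 2)%:E).
  apply/measurable_EFinP; apply: measurable_funM => //; apply: measurable_funX.
  exact: measurable_funB.
have IS : (\int[mu]_(x in U) S x <= 2%:E)%E.
  rewrite integral_nneseries//.
  apply: (@le_trans _ _ (\sum_(0 <= m <oo) ((2%:R / (2 ^ (m + 1))%:R)%:E))%E).
    apply: lee_nneseries => [m _ _|m _].
      by apply: integral_ge0 => x _; exact: term0.
    under eq_integral do rewrite EFinM.
    rewrite ge0_integralZl_EFin//; last 2 first.
    - by move=> x _; rewrite lee_fin sqr_ge0.
    - by apply: measurable_sqr; exact: measurable_funB.
    have := ff m m.+1 (leqnSn m); rewrite -lee_fin L2dotE//; last exact: L2B.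
    move=> h; apply: le_trans (lee_wpmul2l _ h) _; first by rewrite lee_fin.
    rewrite -EFinM lee_fin /ep addn1 expnS natrM natrX invfM mulrA divff// mul1r.
    have -> : 8 = 4 * 2 :> R by rewrite -natrM.
    by rewrite exprMn invfM mulrA divff ?mul1r// expf_neq0.
  have := @cvg_geometric_eseries_half R 2 0; rewrite expr0 divr1 => /cvg_lim.
  by rewrite /eseries => ->.
have mS : measurable_fun U S.
  by apply: ge0_emeasurable_sum => // m x Ux _; exact: term0.
have S0 x : (0 <= S x)%E by apply: nneseries_ge0 => m _ _; exact: term0.
have iS : mu.-integrable U S.
  by apply/integrableP; split=> //; under eq_integral do rewrite gee0_abs//;
    exact: le_lt_trans IS (ltry _).
have aeS := integrable_ae mU iS.
have Sm x m : S x \is a fin_num -> 4 ^+ m * (f m.+1 x - f m x) ^+ 2 <= fine (S x).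
  move=> Sx; rewrite -lee_fin fineK// /S (nneseries_split 0 m.+1)//.
  rewrite add0n big_nat_recr//= -addeA addeCA; apply: leeDl.
  apply: adde_ge0; first by apply: sume_ge0 => k _; exact: term0.
  by apply: nneseries_ge0 => k _ _; exact: term0.
pose v x := fine (limn_esup (fun m => (f m x)%:E)).
have mv : measurable_fun U v.
  apply: measurableT_comp => //; apply: measurable_fun_limn_esup => m.
  exact/measurable_EFinP.
have vE x : S x \is a fin_num -> v x = limn (f^~ x).
  move=> Sx; have [cf _] := summable_increments_cvg (fun m => Sm x m Sx).
  have cE : (fun m => (f m x)%:E) @ \oo --> (limn (f^~ x))%:E.
    by apply: cvg_EFin; [exact: nearW | exact: cf].
  rewrite /v is_cvg_limn_esupE; last by apply/cvg_ex; eexists; exact: cE.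
  by rewrite (cvg_lim _ cE).
have vf m : (\int[mu]_(x in U) ((v x - f m x) ^+ 2)%:E <= (8 * (4 ^+ m)^-1)%:E)%E.
  apply: (@le_trans _ _ (\int[mu]_(x in U) ((4 * (4 ^+ m)^-1)%:E * S x))%E).
    apply: ae_ge0_le_integral => //.
    - by move=> x _; rewrite lee_fin sqr_ge0.
    - by apply: measurable_sqr; exact: measurable_funB.
    - by move=> x _; apply: mule_ge0 => //; rewrite lee_fin mulr_ge0// invr_ge0 exprn_ge0.
    - exact: measurable_funeM.
    - apply: filterS aeS => x /= + Ux => /(_ Ux) Sx.
      have [_ /(_ m)] := summable_increments_cvg (fun m => Sm x m Sx).
      rewrite -vE// => h; rewrite -(fineK Sx) -EFinM lee_fin.
      by rewrite mulrAC ler_pdivlMr ?exprn_gt0// mulrC.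
  rewrite ge0_integralZl_EFin//.
  apply: le_trans (lee_wpmul2l _ IS) _; first by rewrite lee_fin mulr_ge0// invr_ge0 exprn_ge0.
  by rewrite -EFinM lee_fin mulrAC -natrM.
have v2 : L2 U v.
  have -> : v = (v - f 0%N) + f 0%N by rewrite subrK.
  apply: L2D => //; apply: L2P => //; first exact: measurable_funB.
  exact: le_lt_trans (vf 0%N) (ltry _).
exists v => // e e0.
have [m me] : exists m, 18 * (4 ^+ m)^-1 <= e.
  exists (Num.truncn (18 / e)); rewrite ler_pdivrMr ?exprn_gt0// -ler_pdivrMl// mulrC.
  apply: le_trans (ltW (Num.Theory.truncnS_gt _)) _.
  by rewrite -natrX ler_nat ltn_expl.
have ep4 : ep m <= (4 ^+ m)^-1.
  by rewrite lef_pV2 ?posrE ?exprn_gt0// lerXn2r ?nnegrE// ler_nat.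
exists (K m) => i Ki; apply: le_trans me.
have := form_parallelogram (L2_subspace mU) (L2_form mU) (L2B mU (u2 i) (f2 m)) (L2B mU v2 (f2 m)).
have -> : u i - f m - (v - f m) = u i - v by rewrite opprB addrA subrK.
have := L2dot_ge0 U (u i - f m + (v - f m)).
have := fd m i Ki.
have : dist v (f m) <= 8 * (4 ^+ m)^-1 by rewrite -lee_fin L2dotE//; [exact: vf | exact: L2B].
lra.
Qed.

End L2_complete.

(** * Calculus of smooth functions *)

Section derivative_epsilon.
Context (R : realType) (V : normedModType R).

(** A total form of differentiability, with the case [h = 0] included, that can be
    composed without dividing. *)
Lemma is_derive_epsP (f : V -> R) x v d :
  is_derive x v f d <-> forall e : R, 0 < e -> exists2 r : R, 0 < r &
    forall h, `|h| < r -> `|f (h *: v + x) - f x - h * d| <= e * `|h|.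
Proof.
have E h : h != 0 -> h^-1 *: (f (h *: v + x) - f x) - d =
    h^-1 * (f (h *: v + x) - f x - h * d).
  by move=> h0; rewrite mulrBr mulrA mulVf// mul1r.
split=> [[df dE] e e0|H].
  have C : (fun h : R => h^-1 *: (f (h *: v + x) - f x)) @ 0^' --> d.
    by rewrite -dE; exact: df.
  have /cvgrPdist_le/(_ e e0)[r /= r0 rP] := C.
  exists r => // h hr; have [->|h0] := eqVneq h 0.
    by rewrite scale0r add0r subrr mul0r subrr normr0 mulr0.
  have := rP h _ h0; rewrite /ball/= sub0r normrN => /(_ hr).
  by rewrite distrC E// normrM normfV mulrC ler_pdivrMr ?normr_gt0.
have C : (fun h : R => h^-1 *: (f (h *: v + x) - f x)) @ 0^' --> d.
  apply/cvgrPdist_le => e e0; have [r r0 rP] := H e e0.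
  exists r => //= h; rewrite /ball/= sub0r normrN => /rP hr h0.
  by rewrite distrC E// normrM normfV mulrC ler_pdivrMr ?normr_gt0.
by apply: DeriveDef; [exact: (cvgP _ C) | exact: (cvg_lim _ C)].
Qed.

End derivative_epsilon.

Section derivative_directions.
Context (R : realType) (V : normedModType R).

Lemma is_derive_line (f : V -> R) x v d (s : R) :
  is_derive (x + s *: v) v f d <-> is_derive s 1 (fun t : R => f (x + t *: v)) d.
Proof.
have E h : x + (h *: 1 + s) *: v = h *: v + (x + s *: v).
  by rewrite scaler1 scalerDl addrCA.
by split=> /is_derive_epsP H; apply/is_derive_epsP => e /H[r r0 rP];
  exists r => // h /rP; rewrite E.
Qed.

Lemma is_derive_scale (f : V -> R) x v d (c : R) :
  is_derive x v f d -> is_derive x (c *: v) f (c * d).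
Proof.
move=> /is_derive_epsP H; apply/is_derive_epsP => e e0.
have c1 : 0 < `|c| + 1 by rewrite ltr_wpDl.
have [|r r0 rP] := H (e / (`|c| + 1)); first exact: divr_gt0.
exists (r / (`|c| + 1)); first exact: divr_gt0.
move=> h; rewrite ltr_pdivlMr// => hr; rewrite scalerA mulrA.
have hc : `|h * c| <= `|h| * (`|c| + 1) by rewrite normrM ler_wpM2l// lerDl.
apply: le_trans (rP _ (le_lt_trans hc hr)) _.
by rewrite mulrAC ler_pdivrMr// -mulrA ler_wpM2l// ltW.
Qed.

(** Partial derivatives give the derivative along a sum of directions as soon as one
    of them is continuous: the mean value theorem on the segment from [x + h v] to
    [x + h v + h w] turns the increment of [f] into [h] times a nearby value of the
    derivative along [w]. *)
Lemma is_derive_add (f Dv Dw : V -> R) v w :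
  (forall x, is_derive x v f (Dv x)) -> (forall x, is_derive x w f (Dw x)) ->
  continuous Dw -> forall x, is_derive x (v + w) f (Dv x + Dw x).
Proof.
move=> dv dw cw x; apply/is_derive_epsP => e e0.
have e2 : 0 < e / 2 by rewrite divr_gt0.
have /is_derive_epsP/(_ _ e2)[r1 r10 r1P] := dv x.
have /cvgrPdist_le/(_ _ e2)/nbhs_ballP[r2 /= r20 r2P] := cw x.
pose M := `|v| + `|w| + 1; have M0 : 0 < M by rewrite ltr_wpDl// addr_ge0.
exists (Num.min r1 (r2 / M)); first by rewrite lt_min r10 divr_gt0.
move=> h; rewrite lt_min => /andP[hr1]; rewrite ltr_pdivlMr// => hr2.
pose y := x + h *: v.
pose g (t : R) := f (y + t *: w).
have dg (t : R) : is_derive t 1 g (Dw (y + t *: w)) by apply/is_derive_line; exact: dw.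
have cg (a b : R) : {within `[a, b], continuous g}.
  apply: continuous_subspaceT => t.
  by apply: differentiable_continuous; apply/derivable1_diffP; case: (dg t).
have close t : `|t| <= `|h| -> `|Dw x - Dw (y + t *: w)| <= e / 2.
  move=> th; apply: r2P; rewrite -ball_normE/= /y -addrA opprD addrA subrr add0r normrN.
  apply: le_lt_trans hr2; apply: le_trans (ler_normD _ _) _.
  rewrite !normrZ mulrDr mulr1 mulrDr -addrA; apply: lerD => //.
  apply: (@le_trans _ _ (`|h| * `|w|)); first by rewrite ler_wpM2r.
  by rewrite lerDl.
have [t th gE] : exists2 t, `|t| <= `|h| & g h - g 0 = h * Dw (y + t *: w).
  have [h0|h0] := leP 0 h.
    have [t] := MVT_segment h0 (fun t _ => dg t) (cg 0 h).
    rewrite in_itv/= subr0 => /andP[t0 th] ->; exists t; last by rewrite mulrC.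
    by rewrite !ger0_norm// (le_trans t0).
  have [t] := MVT_segment (ltW h0) (fun t _ => dg t) (cg h 0).
  rewrite in_itv/= sub0r => /andP[t0 th] E; exists t.
    by rewrite !ler0_norm ?lerN2// ltW.
  by rewrite -[LHS]opprB E; ring.
have -> : h *: (v + w) + x = y + h *: w.
  by rewrite /y scalerDr addrC addrA.
have -> : f (y + h *: w) - f x - h * (Dv x + Dw x) =
    (f (h *: v + x) - f x - h * Dv x) - h * (Dw x - Dw (y + t *: w)).
  have := gE; rewrite /g scale0r addr0 => E.
  rewrite [h *: v + x]addrC -/y mulrBr -E; ring.
apply: le_trans (ler_normB _ _) _.
rewrite [e]splitr mulrDl lerD ?r1P// normrM mulrC ler_wpM2r//.
exact: close.
Qed.

End derivative_directions.

Section smooth_functions.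
Context (R : realType) (n : nat).
Implicit Types (f g : 'rV[R]_n -> R).
Local Notation e_ i := (delta_mx ord0 i : 'rV[R]_n).

Lemma smooth_continuous f : smooth f -> continuous f.
Proof. by move=> /(_ [::])[]. Qed.

Lemma smooth_derivable f i x : smooth f -> derivable f x (e_ i).
Proof. by move=> /(_ [::])[_]. Qed.

Lemma smooth_is_derive f i x : smooth f -> is_derive x (e_ i) f (partial i f x).
Proof. by move=> sf; apply: DeriveDef => //; exact: smooth_derivable. Qed.

Lemma smooth_partial f i : smooth f -> smooth (partial i f).
Proof. by move=> sf s; have := sf (rcons s i); rewrite foldr_rcons. Qed.

(** Smoothness quantifies over all iterated partial derivatives, so it is proved by
    exhibiting a class of continuous derivable functions that is stable under
    partial derivatives. *)
Lemma smooth_coind (P : ('rV[R]_n -> R) -> Prop) :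
  (forall f, P f -> continuous f) ->
  (forall f i x, P f -> derivable f x (e_ i)) ->
  (forall f i, P f -> P (partial i f)) -> forall f, P f -> smooth f.
Proof.
move=> cP dP pP f Pf s; suff Ps : P (foldr (@partial R n) f s).
  by split=> [|i x]; [exact: cP | exact: dP].
by elim: s => //= i s; exact: pP.
Qed.

Lemma partialE f g i : (forall x, is_derive x (e_ i) f (g x)) -> partial i f = g.
Proof. by move=> fg; apply/funext => x; case: (fg x). Qed.

(** The closure of the smooth functions under sums and products is stable under
    partial derivatives by the product rule, whereas the products of two smooth
    functions alone are not. *)
Inductive smooth_alg : ('rV[R]_n -> R) -> Prop :=
| Smooth_base f : smooth f -> smooth_alg f
| Smooth_cst c : smooth_alg (cst c)
| Smooth_add f g : smooth_alg f -> smooth_alg g -> smooth_alg (f \+ g)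
| Smooth_mul f g : smooth_alg f -> smooth_alg g -> smooth_alg (f \* g).

Lemma smooth_alg_spec f : smooth_alg f ->
  [/\ continuous f, forall i x, derivable f x (e_ i) & forall i, smooth_alg (partial i f)].
Proof.
elim=> {f} [f sf|c|f g saf [cf df pf] sag [cg dg pg]|f g saf [cf df pf] sag [cg dg pg]].
- split; [exact: smooth_continuous | by move=> i x; exact: smooth_derivable |].
  by move=> i; apply/Smooth_base/smooth_partial.
- split; [exact: cst_continuous | by move=> i x; exact: derivable_cst | move=> i].
  rewrite (_ : partial i _ = cst 0); first exact: Smooth_cst.
  by apply: partialE => x; exact: is_derive_cst.
- split; [by move=> x; apply: continuousD; [exact: cf | exact: cg] | by move=> i x; exact: derivableD | move=> i].
  rewrite (_ : partial i _ = partial i f \+ partial i g); first exact: Smooth_add.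
  by apply: partialE => x; apply: is_deriveD; exact/derivableP.
- split; [by move=> x; apply: continuousM; [exact: cf | exact: cg] | by move=> i x; exact: derivableM | move=> i].
  rewrite (_ : partial i _ = (f \* partial i g) \+ (g \* partial i f)).
    by apply: Smooth_add; exact: Smooth_mul.
  by apply: partialE => x; apply: is_deriveM; exact/derivableP.
Qed.

Lemma smooth_algP f : smooth_alg f -> smooth f.
Proof.
by apply: smooth_coind => {}f; [move=> /smooth_alg_spec[]|
  move=> i x /smooth_alg_spec[_ /(_ i x)]|move=> i /smooth_alg_spec[_ _ /(_ i)]].
Qed.

Lemma smooth_cst c : smooth (cst c : 'rV[R]_n -> R).
Proof. exact/smooth_algP/Smooth_cst. Qed.

Lemma smoothD f g : smooth f -> smooth g -> smooth (f \+ g).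
Proof. by move=> sf sg; apply/smooth_algP/Smooth_add; exact: Smooth_base. Qed.

Lemma smoothM f g : smooth f -> smooth g -> smooth (f \* g).
Proof. by move=> sf sg; apply/smooth_algP/Smooth_mul; exact: Smooth_base. Qed.

Lemma smooth_prod I (r : seq I) (F : I -> 'rV[R]_n -> R) :
  (forall i, smooth (F i)) -> smooth (fun x => \prod_(i <- r) F i x).
Proof.
move=> sF; elim: r => [|i r IH].
  by under eq_fun do rewrite big_nil; exact: smooth_cst.
by under eq_fun do rewrite big_cons; exact: smoothM.
Qed.

Lemma partialM f g i : smooth f -> smooth g ->
  partial i (f \* g) = (f \* partial i g) \+ (g \* partial i f).
Proof.
by move=> sf sg; apply: partialE => x; apply: is_deriveM; exact: smooth_is_derive.
Qed.

Lemma partial_cst c i : partial i (cst c : 'rV[R]_n -> R) = cst 0.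
Proof. by apply: partialE => x; exact: is_derive_cst. Qed.

Lemma row_sum_delta_rV (v : 'rV[R]_n) : v = \sum_i v ord0 i *: e_ i.
Proof. exact: row_sum_delta. Qed.

Lemma smooth_is_derive_vec f v x : smooth f ->
  is_derive x v f (\sum_i v ord0 i * partial i f x).
Proof.
move=> sf; rewrite {1}(row_sum_delta_rV v).
elim: (index_enum _) x => [|i r IH] x.
  by rewrite !big_nil; exact: is_derive0.
rewrite !big_cons addrC [X in is_derive _ _ _ X]addrC.
move: x; apply: is_derive_add => //.
  by move=> x; apply: is_derive_scale; exact: smooth_is_derive.
move=> x; apply: continuousM; first exact: cst_continuous.
by apply: smooth_continuous; exact: smooth_partial.
Qed.

Lemma smooth_affine (t : R) z f : smooth f -> smooth (f \o affine t z) /\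
  forall i, partial i (f \o affine t z) = fun x => t * partial i f (affine t z x).
Proof.
have pE i g : smooth g -> partial i (g \o affine t z) = fun x => t * partial i g (affine t z x).
  move=> sg; apply: partialE => x; apply/is_derive_epsP => e e0.
  have /is_derive_epsP/(_ _ e0)[r r0 rP] := is_derive_scale t (smooth_is_derive i (affine t z x) sg).
  exists r => // h /rP; congr (`|g _ - _ - _| <= _).
  by rewrite /affine scalerDr scalerA mulrC -scalerA addrA.
move=> sf; split; last by move=> i; exact: pE.
apply: (@smooth_coind (fun g => exists2 c, smooth c & g = c \o affine t z)).
- move=> _ [g sg ->] x; apply: continuous_comp; last exact: smooth_continuous.
  by apply: continuousD; [exact: scaler_continuous | exact: cst_continuous].
- move=> _ i x [g sg ->].
  have := smooth_is_derive i (affine t z x) sg.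
  move=> /(is_derive_scale t)/is_derive_epsP H.
  suff [] : is_derive x (e_ i) (g \o affine t z) (t * partial i g (affine t z x)) by [].
  apply/is_derive_epsP => e /H[r r0 rP]; exists r => // h /rP.
  by rewrite /affine/= scalerDr [in h *: (t *: _)]scalerA [h * t]mulrC -scalerA addrA.
- move=> _ i [g sg ->]; exists (cst t \* partial i g); last exact: pE.
  by apply: smoothM; [exact: smooth_cst | exact: smooth_partial].
- by exists f.
Qed.

End smooth_functions.

(** * Smooth bump functions *)

Section flat_functions.
Context (R : realType).

(** The functions [t ^ (- k) exp (- c / t)] on the positive half-line: a family
    stable under differentiation up to linear combinations, hence made of smooth
    functions. *)
Definition flat (k : nat) (c t : R) : R :=
  if 0 < t then t^-1 ^+ k * expR (- c / t) else 0.

Lemma flat_ge0 k c t : 0 <= flat k c t.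
Proof.
rewrite /flat; case: ifPn => // t0.
by rewrite mulr_ge0 ?expR_ge0// exprn_ge0// invr_ge0 ltW.
Qed.

(** The exponential series bounds [exp (c / t)] below by its term of order [k + 2];
    the quadratic bound gives the derivative zero at the origin. *)
Lemma flat_le k c t : 0 < c -> flat k c t <= (k.+2)`!%:R / c ^+ k.+2 * t ^+ 2.
Proof.
move=> c0; rewrite /flat; case: ifPn => t0; last first.
  by rewrite mulr_ge0 ?sqr_ge0// divr_ge0// exprn_ge0// ltW.
have ct0 : 0 <= c / t by rewrite divr_ge0// ltW.
have e_ge : (c / t) ^+ k.+2 / k.+2`!%:R <= expR (c / t).
  by apply: le_trans (expR_ge1Dxn k.+1 ct0); rewrite lerDr.
have f0 : 0 < k.+2`!%:R :> R by rewrite ltr0n fact_gt0.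
have p0 : 0 < (c / t) ^+ k.+2 / k.+2`!%:R by rewrite divr_gt0// exprn_gt0// divr_gt0.
rewrite mulNr expRN; apply: (@le_trans _ _ (t^-1 ^+ k * ((c / t) ^+ k.+2 / k.+2`!%:R)^-1)).
  rewrite ler_wpM2l ?exprn_ge0 ?invr_ge0 ?(ltW t0)//.
  by rewrite lef_pV2 ?posrE ?expR_gt0.
have cn0 := lt0r_neq0 c0; have tn0 := lt0r_neq0 t0.
rewrite invf_div expr_div_n exprVn !exprS le_eqVlt; apply/orP; left; apply/eqP.
by field; rewrite ?cn0 ?tn0 ?expf_neq0 ?lt0r_neq0.
Qed.

Lemma is_derive_flat k c (t : R) : 0 < c ->
  is_derive t 1 (flat k c) (- k%:R * flat k.+1 c t + c * flat k.+2 c t).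
Proof.
move=> c0; have [t0|t0|->] := ltrgt0P t.
- have tn0 := lt0r_neq0 t0.
  pose g (y : R) := y ^+ k * expR (- c * y).
  have dX (y : R) : is_derive y 1 (fun y : R => y ^+ k) (k%:R * y ^+ k.-1).
    apply: DeriveDef; first exact: exprn_derivable.
    by rewrite exp_derive /GRing.scale/= mulr1.
  have dE (y : R) : is_derive y 1 (fun y : R => expR (- c * y)) (- c * expR (- c * y)).
    have dl : is_derive y 1 (fun y : R => - c * y) (- c).
      have := is_deriveZ (- c) (is_derive_id y (1 : R)).
      by rewrite /GRing.scale/= mulr1.
    by have := is_derive1_comp (is_derive_expR (- c * y)) dl; rewrite mulrC.
  have dg (y : R) : is_derive y 1 g (y ^+ k * (- c * expR (- c * y)) +
      expR (- c * y) * (k%:R * y ^+ k.-1)).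
    exact: (is_deriveM (dX y) (dE y)).
  have di : is_derive t 1 (fun t : R => t^-1) (- (t^-1 ^+ 2)).
    have := is_deriveV tn0 (is_derive_id t (1 : R)).
    by rewrite /GRing.scale/= mulr1 exprVn.
  have dgi := is_derive1_comp (dg t^-1) di.
  have near_eq : \near t, (g \o (fun t : R => t^-1)) t = flat k c t.
    near=> s; rewrite /= /g /flat.
    suff -> : 0 < s by [].
    near: s; exact: lt_nbhsr.
  apply: (near_eq_is_derive near_eq); apply: is_derive_eq.
  rewrite /flat t0; case: k {dX g dg dgi near_eq} => [|k] /=; rewrite !exprS; ring.
- have near_eq : \near t, cst 0 t = flat k c t.
    near=> s; rewrite /flat; suff -> : (0 < s) = false by [].
    apply/negbTE; rewrite -leNgt ltW//.
    near: s; exact: lt_nbhsl.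
  apply: (near_eq_is_derive near_eq); rewrite /flat ltNge (ltW t0)/= !mulr0 addr0.
  exact: is_derive_cst.
- rewrite /flat ltxx !mulr0 addr0 -/(flat k c).
  apply/is_derive_epsP => e e0.
  pose K : R := k.+2`!%:R / c ^+ k.+2.
  have K0 : 0 < K by rewrite divr_gt0 ?exprn_gt0// ltr0n fact_gt0.
  exists (e / K); first exact: divr_gt0.
  move=> h; rewrite ltr_pdivlMr// => hK.
  rewrite scaler1 addr0 mulr0 subr0.
  rewrite {2}/flat ltxx subr0 ger0_norm ?flat_ge0//.
  apply: le_trans (flat_le k h c0) _; rewrite -/K.
  rewrite -real_normK ?num_real// expr2 mulrA ler_wpM2r// mulrC ltW//.
Unshelve. all: by end_near. Qed.

End flat_functions.

Section bumps.
Context (R : realType) (n : nat).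
Local Notation e_ i := (delta_mx ord0 i : 'rV[R]_n).

(** The linear span is needed, since the derivative of [flat k] combines two other
    members of the family. *)
Inductive flat_span (c s b : R) (j : 'I_n) : ('rV[R]_n -> R) -> Prop :=
| Flat_base k : flat_span c s b j (fun x => flat k c (s * x ord0 j + b))
| Flat_lin d f g : flat_span c s b j f -> flat_span c s b j g ->
    flat_span c s b j (fun x => d * f x + g x).

Lemma flat_coord_is_derive k c s b (j i : 'I_n) x : 0 < c ->
  is_derive x (e_ i) (fun x => flat k c (s * x ord0 j + b))
    ((s * (j == i)%:R) * (- k%:R * flat k.+1 c (s * x ord0 j + b) +
       c * flat k.+2 c (s * x ord0 j + b))).
Proof.
move=> c0; apply/is_derive_epsP => e e0.
have /(is_derive_scale (s * (j == i)%:R))/is_derive_epsP/(_ _ e0)[r r0 rP] :=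
  is_derive_flat k (s * x ord0 j + b) c0.
exists r => // h /rP; rewrite !mxE/= scaler1 /GRing.scale/=.
by congr (`|flat k c _ - _ - _| <= _); rewrite eq_sym; ring.
Qed.

Lemma flat_span_spec c s b j f : 0 < c -> flat_span c s b j f ->
  [/\ forall i x, derivable f x (e_ i), continuous f &
      forall i, flat_span c s b j (partial i f)].
Proof.
move=> c0; elim=> {f} [k|d f g _ [df cf pf] _ [dg cg pg]]; split.
- by move=> i x; case: (flat_coord_is_derive k s b j i x c0).
- move=> x; apply: (@continuous_comp _ _ _ (fun x : 'rV[R]_n => s * x ord0 j + b)).
    apply: continuousD; last exact: cst_continuous.
    apply: continuousM; [exact: cst_continuous | exact: coord_continuous].
  apply: differentiable_continuous; apply/derivable1_diffP.
  by case: (is_derive_flat k (s * x ord0 j + b) c0).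
- move=> i; rewrite (partialE (fun x => flat_coord_is_derive k s b j i x c0)).
  pose F l (x : 'rV[R]_n) := flat l c (s * x ord0 j + b); pose a := s * (j == i)%:R.
  have -> : (fun x : 'rV[R]_n => a * (- k%:R * F k.+1 x + c * F k.+2 x)) =
     (fun x => - (a * k%:R) * F k.+1 x + ((a * c - 1) * F k.+2 x + F k.+2 x)).
    by apply/funext => x; ring.
  by apply: Flat_lin; [exact: Flat_base|apply: Flat_lin; exact: Flat_base].
- by move=> i x; apply: derivableD => //; apply: derivableZ.
- move=> x; apply: (@continuousD _ _ _ (fun x => d * f x) g); last exact: cg.
  by apply: (@continuousM _ _ (cst d) f); [exact: cst_continuous|exact: cf].
- move=> i; rewrite (_ : partial i _ = fun x => d * partial i f x + partial i g x).
    exact: Flat_lin.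
  apply: partialE => x; apply: is_deriveD; last exact/derivableP.
  by apply: is_deriveZ; exact/derivableP.
Qed.

Lemma smooth_flat_coord k c s b (j : 'I_n) : 0 < c ->
  smooth (fun x : 'rV[R]_n => flat k c (s * x ord0 j + b)).
Proof.
move=> c0; apply: (@smooth_coind _ _ (flat_span c s b j)) (Flat_base _ _ _ _ _).
- by move=> f /(flat_span_spec c0)[].
- by move=> f i x /(flat_span_spec c0)[/(_ i x)].
- by move=> f i /(flat_span_spec c0)[_ _ /(_ i)].
Qed.

Definition bump (c : R) (a b : 'I_n -> R) (x : 'rV[R]_n) : R :=
  \prod_i (flat 0 c (x ord0 i - a i) * flat 0 c (b i - x ord0 i)).

Lemma smooth_bump c a b : 0 < c -> smooth (bump c a b).
Proof.
move=> c0; apply: smooth_prod => i.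
have -> : (fun x : 'rV[R]_n => flat 0 c (x ord0 i - a i) * flat 0 c (b i - x ord0 i)) =
  (fun x => flat 0 c (1 * x ord0 i + - a i)) \*
  (fun x => flat 0 c (-1 * x ord0 i + b i)).
  by apply/funext => x /=; rewrite mul1r mulN1r [- _ + _]addrC.
by apply: smoothM; exact: smooth_flat_coord.
Qed.

Lemma flat0_gt0 (c t : R) : 0 < t -> 0 < flat 0 c t.
Proof. by move=> t0; rewrite /flat t0 expr0 mul1r expR_gt0. Qed.

Lemma flat0_le1 (c t : R) : 0 < c -> flat 0 c t <= 1.
Proof.
move=> c0; rewrite /flat; case: ifPn => // t0.
by rewrite expr0 mul1r -expR0 ler_expR mulNr oppr_le0 divr_ge0// ltW.
Qed.

Lemma bump_ge0 c a b x : 0 <= bump c a b x.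
Proof. by apply: prodr_ge0 => i _; rewrite mulr_ge0// flat_ge0. Qed.

Lemma bump_le1 c a b x : 0 < c -> bump c a b x <= 1.
Proof.
move=> c0; apply: prodr_ile1 => i _.
by rewrite mulr_ge0 ?flat_ge0//= mulr_ile1 ?flat_ge0 ?flat0_le1.
Qed.

Lemma bump_gt0 c a b x : open_box a b x -> 0 < bump c a b x.
Proof.
move=> xab; apply: prodr_gt0 => i _; have := xab i; rewrite /= in_itv/= => /andP[h1 h2].
by rewrite mulr_gt0// flat0_gt0// subr_gt0.
Qed.

Lemma bump_eq0 c a b x : ~ open_box a b x -> bump c a b x = 0.
Proof.
move=> /existsNP[i] /=; rewrite in_itv/= => /negP; rewrite negb_and -!leNgt => xi.
rewrite /bump (bigD1 i)//= /flat !subr_gt0.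
case/orP: xi => xi; first by rewrite (ltNge (a i)) xi/= !mul0r.
by rewrite (ltNge (x ord0 i)) xi/= mulr0 mul0r.
Qed.

(** As [c] decreases to zero the bumps increase to the indicator of the open box:
    this is how test functions detect the values of a measure on boxes. *)
Lemma bump_cvg a b x : (fun k => bump k.+1%:R^-1 a b x) @ \oo --> (\1_(open_box a b) x : R).
Proof.
have [xab|xab] := pselect (open_box a b x); last first.
  rewrite indicE memNset//=.
  by under eq_fun do rewrite (bump_eq0 _ xab); exact: cvg_cst.
rewrite indicE mem_set//=; pose S := \sum_i ((x ord0 i - a i)^-1 + (b i - x ord0 i)^-1).
have E (c : R) : bump c a b x = expR (- (c * S)).
  rewrite /bump /S mulr_sumr -sumrN expR_sum; apply: eq_bigr => i _.
  have := xab i; rewrite /= in_itv/= => /andP[h1 h2].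
  rewrite /flat !subr_gt0 h1 h2 !expr0 !mul1r -expRD; congr expR; ring.
under eq_fun do rewrite E.
have H : (fun k : nat => - (k.+1%:R^-1 * S)) @ \oo --> - (0 * S).
  by apply: cvgN; apply: cvgM; [exact: cvg_harmonic | exact: cvg_cst].
rewrite mul0r oppr0 in H; have -> : (1%:R : R) = expR 0 by rewrite expR0.
by apply: continuous_cvg H; exact: continuous_expR.
Qed.

Definition closed_box (a b : 'I_n -> R) : set 'rV[R]_n := boxset (fun i => `[a i, b i]%classic).

Lemma compact_closed_box a b : compact (closed_box a b).
Proof. by apply: rV_compact => i; exact: segment_compact. Qed.

Lemma closed_closed_box a b : closed (closed_box a b).
Proof. by apply: compact_closed; [exact: norm_hausdorff|exact: compact_closed_box]. Qed.

Lemma support_bump c a b : support (bump c a b) `<=` closed_box a b.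
Proof.
rewrite /support [X in _ `<=` X](closure_id _).1; last exact: closed_closed_box.
apply: closure_subset => x /= /eqP bx.
have : open_box a b x by apply: contra_notP bx; exact: bump_eq0.
by move=> xab i; have := xab i; rewrite /= !in_itv/= => /andP[/ltW -> /ltW ->].
Qed.

Lemma test_bump U c a b : 0 < c -> closed_box a b `<=` U -> test_function U (bump c a b).
Proof.
move=> c0 abU; split; first exact: smooth_bump.
- apply: subclosed_compact (@compact_closed_box a b) _; first exact: closed_closure.
  exact: support_bump.
- by apply: subset_trans abU; exact: support_bump.
Qed.

End bumps.

(** * Test functions, translations and integrals along rays *)

Section test_functions.
Context (R : realType) (n : nat).
Implicit Types (f g : 'rV[R]_n -> R) (U : set 'rV[R]_n).
Local Notation mu := (lebesgue_rV R n).
Local Notation e_ i := (delta_mx ord0 i : 'rV[R]_n).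

Lemma support_out f x : ~ support f x -> f x = 0.
Proof. by apply: contra_notP => /eqP fx; exact: subset_closure. Qed.

Lemma support_sub f (K : set 'rV[R]_n) : closed K -> (forall x, ~ K x -> f x = 0) ->
  support f `<=` K.
Proof.
move=> cK fK; rewrite [X in _ `<=` X](closure_id _).1//.
by apply: closure_subset => x /= /eqP fx; apply: contra_notP fx; exact: fK.
Qed.

Lemma closed_support f : closed (support f).
Proof. exact: closed_closure. Qed.

Lemma near_support_out f x : ~ support f x -> \near x, cst 0 x = f x.
Proof.
move=> fx; have : nbhs x (~` support f).
  by apply: open_nbhs_nbhs; split=> //; exact/closed_openC/closed_support.
by apply: filterS => y /support_out ->.
Qed.

Lemma partial_out f i x : ~ support f x -> partial i f x = 0.
Proof.
move=> /near_support_out fx.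
by have [] := near_eq_is_derive fx (is_derive_cst (0 : R) x (e_ i)).
Qed.

Lemma support_partial f i : support (partial i f) `<=` support f.
Proof. by apply: support_sub; [exact: closed_support | move=> x; exact: partial_out]. Qed.

Lemma test_partial U f i : test_function U f -> test_function U (partial i f).
Proof.
move=> [sf cf fU]; have sub := @support_partial f i; split.
- exact: smooth_partial.
- exact: subclosed_compact (@closed_support _) cf sub.
- exact: subset_trans fU.
Qed.

Lemma testW U V f : U `<=` V -> test_function U f -> test_function V f.
Proof. by move=> UV [sf cf fU]; split=> //; exact: subset_trans UV. Qed.

Lemma testM U f g : smooth f -> test_function U g -> test_function U (f \* g).
Proof.
move=> sf [sg cg gU].
have sub : support (f \* g) `<=` support g.
  apply: support_sub; first exact: closed_support.
  by move=> x /support_out /= ->; rewrite mulr0.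
split; [exact: smoothM | | exact: subset_trans gU].
exact: subclosed_compact (@closed_support _) cg sub.
Qed.

Lemma test_out U f x : test_function U f -> ~ U x -> f x = 0.
Proof. by move=> [_ _ fU] Ux; apply: support_out => /fU. Qed.

Lemma compact_bounded_rV (K : set 'rV[R]_n) : compact K -> exists2 r : R, 0 < r &
  forall x, K x -> `|x| < r.
Proof.
move=> /compact_bounded[M [_ MP]]; exists (`|M| + 2); first by rewrite ltr_wpDl.
move=> x Kx; have := MP (`|M| + 1); rewrite ltr_pwDr ?ler_norm// => /(_ isT x Kx).
by move=> /= h; apply: le_lt_trans h _; rewrite ltrD2l ltr1n.
Qed.

Lemma test_bounded U f : test_function U f -> exists2 M : R, 0 <= M &
  forall x, `|f x| <= M.
Proof.
move=> [sf cf _]; have := cf; rewrite -/(support f) => K.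
have : compact (f @` support f).
  by apply: continuous_compact => //; apply: continuous_subspaceT; exact: smooth_continuous.
move=> /compact_bounded[M [_ MP]]; exists (`|M| + 1); first by rewrite addr_ge0.
move=> x; have [fx|/support_out ->] := pselect (support f x); last first.
  by rewrite normr0 addr_ge0.
by apply: MP; [rewrite ltr_pwDr// ler_norm | exists x].
Qed.

Lemma continuous_measurable_rV f : continuous f -> measurable_fun setT f.
Proof.
move=> /continuousP cf.
apply: (measurability _ (measurable_realfun.RGenOpens.measurableE R)).
move=> _ [_ [a [b ->] <-]]; rewrite setTI; apply: open_measurable_rV.
exact/cf/interval_open.
Qed.

Lemma lebesgue_open_box_lty (a b : 'I_n -> R) : (mu (open_box a b) < +oo)%E.
Proof. by rewrite lebesgue_open_box ltry. Qed.

Lemma norm_box (r : R) (x : 'rV[R]_n) : 0 < r -> `|x| < r -> open_box (fun=> - r) (fun=> r) x.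
Proof.
move=> r0 xr i /=; rewrite in_itv/= -ltr_norml; apply: le_lt_trans xr.
exact: coord_le_norm.
Qed.

Lemma bounded_support_integrable f (M r : R) : measurable_fun setT f ->
  (forall x, `|f x| <= M) -> 0 < r -> (forall x, f x != 0 -> `|x| < r) ->
  mu.-integrable setT (EFin \o f).
Proof.
move=> mf fM r0 fr; pose B : set 'rV[R]_n := open_box (fun=> - r) (fun=> r).
have mB : measurable B by exact: measurable_open_box.
apply: (@le_integrable _ _ _ _ _ measurableT _ (fun x => M%:E * (\1_B x)%:E)%E).
- exact/measurable_EFinP.
- move=> x _; rewrite -EFinM !abse_EFin lee_fin /=.
  have M0 : 0 <= M by apply: le_trans (fM x).
  have [->|fx] := eqVneq (f x) 0; first by rewrite normr0.
  rewrite indicE mem_set; last by apply: norm_box => //; exact: fr.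
  by rewrite mulr1 [leRHS]ger0_norm.
- apply: integrableZl => //; apply/integrableP; split.
    by apply/measurable_EFinP; exact: measurable_indic.
  under eq_integral do rewrite gee0_abs ?lee_fin//.
  by rewrite integral_indic// setIT; exact: lebesgue_open_box_lty.
Qed.

Lemma test_integrable U f : test_function U f -> mu.-integrable setT (EFin \o f).
Proof.
move=> tf; have [M M0 fM] := test_bounded tf; have [sf cf _] := tf.
have [r r0 fr] := compact_bounded_rV cf.
apply: (bounded_support_integrable _ fM r0).
  by apply: continuous_measurable_rV; exact: smooth_continuous.
by move=> x fx; apply: fr; exact: subset_closure.
Qed.

(** A test function is bounded and vanishes outside a bounded set. *)
Lemma test_L2 U V f : measurable V -> test_function U f -> L2 V f.
Proof.
move=> mV tf; apply: (@L2_restr _ _ setT) => //.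
split; first by apply: continuous_measurable_rV; apply: smooth_continuous; case: tf.
have := test_integrable (testM _ tf); have [sf _ _] := tf => /(_ f sf).
by congr (_.-integrable _ _); apply/funext => x /=; rewrite expr2.
Qed.

End test_functions.

Section translation.
Context (R : realType) (n : nat).
Local Notation mu := (lebesgue_rV R n).
Implicit Types (h : 'rV[R]_n -> R) (z : 'rV[R]_n).

Lemma measurable_shift z : measurable_fun setT (fun x : 'rV[R]_n => x + z).
Proof.
have := measurable_affine (1 : R) z.
by congr measurable_fun; apply/funext => x; rewrite /affine scale1r.
Qed.

Lemma ge0_integral_shift z (f : 'rV[R]_n -> \bar R) : measurable_fun setT f ->
  (forall x, (0 <= f x)%E) -> (\int[mu]_x f (x + z)%R = \int[mu]_x f x)%E.
Proof.
move=> mf f0; have := ge0_integral_affine z (@ltr01 R) mf f0.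
rewrite expr1n invr1 mul1e => <-; apply: eq_integral => x _.
by rewrite /affine scale1r.
Qed.

Lemma integrable_shift z h : mu.-integrable setT (EFin \o h) ->
  mu.-integrable setT (fun x => (h (x + z))%:E).
Proof.
move=> /integrableP[mh ih]; apply/integrableP; split.
  by apply: (measurableT_comp mh); exact: measurable_shift.
rewrite (@ge0_integral_shift z (fun x => `|(h x)%:E|%E))//.
exact: measurableT_comp.
Qed.

Lemma integral_shift z h : mu.-integrable setT (EFin \o h) ->
  (\int[mu]_x (h (x + z)%R)%:E = \int[mu]_x (h x)%:E)%E.
Proof.
move=> ih; have [mh _] := integrableP _ _ _ ih.
rewrite integralE [RHS]integralE; congr (_ - _)%E; apply/esym.
  rewrite -(ge0_integral_shift z) => //; last exact: (measurable_funepos mh).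
  by apply: eq_integral => x _; rewrite !funeposE.
rewrite -(ge0_integral_shift z) => //; last exact: (measurable_funeneg mh).
by apply: eq_integral => x _; rewrite !funenegE.
Qed.

End translation.

Section unit_Fubini.
Context (R : realType) (n : nat).
Local Notation mu := (lebesgue_rV R n).
Local Notation leb := (@lebesgue_measure R).
Local Notation I01 := (`[0, 1]%classic : set R).
Variable K : R * 'rV[R]_n -> R.
Hypothesis mK : measurable_fun [set: measurableTypeR R * 'rV[R]_n] K.

Let mI : measurable I01. Proof. exact: measurable_itv. Qed.

Let F (p : measurableTypeR R * 'rV[R]_n) : \bar R := ((K p) * \1_I01 p.1)%:E.

Let mF : measurable_fun setT F.
Proof.
apply/measurable_EFinP; apply: measurable_funM => //.
exact: (measurableT_comp (measurable_indic mI) measurable_fst).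
Qed.

Lemma unit_integral_indic (f : R -> \bar R) :
  (\int[leb]_(s in I01) f s = \int[leb]_s (f s * (\1_I01 s)%:E))%E.
Proof.
rewrite integral_mkcond; apply: eq_integral => s _; rewrite patchE indicE.
by case: ifPn => _; rewrite ?mule1 ?mule0.
Qed.

(** Integrals over rays [x + s z], [0 <= s <= 1], are exchanged with integrals over
    the space. *)
Lemma unit_Tonelli (f : R * 'rV[R]_n -> \bar R) :
  measurable_fun [set: measurableTypeR R * 'rV[R]_n] f -> (forall p, 0 <= f p)%E ->
  (\int[mu]_x \int[leb]_(s in I01) f (s, x) = \int[leb]_(s in I01) \int[mu]_x f (s, x))%E.
Proof.
move=> mf f0.
pose G (p : measurableTypeR R * 'rV[R]_n) : \bar R := (f p * (\1_I01 p.1)%:E)%E.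
have G0 p : (0 <= G p)%E by apply: mule_ge0 => //; rewrite lee_fin.
have mG : measurable_fun setT G.
  apply: emeasurable_funM => //; apply/measurable_EFinP.
  exact: (measurableT_comp (measurable_indic mI) measurable_fst).
have := @fubini_tonelli _ _ _ _ R leb mu G mG G0.
rewrite /G /= => H; rewrite unit_integral_indic; under eq_integral do rewrite unit_integral_indic.
rewrite -H; apply: eq_integral => s _.
by rewrite ge0_integralZr//; exact: (measurableT_comp mf (pair1_measurable _)).
Qed.

Hypothesis C : R.
Hypothesis KC : forall s, 0 <= s <= 1 -> (\int[mu]_x `|K (s, x)|%:E <= C%:E)%E.

Let iF : (leb \x mu)%E.-integrable setT F.
Proof.
apply/integrable12ltyP => //.
apply: (@le_lt_trans _ _ (\int[leb]_(s in I01) C%:E)%E); last first.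
  rewrite integral_cst//= lebesgue_measure_itv/= lte_fin ltr01 oppr0 adde0 mule1.
  exact: ltry.
rewrite [leRHS]unit_integral_indic; apply: ge0_le_integral => //.
- by move=> s _; exact: integral_ge0.
- apply: (@measurable_fun_fubini_tonelli_F _ _ _ _ R mu (abse \o F)).
    exact: measurableT_comp.
  by move=> x; exact: abse_ge0.
- by apply: measurable_funeM; apply/measurable_EFinP; exact: measurable_indic.
move=> s _; rewrite /F/= indicE; have [sI|sI] := boolP (s \in I01); last first.
  by under eq_integral do rewrite mulr0 normr0; rewrite integral0 mule0.
under eq_integral do rewrite mulr1.
by rewrite mule1; apply: KC; move: sI; rewrite inE/= in_itv.
Qed.

Lemma unit_Fubini :
  (\int[mu]_x \int[leb]_(s in I01) (K (s, x))%:E =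
   \int[leb]_(s in I01) \int[mu]_x (K (s, x))%:E)%E.
Proof.
have := @Fubini _ _ _ _ R leb mu F iF; rewrite /F/= => H.
rewrite unit_integral_indic; under eq_integral do rewrite unit_integral_indic.
under eq_integral do under eq_integral do rewrite -EFinM.
rewrite -H; apply: eq_integral => s _; rewrite indicE.
case: (s \in _); last first.
  by rewrite mule0; under eq_integral do rewrite mulr0; rewrite integral0.
by rewrite mule1; under eq_integral do rewrite mulr1.
Qed.

Lemma integrable_unit_Fubini :
  mu.-integrable setT (fun x => \int[leb]_(s in I01) (K (s, x))%:E)%E.
Proof.
have E : (fun x => \int[leb]_(s in I01) (K (s, x))%:E)%E = fubini_G leb F.
  apply/funext => x; rewrite /fubini_G unit_integral_indic /F.
  by apply: eq_integral => s _; rewrite EFinM.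
rewrite E; apply/integrableP; split; first exact: (measurable_fubini_G iF).
have [_] := integrableP _ _ _ iF; apply: le_lt_trans.
rewrite (fubini_tonelli2 (abse \o F))//=; last exact: measurableT_comp.
apply: ge0_le_integral => //.
- by apply: measurableT_comp => //; exact: (measurable_fubini_G iF).
- apply: (@measurable_fun_fubini_tonelli_G _ _ _ _ R leb (abse \o F)).
    exact: measurableT_comp.
  by move=> x; exact: abse_ge0.
- move=> x _; apply: le_abse_integral => //.
  exact: (measurableT_comp mF (pair2_measurable _)).
Qed.

Lemma ae_unit_integrable :
  {ae mu, forall x, leb.-integrable I01 (fun s => (K (s, x))%:E)}.
Proof.
have := ae_integrable2 iF; apply: filterS => x ix.
have mI' : measurable (I01 : set (measurableTypeR R)) by exact: mI.
apply/(integrable_mkcond _ mI').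
have -> : (fun s => (K (s, x))%:E) \_ I01 = (fun s => F (s, x)).
  apply/funext => s; rewrite patchE /F /= indicE.
  by case: ifPn => _; rewrite ?mulr1 ?mulr0.
exact: ix.
Qed.

End unit_Fubini.

(** * Integration by parts against test functions *)

Section directional_calculus.
Context (R : realType) (n : nat).
Implicit Types (f g : 'rV[R]_n -> R) (U : set 'rV[R]_n) (v z : 'rV[R]_n).
Local Notation mu := (lebesgue_rV R n).
Local Notation leb := (@lebesgue_measure R).
Local Notation I01 := (`[0, 1]%classic : set R).

Lemma lebesgue_unit : leb I01 = 1%E.
Proof. by rewrite lebesgue_measure_itv/= lte_fin ltr01 oppr0 adde0. Qed.

Lemma test_lin U c f g : test_function U f -> test_function U g ->
  test_function U (fun x => c * f x + g x).
Proof.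
move=> [sf cf fU] [sg cg gU].
have cK : compact (support f `|` support g) by exact: compactU.
have sub : support (fun x => c * f x + g x) `<=` support f `|` support g.
  apply: support_sub; first by apply: closedU; exact: closed_support.
  move=> x /not_orP[/support_out -> /support_out ->]; by rewrite mulr0 addr0.
split.
- exact: (smoothD (smoothM (smooth_cst c) sf) sg).
- by apply: subclosed_compact cK sub; exact: closed_support.
- by apply: subset_trans sub _; rewrite subUset.
Qed.

Lemma test0 U : test_function U (fun=> 0).
Proof.
have sub : support (fun=> 0 : R) `<=` (set0 : set 'rV[R]_n).
  by apply: support_sub => //; exact: closed0.
split; [exact: smooth_cst | | by apply: subset_trans sub _].
exact: subclosed_compact (@closed_support _ _ _) (@compact0 _) sub.
Qed.

Definition dird f v : 'rV[R]_n -> R := fun x => \sum_i v ord0 i * partial i f x.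

Lemma test_dird U f v : test_function U f -> test_function U (dird f v).
Proof.
move=> tf; rewrite /dird; elim: (index_enum _) => [|i r IH].
  by under eq_fun do rewrite big_nil; exact: test0.
by under eq_fun do rewrite big_cons; apply: test_lin => //; exact: test_partial.
Qed.

Lemma continuous_dird f v : smooth f -> continuous (dird f v).
Proof.
move=> sf; rewrite /dird; elim: (index_enum _) => [|i r IH].
  by under eq_fun do rewrite big_nil; exact: cst_continuous.
under eq_fun do rewrite big_cons; move=> x.
apply: (@continuousD _ _ _ (fun x => v ord0 i * partial i f x)) (IH x).
apply: (@continuousM _ _ (cst (v ord0 i))); first exact: cst_continuous.
by apply: smooth_continuous; exact: smooth_partial.
Qed.

Lemma measurable_ray z : measurable_fun [set: measurableTypeR R * 'rV[R]_n]
  (fun p => p.2 + p.1 *: z).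
Proof.
apply: measurable_fun_rV => i; under eq_fun do rewrite !mxE.
apply: measurable_funD.
  exact: (measurableT_comp (measurable_coord_rV i) measurable_snd).
by apply: measurable_funM => //; exact: measurable_fst.
Qed.

(** The derivative of [s |-> f (x + s v)] is the directional derivative of [f] along
    the ray. *)
Lemma smooth_FTC f v x : smooth f ->
  (\int[leb]_(s in I01) (dird f v (x + s *: v)%R)%:E = (f (x + v)%R - f x)%:E)%E.
Proof.
move=> sf; pose F (s : R) := f (x + s *: v).
have dF (s : R) : is_derive s 1 F (dird f v (x + s *: v)).
  by have /is_derive_line := smooth_is_derive_vec v (x + s *: v) sf.
have cF : continuous F.
  move=> s; apply: differentiable_continuous; apply/derivable1_diffP.
  by case: (dF s).
have cline : continuous (fun s : R => x + s *: v).
  move=> s; apply: (@continuousD _ _ _ (cst x) (fun s : R => s *: v)).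
    exact: cst_continuous.
  exact: scalel_continuous.
rewrite (@continuous_FTC2 _ (fun s => dird f v (x + s *: v)) F 0 1).
- by rewrite /F scale1r scale0r addr0 EFinB.
- exact: ltr01.
- apply: continuous_subspaceT => s.
  by apply: continuous_comp; [exact: cline | exact: continuous_dird].
- split; [by move=> s _; case: (dF s) | |].
  + exact: (cvg_at_right_filter (cF 0)).
  + exact: (cvg_at_left_filter (cF 1)).
- by move=> s _; rewrite derive1E; case: (dF s).
Qed.

(** Translation invariance: the increments of [f] along [v] have integral zero, and
    by the fundamental theorem of calculus so has the mean of the directional
    derivative over a ray, which has the same integral as the directional derivative
    itself. *)
Lemma integral_dird f v : test_function setT f -> (\int[mu]_x (dird f v x)%:E = 0)%E.
Proof.
move=> tf; have td := test_dird v tf; have [sf _ _] := tf.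
have cd : continuous (dird f v) by exact: continuous_dird.
pose K (p : R * 'rV[R]_n) := dird f v (p.2 + p.1 *: v).
have mK : measurable_fun [set: measurableTypeR R * 'rV[R]_n] K.
  exact: (measurableT_comp (continuous_measurable_rV cd) (measurable_ray v)).
have id := test_integrable td.
have nd : (\int[mu]_x `|dird f v x|%:E < +oo)%E by case/integrableP : id.
have mn : measurable_fun setT (fun x : 'rV[R]_n => `|dird f v x|%:E).
  by apply/measurable_EFinP; apply: measurableT_comp => //; exact: continuous_measurable_rV.
pose C := fine (\int[mu]_x `|dird f v x|%:E)%E.
have KC s : 0 <= s <= 1 -> (\int[mu]_x `|K (s, x)|%:E <= C%:E)%E.
  move=> _; rewrite /C fineK; last first.
    by rewrite ge0_fin_numE//; apply: integral_ge0 => x _; rewrite lee_fin.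
  by rewrite -(ge0_integral_shift (s *: v) mn)//; move=> x; rewrite lee_fin.
have := unit_Fubini mK KC; rewrite /K/=.
under eq_integral do rewrite smooth_FTC//.
under eq_integral do rewrite EFinB.
rewrite integralB//=; last 2 first.
- exact: (integrable_shift _ (test_integrable tf)).
- exact: (test_integrable tf).
rewrite (integral_shift v (test_integrable tf)) subee; last first.
  by apply: integrable_fin_num => //; exact: (test_integrable tf).
have -> : (\int[leb]_(s in I01) \int[mu]_x (dird f v (x + s *: v)%R)%:E =
    \int[mu]_x (dird f v x)%:E)%E.
  transitivity (\int[leb]_(s in I01) (cst (\int[mu]_x (dird f v x)%:E) s))%E.
    by apply: eq_integral => s _; rewrite /= (integral_shift _ id).
  rewrite integral_cst; last exact: measurable_itv.
  rewrite [X in (_ * X)%E](_ : _ = 1%E) ?mule1//; exact: lebesgue_unit.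
by move=> <-.
Qed.

Lemma dird_delta f i : dird f (delta_mx ord0 i) = partial i f.
Proof.
apply/funext => x; rewrite /dird (bigD1 i)//= !mxE !eqxx mul1r big1 ?addr0// => j ji.
by rewrite mxE (negbTE ji) andbF mul0r.
Qed.

Lemma integral_partial f i : test_function setT f -> (\int[mu]_x (partial i f x)%:E = 0)%E.
Proof. by move=> tf; rewrite -(dird_delta f i); exact: integral_dird. Qed.

Lemma test_L2dotT U (w : 'rV[R]_n -> R) f : test_function U f ->
  L2dot U w f = L2dot setT w f.
Proof.
move=> tf; rewrite /L2dot Rintegral_mkcond; apply: eq_Rintegral => x _.
rewrite patchE; case: ifPn => //; rewrite notin_setE => Ux.
by rewrite (test_out tf Ux) mulr0.
Qed.

(** The product with a test function is a test function, whose partial derivatives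
    have integral zero. *)
Lemma smooth_weak_gradient U f : smooth f -> weak_gradient U f (fun i => partial i f).
Proof.
move=> sf phi tphi i.
have tphiT := testW (@subsetT _ U) tphi.
have tp := test_partial i tphi; have tpT := test_partial i tphiT.
rewrite (test_L2dotT _ tp) (test_L2dotT _ tphi).
have [sphi _ _] := tphi.
have i1 := test_integrable (testM sf tpT).
have i2 := test_integrable (testM (smooth_partial i sf) tphiT).
have := integral_partial i (testM sf tphiT); rewrite partialM//.
under eq_integral => x _.
  have -> : ((f \* partial i phi \+ phi \* partial i f) x)%:E =
     ((f x * partial i phi x)%:E + (partial i f x * phi x)%:E)%E.
    by rewrite -EFinD /= [phi x * _]mulrC.
  over.
rewrite integralD//= => H; apply/eqP; rewrite -addr_eq0; apply/eqP.
rewrite /L2dot /Rintegral -fineD ?H//.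
- exact: (integrable_fin_num measurableT i1).
- exact: (integrable_fin_num measurableT i2).
Qed.

End directional_calculus.

(** * The fundamental lemma of the calculus of variations *)

Section density_measure.
Context (R : realType) (n : nat) (f : 'rV[R]_n -> \bar R).
Hypotheses (mf : measurable_fun setT f) (f0 : forall x, (0 <= f x)%E).

Definition density (A : set 'rV[R]_n) : \bar R := (\int[lebesgue_rV R n]_(x in A) f x)%E.

Let density0 : density set0 = 0%E. Proof. exact: integral_set0. Qed.

Let density_ge0 A : (0 <= density A)%E. Proof. exact: integral_ge0. Qed.

Let density_sigma_additive : semi_sigma_additive density.
Proof. exact: semi_sigma_additive_nng_induced. Qed.

HB.instance Definition _ := isMeasure.Build _ _ _ density density0 density_ge0
  density_sigma_additive.

Definition density_measure : {measure set 'rV[R]_n -> \bar R} := density.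

End density_measure.

Section du_bois_reymond.
Context (R : realType) (n : nat).
Local Notation mu := (lebesgue_rV R n).

(** The positive and negative parts of [G] are densities of two finite measures that
    agree on boxes, hence everywhere. *)
Lemma ae0_of_boxes (G : 'rV[R]_n -> R) : mu.-integrable setT (EFin \o G) ->
  (forall a b, (\int[mu]_(x in open_box a b) (G x)%:E = 0)%E) ->
  {ae mu, forall x, G x = 0}.
Proof.
move=> iG GB; have [mG _] := integrableP _ _ _ iG.
pose Gp := (EFin \o G)^\+%E; pose Gm := (EFin \o G)^\-%E.
have mGp : measurable_fun setT Gp by exact: measurable_funepos.
have mGm : measurable_fun setT Gm by exact: measurable_funeneg.
have Gp0 x : (0 <= Gp x)%E by exact: funepos_ge0.
have Gm0 x : (0 <= Gm x)%E by exact: funeneg_ge0.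
have iGp : mu.-integrable setT Gp by exact: integrable_funepos.
have iGm : mu.-integrable setT Gm by exact: integrable_funeneg.
pose mp := density_measure mGp Gp0; pose mm := density_measure mGm Gm0.
have lt_p A : measurable A -> (mp A < +oo)%E.
  move=> mA; rewrite /mp /=.
  have : (\int[mu]_(x in A) Gp x < +oo)%E by apply: integrable_lty => //; exact: integrableS iGp.
  by [].
have fin_m A : measurable A -> (mm A \is a fin_num)%E.
  move=> mA; rewrite ge0_fin_numE; last exact: measure_ge0.
  have : (\int[mu]_(x in A) Gm x < +oo)%E by apply: integrable_lty => //; exact: integrableS iGm.
  by [].
have boxE B : open_boxes B -> mp B = mm B.
  move=> [a [b ->]]; have := GB a b; rewrite integralE => /eqP.
  rewrite sube_eq ?add0e; first by move=> /eqP.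
    by rewrite ge0_fin_numE; [exact: (lt_p _ (measurable_open_box _ _))|exact: integral_ge0].
  rewrite fin_num_adde_defl//.
  exact: (fin_m _ (measurable_open_box _ _)).
have allE A : measurable A -> mp A = mm A.
  apply: (measure_unique (@open_boxes R n)
    (fun k => open_box (fun _ => - k%:R) (fun _ => k%:R))) => //.
  - exact: measurable_rV_open_boxes.
  - exact: setI_closed_open_boxes.
  - by move=> k; exists (fun=> - k%:R), (fun=> k%:R).
  - exact: cover_open_boxes.
  - by move=> k; apply: lt_p; exact: measurable_open_box.
have : ae_eq mu setT (EFin \o G) (cst 0%E).
  apply: integral_ae_eq => // A _ mA.
  rewrite integral0 integralE.
  have := allE A mA; rewrite /mp /mm /= /density => ->.
  by rewrite subee//; exact: (fin_m _ mA).
by apply: filterS => x /(_ I)[].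
Qed.

(** Testing against bumps that increase to the indicator of a box shows that [F] has
    integral zero on every box. *)
Lemma du_bois_reymond (a b : 'I_n -> R) (F : 'rV[R]_n -> R) :
  mu.-integrable (open_box a b) (EFin \o F) ->
  (forall phi, test_function (closed_box a b) phi ->
     (forall x, ~ open_box a b x -> phi x = 0) ->
     (\int[mu]_(x in open_box a b) (F x * phi x)%:E = 0)%E) ->
  {ae mu, forall x, open_box a b x -> F x = 0}.
Proof.
set C := open_box a b => iF H; have mC : measurable C by exact: measurable_open_box.
have iG : mu.-integrable setT (EFin \o (F \_ C)).
  by rewrite -restrict_EFin; apply/(integrable_mkcond _ mC).
suff : {ae mu, forall x, (F \_ C) x = 0}.
  by apply: filterS => x; rewrite patchE => + Cx; rewrite mem_set.
apply: ae0_of_boxes => // a' b'.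
pose c i := Num.max (a i) (a' i); pose d i := Num.min (b i) (b' i).
have DE : open_box c d = C `&` open_box a' b'.
  apply/seteqP; split=> x /=.
    by move=> xcd; split=> i; have := xcd i; rewrite /= !in_itv/= gt_max lt_min
      => /andP[/andP[? ?] /andP[? ?]]; apply/andP.
  move=> [h1 h2] i; have := h1 i; have := h2 i; rewrite /= !in_itv/= gt_max lt_min.
  by move=> /andP[-> ->] /andP[-> ->].
have [mF _] := integrableP _ _ _ iF.
pose f_ k x := (F x * bump k.+1%:R^-1 c d x)%:E.
pose f x := (F x * \1_(open_box c d) x)%:E.
have mb k : measurable_fun setT (bump k.+1%:R^-1 c d).
  by apply: continuous_measurable_rV; apply: smooth_continuous; apply: smooth_bump.
have mF' : measurable_fun C F by apply/measurable_EFinP.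
have -> : (\int[mu]_(x in open_box a' b') ((F \_ C) x)%:E = \int[mu]_(x in C) f x)%E.
  rewrite integral_mkcond [RHS]integral_mkcond; apply: eq_integral => x _.
  rewrite !patchE /f DE indicI /= !indicE.
  by case: (x \in C); case: (x \in open_box _ _); rewrite /= ?mulr1 ?mulr0 ?mul1r.
have fcvg x : C x -> f_ ^~ x @ \oo --> f x.
  move=> _; rewrite /f_ /f; apply: cvg_EFin; first exact: nearW.
  exact: (cvgM (cvg_cst (F x)) (@bump_cvg R n c d x)).
have := @dominated_convergence _ _ _ mu C mC f_ f (abse \o (EFin \o F)).
case.
- by move=> k; apply/measurable_EFinP; apply: measurable_funM => //; exact: measurable_funTS.
- apply/measurable_EFinP; apply: measurable_funM => //; apply: measurable_funTS.
  by apply: measurable_indic; exact: measurable_open_box.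
- exact: aeW.
- exact: integrable_abse.
- apply: aeW => x k _; rewrite /f_ /= lee_fin normrM (ger0_norm (bump_ge0 _ _ _ _)) ler_piMr//.
  by apply: bump_le1; rewrite invr_gt0.
move=> _ _ cv.
have E : (fun k => \int[mu]_(x in C) f_ k x)%E = (fun=> 0%E).
  apply/funext => k; apply: H.
    apply: test_bump; first by rewrite invr_gt0.
    move=> x xcd i; have := xcd i; rewrite /= !in_itv/= ge_max le_min.
    by move=> /andP[/andP[-> _] /andP[-> _]].
  by move=> x Cx; apply: bump_eq0; rewrite DE => -[].
move: cv; rewrite /= E => cv; exact: (cvg_unique _ cv (cvg_cst _)).
Qed.
End du_bois_reymond.

(** * Sobolev functions along segments *)

Section unit_jensen.
Context (R : realType).
Local Notation leb := (@lebesgue_measure R).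
Local Notation I01 := (`[0, 1]%classic : set R).

(** The square of the mean is at most the mean of the square: expand the square of
    [w - m]. *)
Lemma unit_jensen (w : R -> R) : leb.-integrable I01 (EFin \o w) ->
  ((((\int[leb]_(s in I01) w s)%R ^+ 2)%:E <= \int[leb]_(s in I01) (w s ^+ 2)%:E)%E).
Proof.
move=> iw; have mI : measurable (I01 : set (measurableTypeR R)) by exact: measurable_itv.
have mw : measurable_fun I01 w by apply/measurable_EFinP; case/integrableP : iw.
have mw2 : measurable_fun I01 (fun s => (w s ^+ 2)%:E).
  by apply/measurable_EFinP; exact: measurable_funX.
have q0 : (0 <= \int[leb]_(s in I01) (w s ^+ 2)%:E)%E.
  by apply: integral_ge0 => s _; rewrite lee_fin sqr_ge0.
have [->|qy] := eqVneq (\int[leb]_(s in I01) (w s ^+ 2)%:E)%E +oo%E; first exact: leey.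
have qlt : (\int[leb]_(s in I01) (w s ^+ 2)%:E < +oo)%E by rewrite ltey.
have iw2 : leb.-integrable I01 (EFin \o (fun s => w s ^+ 2)).
  apply/integrableP; split=> //.
  by under eq_integral do rewrite gee0_abs ?lee_fin ?sqr_ge0//.
have qfin : (\int[leb]_(s in I01) (w s ^+ 2)%:E)%E \is a fin_num by rewrite ge0_fin_numE.
rewrite -(fineK qfin) lee_fin -/(Rintegral leb I01 (fun s => w s ^+ 2)).
set m := Rintegral leb I01 w; set q := Rintegral _ _ _.
have icst (c : R) : leb.-integrable I01 (EFin \o cst c).
  apply/integrableP; split; first by apply/measurable_EFinP; exact: measurable_cst.
  rewrite (_ : (fun=> _) = cst (`|c|%:E))//.
  rewrite integral_cst// [X in (_ * X)%E](_ : _ = 1%E) ?mule1 ?ltry//.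
  exact: lebesgue_unit.
have iZ (c : R) : leb.-integrable I01 (EFin \o (fun s => c * w s)).
  have -> : EFin \o (fun s => c * w s) = (fun s => c%:E * (EFin \o w) s)%E.
    by apply/funext => s /=; rewrite EFinM.
  exact: integrableZl.
have : 0 <= \int[leb]_(s in I01) (w s ^+ 2 + ((- (2 * m)) * w s + m ^+ 2)).
  apply: Rintegral_ge0 => s _; have := sqr_ge0 (w s - m); nra.
have iD : leb.-integrable I01 (EFin \o (fun s => - (2 * m) * w s + m ^+ 2)).
  have -> : EFin \o (fun s => - (2 * m) * w s + m ^+ 2) =
     (fun s => (EFin \o (fun s => (- (2 * m) * w s)%R)) s + (EFin \o cst (m ^+ 2)%R) s)%E.
    by apply/funext => s /=; rewrite EFinD.
  exact: integrableD.
rewrite (RintegralD mI iw2 iD) (RintegralD mI (iZ _) (icst _)).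
rewrite RintegralZl// -/m -/q Rintegral_cst//.
set F := fine _; have -> : F = 1 by exact: (congr1 fine (lebesgue_unit R)).
rewrite mulr1.
move=> h; have {}h : 0 <= q + (- (2 * m) * m + m * m) by exact: h.
rewrite expr2; lra.
Qed.

End unit_jensen.

Section integrability_helpers.
Context (R : realType) (n : nat).
Local Notation mu := (lebesgue_rV R n).

Lemma integrable_mul_bounded (f phi : 'rV[R]_n -> R) (M : R) :
  mu.-integrable setT (EFin \o f) -> measurable_fun setT phi ->
  (forall x, `|phi x| <= M) -> mu.-integrable setT (fun x => (f x * phi x)%:E).
Proof.
move=> iF mphi phiM; have [/measurable_EFinP mf _] := integrableP _ _ _ iF.
apply: (@le_integrable _ _ _ _ _ measurableT _ (fun x => M%:E * (EFin \o f) x)%E).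
- by apply/measurable_EFinP; exact: measurable_funM.
- move=> x _; rewrite /= lee_fin !normrM mulrC ler_wpM2r//.
  by apply: le_trans (phiM x) _; exact: ler_norm.
- exact: integrableZl.
Qed.

Lemma L2_indic (B : set 'rV[R]_n) : measurable B -> (mu B < +oo)%E -> L2 setT (\1_B : 'rV[R]_n -> R).
Proof.
move=> mB By; apply: L2P; first exact: measurable_indic.
have E : (fun x : 'rV[R]_n => ((\1_B x : R) ^+ 2)%:E) = (fun x => (\1_B x)%:E).
  by apply/funext => x; rewrite indicE; case: (_ \in _); rewrite /= ?expr1n ?expr0n.
by rewrite E integral_indic// setIT.
Qed.

Lemma L2_indic_integrable (w : 'rV[R]_n -> R) (B : set 'rV[R]_n) : L2 setT w ->
  measurable B -> (mu B < +oo)%E -> mu.-integrable setT (EFin \o (fun x => w x * \1_B x)).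
Proof. by move=> w2 mB By; apply: L2M_integrable => //; exact: L2_indic. Qed.

(** The weak derivative along [z], extended by zero outside [W] so that it can be
    integrated over translates. *)
Definition ext_grad (W : set 'rV[R]_n) (g : 'I_n -> 'rV[R]_n -> R) (z : 'rV[R]_n) :
  'rV[R]_n -> R := \sum_i z ord0 i *: (g i \_ W).

Lemma ext_gradE W g z x : ext_grad W g z x = \sum_i z ord0 i * (g i \_ W) x.
Proof. by rewrite /ext_grad fct_sumE. Qed.

Lemma L2_ext_grad W g z : measurable W -> (forall i, L2 W (g i)) -> L2 setT (ext_grad W g z).
Proof.
move=> mW g2; apply: (@subspace_sum _ _ _ (L2_subspace measurableT)) => i _.
exact: L2_ext.
Qed.

Lemma dirdE (f : 'rV[R]_n -> R) v : dird f v = \sum_i v ord0 i *: partial i f.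
Proof. by apply/funext => x; rewrite fct_sumE. Qed.

Lemma weak_dird W u g z psi : measurable W -> H1 W u g -> test_function W psi ->
  L2dot setT (ext_grad W g z) psi = - L2dot setT (u \_ W) (dird psi z).
Proof.
move=> mW [u2 g2 wg] tpsi.
have L2T := L2_subspace (@measurableT _ 'rV[R]_n).
have [fC _ fl] := L2_form (@measurableT _ 'rV[R]_n).
have p2 : L2 setT psi by exact: test_L2 tpsi.
have u2T : L2 setT (u \_ W) by exact: L2_ext.
have g2T i : L2 setT (g i \_ W) by exact: L2_ext.
have pp2 i : L2 setT (partial i psi) by apply: test_L2 => //; exact: test_partial tpsi.
rewrite /ext_grad (functional_sum L2T (fl _ p2))// fC dirdE.
rewrite (functional_sum L2T (fl _ u2T))// -sumrN; apply: eq_bigr => i _.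
rewrite -mulrN (fC (partial i psi)); congr (_ * _).
rewrite !L2dot_extl//.
by have := wg psi tpsi i => ->; rewrite opprK.
Qed.

End integrability_helpers.

Section ray_integrals.
Context (R : realType) (n : nat).
Local Notation mu := (lebesgue_rV R n).
Local Notation leb := (@lebesgue_measure R).
Local Notation I01 := (`[0, 1]%classic : set R).

Lemma integrable_ray_integral (p : 'rV[R]_n -> R) z : mu.-integrable setT (EFin \o p) ->
  mu.-integrable setT (fun x => \int[leb]_(s in I01) (p (x + s *: z)%R)%:E)%E /\
  {ae mu, forall x, leb.-integrable I01 (fun s => (p (x + s *: z)%R)%:E)}.
Proof.
move=> ip; have [/measurable_EFinP mp lp] := integrableP _ _ _ ip.
have mK : measurable_fun [set: measurableTypeR R * 'rV[R]_n] (fun q => p (q.2 + q.1 *: z)).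
  exact: (measurableT_comp mp (measurable_ray z)).
have mn : measurable_fun setT (fun x : 'rV[R]_n => `|p x|%:E).
  by apply/measurable_EFinP; exact: measurableT_comp.
pose C := fine (\int[mu]_x `|p x|%:E)%E.
have CE : (\int[mu]_x `|p x|%:E)%E = C%:E.
  by rewrite /C fineK// ge0_fin_numE//; apply: integral_ge0 => x _; rewrite lee_fin.
have KC s : 0 <= s <= 1 -> (\int[mu]_x `|p (x + s *: z)%R|%:E <= C%:E)%E.
  by move=> _; rewrite -CE -(ge0_integral_shift (s *: z) mn)//; move=> x; rewrite lee_fin.
split; first exact: (integrable_unit_Fubini mK KC).
exact: (ae_unit_integrable mK KC).
Qed.
End ray_integrals.

Lemma closed_box_shift (R : realType) n (a b : 'I_n -> R) (v y : 'rV[R]_n) :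
  closed_box (fun i => a i + v ord0 i) (fun i => b i + v ord0 i) y <-> closed_box a b (y - v).
Proof.
by split=> H i; have := H i; rewrite /= !in_itv/= !mxE lerBrDr lerBlDr.
Qed.

Section translation_identity.
Context (R : realType) (n : nat).
Local Notation mu := (lebesgue_rV R n).
Local Notation leb := (@lebesgue_measure R).
Local Notation I01 := (`[0, 1]%classic : set R).
Variables (W : set 'rV[R]_n) (u : 'rV[R]_n -> R) (g : 'I_n -> 'rV[R]_n -> R).
Hypotheses (oW : open W) (ug : H1 W u g).
Variables (z : 'rV[R]_n) (a b : 'I_n -> R).
Hypothesis seg : forall x s, closed_box a b x -> 0 <= s <= 1 -> W (x + s *: z).

Let mW : measurable W. Proof. exact: open_measurable_rV. Qed.
Let u2 : L2 setT (u \_ W). Proof. by case: ug => u2 _ _; exact: L2_ext. Qed.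
Let gz := ext_grad W g z.
Let gz2 : L2 setT gz. Proof. by case: ug => _ g2 _; exact: L2_ext_grad. Qed.

Let radius : exists2 r : R, 0 < r &
  forall x s, closed_box a b x -> 0 <= s <= 1 -> `|x + s *: z| < r.
Proof.
have [r r0 rP] := compact_bounded_rV (@compact_closed_box R n a b).
exists (r + `|z|); first by rewrite ltr_wpDr.
move=> x s /rP xr /andP[s0 s1]; apply: le_lt_trans (ler_normD _ _) _.
by rewrite ltr_leD// normrZ ger0_norm// ler_piMl.
Qed.

Let r := projT1 (cid2 radius).
Let B : set 'rV[R]_n := open_box (fun=> - r) (fun=> r).

Let segB x s : closed_box a b x -> 0 <= s <= 1 -> B (x + s *: z).
Proof.
rewrite /B /r; case: (cid2 radius) => r' /= r0 rP h1 h2.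
by apply: norm_box => //; exact: rP.
Qed.

Let mB : measurable B. Proof. exact: measurable_open_box. Qed.
Let By : (mu B < +oo)%E. Proof. exact: lebesgue_open_box_lty. Qed.

Let p x := gz x * \1_B x.
Let q x := (u \_ W) x * \1_B x.
Let ip : mu.-integrable setT (EFin \o p). Proof. exact: L2_indic_integrable. Qed.
Let iq : mu.-integrable setT (EFin \o q). Proof. exact: L2_indic_integrable. Qed.

Let oc x : open_box a b x -> closed_box a b x.
Proof. by move=> xab i; have := xab i; rewrite /= !in_itv/= => /andP[/ltW -> /ltW ->]. Qed.

Section against_test_function.
Variable phi : 'rV[R]_n -> R.
Hypotheses (tphi : test_function (closed_box a b) phi).

Let tphiT : test_function setT phi. Proof. exact: testW tphi. Qed.

Let mphi : measurable_fun setT phi.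
Proof.
by case: tphi => sf _ _; apply: continuous_measurable_rV; exact: smooth_continuous.
Qed.

Let psi (s : R) : 'rV[R]_n -> R := phi \o affine 1 (- (s *: z)).

Let psiE s y : psi s y = phi (y - s *: z).
Proof. by rewrite /psi /= /affine scale1r. Qed.

Let psi_out s y : 0 <= s <= 1 -> ~ (W y /\ B y) -> psi s y = 0.
Proof.
move=> s01; apply: contra_notP => py.
have : closed_box a b (y - s *: z).
  by apply: contra_notP py => /(test_out tphi); rewrite psiE.
by move=> cy; have := seg cy s01; have := segB cy s01; rewrite subrK.
Qed.

Let tpsi s : 0 <= s <= 1 -> test_function W (psi s).
Proof.
move=> s01; have [sphi _ _] := tphi.
pose a' i := a i + (s *: z) ord0 i; pose b' i := b i + (s *: z) ord0 i.
have boxE y : closed_box a' b' y <-> closed_box a b (y - s *: z) by exact: closed_box_shift.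
have sub : support (psi s) `<=` closed_box a' b'.
  apply: support_sub; first exact: closed_closed_box.
  move=> y; rewrite psiE => H; apply: (test_out tphi) => cy; apply: H; exact/boxE.
split.
- by case: (smooth_affine 1 (- (s *: z)) sphi).
- exact: subclosed_compact (@closed_support _ _ _) (@compact_closed_box R n a' b') sub.
- apply: subset_trans sub _ => y /boxE cy.
  by have := seg cy s01; rewrite subrK.
Qed.

Let dpsiE s y : dird (psi s) z y = dird phi z (y - s *: z).
Proof.
have [sphi _ _] := tphi; have [_ pE] := smooth_affine 1 (- (s *: z)) sphi.
by rewrite /dird; apply: eq_bigr => i _; rewrite /psi pE mul1r /affine scale1r.
Qed.

Let td : test_function setT (dird phi z). Proof. exact: test_dird. Qed.
Let cd : continuous (dird phi z).
Proof. by case: td => sf _ _; exact: smooth_continuous. Qed.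
Let md : measurable_fun setT (dird phi z).
Proof. exact: continuous_measurable_rV. Qed.

Let weak_s s : 0 <= s <= 1 ->
  (\int[mu]_x (p x * phi (x - s *: z)%R)%:E =
   \int[mu]_x (- (q x * dird phi z (x - s *: z)%R))%:E)%E.
Proof.
move=> s01; have := weak_dird z mW ug (tpsi s01).
have [M _ phiM] := test_bounded tphi; have [M' _ dM] := test_bounded td.
have ms : measurable_fun setT (fun x : 'rV[R]_n => x - s *: z) by exact: measurable_shift.
have i1 : mu.-integrable setT (fun x => (p x * phi (x - s *: z))%:E).
  by apply: integrable_mul_bounded ip _ _; [exact: (measurableT_comp mphi ms)|].
have i2 : mu.-integrable setT (fun x => (q x * dird phi z (x - s *: z))%:E).
  by apply: integrable_mul_bounded iq _ _; [exact: (measurableT_comp md ms)|].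
have td' := test_dird z (tpsi s01).
have E1 : L2dot setT gz (psi s) = \int[mu]_x (p x * phi (x - s *: z)).
  apply: eq_Rintegral => x _; rewrite /p -psiE indicE.
  have [xB|xB] := boolP (x \in B); first by rewrite mulr1.
  rewrite psi_out ?mulr0 ?mul0r// => -[_ Bx].
  by move: xB; rewrite notin_setE.
have E2 : L2dot setT (u \_ W) (dird (psi s) z) = \int[mu]_x (q x * dird phi z (x - s *: z)).
  apply: eq_Rintegral => x _; rewrite /q -dpsiE indicE.
  have [xB|xB] := boolP (x \in B); first by rewrite mulr1.
  have [->|dx] := eqVneq (dird (psi s) z x) 0; first by rewrite !mulr0.
  exfalso; move: xB; rewrite notin_setE; apply.
  have : support (psi s) x.
    apply: contra_notP (negP dx) => sx; apply/eqP; rewrite /dird big1// => i _.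
    by rewrite partial_out// mulr0.
  move=> sx; suff : support (psi s) `<=` closed_box (fun i => a i + (s *: z) ord0 i)
      (fun i => b i + (s *: z) ord0 i).
    move=> /(_ _ sx) /closed_box_shift cx.
    by have := segB cx s01; rewrite subrK.
  apply: support_sub; first exact: closed_closed_box.
  move=> y; rewrite psiE => H; apply: (test_out tphi) => cy; apply: H.
  exact/closed_box_shift.
rewrite E1 E2 => E.
under [RHS]eq_integral do rewrite EFinN.
rewrite integralN; last first.
  exact: integrable_add_def i2.
have f1 := integrable_fin_num measurableT i1.
have f2 := integrable_fin_num measurableT i2.
by rewrite -(fineK f1) -(fineK f2) -EFinN; congr EFin.
Qed.

Let intC (f : 'rV[R]_n -> R) : mu.-integrable setT (EFin \o f) ->
  (\int[mu]_x `|f x|%:E)%E = (fine (\int[mu]_x `|f x|%:E)%E)%:E.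
Proof.
move=> /integrableP[_ lf]; rewrite fineK// ge0_fin_numE//.
by apply: integral_ge0 => x _; rewrite lee_fin.
Qed.

Let int_bound (f h : 'rV[R]_n -> R) (M : R) (w : 'rV[R]_n) : mu.-integrable setT (EFin \o f) ->
  0 <= M -> measurable_fun setT h -> (forall x, `|h x| <= M) ->
  (\int[mu]_x `|f (x + w)%R * h x|%:E <= (M * fine (\int[mu]_x `|f x|%:E))%:E)%E.
Proof.
move=> iF M0 mh hM; have [/measurable_EFinP mf _] := integrableP _ _ _ iF.
have mabs : measurable_fun setT (fun x => `|f x|%:E).
  by apply/measurable_EFinP; exact: measurableT_comp.
have msh := measurable_shift w.
have mfw : measurable_fun setT (fun x : 'rV[R]_n => f (x + w)) by exact: (measurableT_comp mf msh).
rewrite EFinM -intC// -(ge0_integral_shift w mabs) => [|x]; last by rewrite lee_fin.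
rewrite -ge0_integralZl_EFin//; last exact: (measurableT_comp mabs msh).
apply: ge0_le_integral => //.
- apply/measurable_EFinP; apply: measurableT_comp => //; exact: measurable_funM.
- apply: measurable_funeM; exact: (measurableT_comp mabs msh).
- by move=> x _; rewrite -EFinM lee_fin normrM mulrC ler_wpM2r.
Qed.

(** For fixed [s] the translate of [phi] by [s z] is still supported in [W], and the
    weak derivative moves [z] onto it. Integrating in [s], the fundamental theorem
    of calculus for the smooth function [phi] turns the derivative into the
    difference of [phi] and its translate. *)
Lemma weak_translation_identity :
  (\int[mu]_x (q (x + z)%R * phi x)%:E - \int[mu]_x (q x * phi x)%:E =
   \int[mu]_x \int[leb]_(s in I01) (p (x + s *: z)%R * phi x)%:E)%E /\
  mu.-integrable setT (fun x => \int[leb]_(s in I01) (p (x + s *: z)%R * phi x)%:E)%E.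
Proof.
have [sphi _ _] := tphi.
have [M M0 phiM] := test_bounded tphi; have [M' M'0 dM] := test_bounded td.
have [/measurable_EFinP mp _] := integrableP _ _ _ ip.
have [/measurable_EFinP mq _] := integrableP _ _ _ iq.
pose K1 (t : R * 'rV[R]_n) := p (t.2 + t.1 *: z) * phi t.2.
pose K2 (t : R * 'rV[R]_n) := - (q t.2 * dird phi z (t.2 - t.1 *: z)).
have mK1 : measurable_fun [set: measurableTypeR R * 'rV[R]_n] K1.
  apply: measurable_funM; first exact: (measurableT_comp mp (measurable_ray z)).
  exact: (measurableT_comp mphi measurable_snd).
have rayN : (fun t : measurableTypeR R * 'rV[R]_n => t.2 - t.1 *: z) =
    (fun t => t.2 + t.1 *: (- z)) by apply/funext => t; rewrite scalerN.
have mK2 : measurable_fun [set: measurableTypeR R * 'rV[R]_n] K2.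
  apply: measurableT_comp => //; apply: measurable_funM.
    exact: (measurableT_comp mq measurable_snd).
  by apply: (measurableT_comp md); rewrite rayN; exact: measurable_ray.
have KC1 s : 0 <= s <= 1 -> (\int[mu]_x `|K1 (s, x)|%:E <=
    (M * fine (\int[mu]_x `|p x|%:E))%:E)%E.
  by move=> _; exact: (@int_bound p phi M (s *: z) ip M0 mphi phiM).
have KC2 s : 0 <= s <= 1 -> (\int[mu]_x `|K2 (s, x)|%:E <=
    (M' * fine (\int[mu]_x `|q x|%:E))%:E)%E.
  move=> _; have ms := measurable_shift (- (s *: z)).
  have := @int_bound q (fun x => dird phi z (x - s *: z)) M' 0 iq M'0
    (measurableT_comp md ms) (fun x => dM _).
  by apply: le_trans; rewrite le_eqVlt; apply/orP; left; apply/eqP;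
    apply: eq_integral => x _; rewrite /K2/= normrN addr0.
have inner1 s : 0 <= s <= 1 -> (\int[mu]_x (K1 (s, x))%:E = \int[mu]_x (K2 (s, x))%:E)%E.
  move=> s01; rewrite -(weak_s s01).
  have ms := measurable_shift (- (s *: z)).
  have i1 : mu.-integrable setT (EFin \o (fun x => p x * phi (x - s *: z))).
    by apply: integrable_mul_bounded ip _ _; [exact: (measurableT_comp mphi ms)|].
  rewrite -(integral_shift (s *: z) i1).
  by apply: eq_integral => x _; rewrite /K1/= addrK.
have inner2 y : (\int[leb]_(s in I01) (K2 (s, y))%:E =
    (q y * phi (y - z) - q y * phi y)%:E)%E.
  have FTC := smooth_FTC (- z) y sphi.
  have dN s : dird phi (- z) (y + s *: (- z)) = - dird phi z (y - s *: z).
    by rewrite scalerN /dird -sumrN; apply: eq_bigr => i _; rewrite mxE mulNr.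
  have -> : (fun s => (K2 (s, y))%:E) =
     (fun s => (q y)%:E * (dird phi (- z) (y + s *: (- z)))%:E)%E.
    by apply/funext => s; rewrite -EFinM dN mulrN.
  rewrite integralZl//; first by rewrite FTC -EFinM mulrBr.
  apply: continuous_compact_integrable; first exact: segment_compact.
  apply: continuous_subspaceT => s; apply: continuous_comp; last exact: continuous_dird.
  apply: (@continuousD _ _ _ (cst y) (fun s : R => s *: (- z))).
    exact: cst_continuous.
  exact: scalel_continuous.
have H1 := unit_Fubini mK1 KC1; have H2 := unit_Fubini mK2 KC2.
have I1 := integrable_unit_Fubini mK1 KC1; rewrite /K1 /= in H1 I1.
split=> //; rewrite H1.
have -> : (\int[leb]_(s in I01) \int[mu]_x (p (x + s *: z)%R * phi x)%:E =
    \int[leb]_(s in I01) \int[mu]_x (K2 (s, x))%:E)%E.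
  by apply: eq_integral => s; rewrite inE/= in_itv/= => /inner1.
rewrite -H2; under [RHS]eq_integral do rewrite inner2.
have ms := measurable_shift (- z).
have i1 : mu.-integrable setT (EFin \o (fun x => q x * phi (x - z))).
  by apply: integrable_mul_bounded iq _ _; [exact: (measurableT_comp mphi ms)|].
have i2 : mu.-integrable setT (EFin \o (fun x => q x * phi x)).
  by apply: integrable_mul_bounded iq _ _.
under [RHS]eq_integral do rewrite EFinB.
rewrite [RHS]integralB//; congr (_ - _)%E.
rewrite -(integral_shift z i1).
by apply: eq_integral => x _; rewrite addrK.
Qed.

End against_test_function.
Let P x := (\int[leb]_(s in I01) (p (x + s *: z)%R)%:E)%E.
Let iP : mu.-integrable setT P. Proof. by have [] := integrable_ray_integral z ip. Qed.
Let ae_ray : {ae mu, forall x, leb.-integrable I01 (fun s => (p (x + s *: z)%R)%:E)}.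
Proof. by have [] := integrable_ray_integral z ip. Qed.

Let ifP : mu.-integrable setT (EFin \o (fine \o P)).
Proof.
apply: (le_integrable measurableT _ _ iP).
  by apply/measurable_EFinP; apply: measurableT_comp => //; case/integrableP : iP.
by move=> x _; rewrite /=; case: (P x) => [t| |]//=; rewrite ?normr0 ?leey.
Qed.

Let F x := q (x + z) - q x - fine (P x).

Let iF : mu.-integrable setT (EFin \o F).
Proof.
have -> : EFin \o F = ((fun x => (q (x + z)%R)%:E) \- (EFin \o q) \- (EFin \o (fine \o P)))%E.
  by apply/funext => x; rewrite /= /F !EFinB.
apply: integrableB => //; apply: integrableB => //.
exact: integrable_shift.
Qed.

Let F_test phi : test_function (closed_box a b) phi ->
  (forall x, ~ open_box a b x -> phi x = 0) ->
  (\int[mu]_(x in open_box a b) (F x * phi x)%:E = 0)%E.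
Proof.
move=> tphi phi0; have [E I1] := weak_translation_identity tphi.
have mphi : measurable_fun setT phi.
  by case: tphi => sf _ _; apply: continuous_measurable_rV; exact: smooth_continuous.
have [M M0 phiM] := test_bounded tphi.
have -> : (\int[mu]_(x in open_box a b) (F x * phi x)%:E = \int[mu]_x (F x * phi x)%:E)%E.
  rewrite integral_mkcond; apply: eq_integral => x _; rewrite patchE.
  by case: ifPn => //; rewrite notin_setE => /phi0 ->; rewrite mulr0.
have i1 := integrable_mul_bounded (integrable_shift z iq) mphi phiM.
have i2 := integrable_mul_bounded iq mphi phiM.
have i3 := integrable_mul_bounded ifP mphi phiM.
have E3 : (\int[mu]_x ((fine \o P) x * phi x)%:E =
    \int[mu]_x \int[leb]_(s in I01) (p (x + s *: z)%R * phi x)%:E)%E.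
  apply: ae_eq_integral => //.
  - by case/integrableP : i3.
  - by case/integrableP : I1.
  - apply: filterS ae_ray => x ix _.
    have mI : measurable (I01 : set (measurableTypeR R)) by exact: measurable_itv.
    under [RHS]eq_integral do rewrite EFinM.
    rewrite integralZr// EFinM fineK//.
    exact: (integrable_fin_num mI ix).
have -> : (fun x => (F x * phi x)%:E) = ((fun x => (q (x + z)%R * phi x)%:E) \-
    (fun x => (q x * phi x)%:E) \- (fun x => ((fine \o P) x * phi x)%:E))%E.
  by apply/funext => x; rewrite /= /F !mulrBl !EFinB.
rewrite integralB//; last exact: integrableB.
rewrite integralB// E E3 subee//.
exact: (integrable_fin_num measurableT I1).
Qed.

(** A Sobolev function is absolutely continuous along almost every segment: by the
    previous identity the increment and the integral of the derivative agree against
    all test functions, hence almost everywhere. Jensen then bounds the square of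
    the increment. *)
Lemma H1_translate_ae :
  {ae mu, forall x, open_box a b x ->
    (((u (x + z)%R - u x)%R ^+ 2)%:E <=
      \int[leb]_(s in I01) ((ext_grad W g z (x + s *: z)%R) ^+ 2)%:E)%E}.
Proof.
have mC : measurable (open_box a b) by exact: measurable_open_box.
have := du_bois_reymond (integrableS measurableT mC (@subsetT _ _) iF) F_test.
apply: filterS2 ae_ray => x ix Fx Cx; have cx := oc Cx.
have in1 : (1 : R) \in `[0, 1] by rewrite in_itv/= ler01 lexx.
have W0 : W x by have := @seg x 0 cx; rewrite scale0r addr0; apply; rewrite lexx ler01.
have B0 : B x by have := @segB x 0 cx; rewrite scale0r addr0; apply; rewrite lexx ler01.
have W1 : W (x + z) by have := @seg x 1 cx; rewrite scale1r; apply; rewrite lexx ler01.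
have B1 : B (x + z) by have := @segB x 1 cx; rewrite scale1r; apply; rewrite lexx ler01.
have qE y : W y -> B y -> q y = u y.
  by move=> Wy By_; rewrite /q patchE indicE !mem_set// mulr1.
have pE s : 0 <= s <= 1 -> p (x + s *: z) = gz (x + s *: z).
  by move=> s01; rewrite /p indicE mem_set ?mulr1//; exact: segB.
have /eqP := Fx Cx; rewrite /F !qE// subr_eq0 => /eqP ->.
apply: le_trans (unit_jensen ix) _.
rewrite le_eqVlt; apply/orP; left; apply/eqP; apply: eq_integral => s.
by rewrite inE/= in_itv/= => /pE ->.
Qed.

End translation_identity.

Section translation_open.
Context (R : realType) (n : nat).
Local Notation mu := (lebesgue_rV R n).
Local Notation leb := (@lebesgue_measure R).
Local Notation I01 := (`[0, 1]%classic : set R).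

(** The segment is compact. *)
Lemma segment_tube (W : set 'rV[R]_n) (x z : 'rV[R]_n) : open W ->
  (forall s : R, 0 <= s <= 1 -> W (x + s *: z)) ->
  \forall y \near x, forall s : R, 0 <= s <= 1 -> W (y + s *: z).
Proof.
move=> oW seg.
have H := (compact_near_coveringP (`[0, 1]%classic : set R)).1 (@segment_compact R 0 1) _ (nbhs x)
  (fun y s => W (y + s *: z)) _.
have : \near x, (`[0, 1]%classic : set R) `<=` (fun s : R => W (x + s *: z)).
  apply: H => s; rewrite /= in_itv/= => /seg Ws.
  have cs : (fun p : R * 'rV[R]_n => p.2 + p.1 *: z) @ (s, x) --> x + s *: z.
    apply: cvgD; first exact: cvg_snd.
    by apply: cvgZl; exact: cvg_fst.
  have := cs _ (open_nbhs_nbhs (conj oW Ws)).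
  by [].
by apply: filterS => y H1 s s01; apply: H1; rewrite /= in_itv.
Qed.

(** The boxes on which the estimate is known can be taken with rational centre and
    radius [1 / k]; countably many of them cover the points whose segment lies in
    [W]. *)
Lemma H1_translate_segment W u g (z : 'rV[R]_n) : open W -> H1 W u g ->
  {ae mu, forall x, (forall s : R, 0 <= s <= 1 -> W (x + s *: z)) ->
    (((u (x + z)%R - u x)%R ^+ 2)%:E <=
      \int[leb]_(s in I01) ((ext_grad W g z (x + s *: z)%R) ^+ 2)%:E)%E}.
Proof.
move=> oW ug.
pose lo (q : 'rV[rat]_n * nat) (i : 'I_n) : R := ratr (q.1 ord0 i) - q.2.+1%:R^-1.
pose hi (q : 'rV[rat]_n * nat) (i : 'I_n) : R := ratr (q.1 ord0 i) + q.2.+1%:R^-1.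
pose good q := forall x (s : R), closed_box (lo q) (hi q) x -> 0 <= s <= 1 -> W (x + s *: z).
pose ineq x := (((u (x + z)%R - u x)%R ^+ 2)%:E <=
      \int[leb]_(s in I01) ((ext_grad W g z (x + s *: z)%R) ^+ 2)%:E)%E.
have ae_q (k : nat) : {ae mu, forall x,
    if unpickle k is Some q then good q -> open_box (lo q) (hi q) x -> ineq x else True}.
  case: (unpickle k) => [q|]; last by apply: aeW.
  have [gq|gq] := pselect (good q); last by apply: aeW => x /gq.
  by apply: filterS (H1_translate_ae oW ug gq) => x H _; exact: H.
apply: filterS (ae_foralln ae_q) => x Hx seg.
have /nbhs_ballP[e /= e0 eW] := segment_tube oW seg.
pose k := Num.truncn (2 / e); have k2 : 2 * k.+1%:R^-1 < e.
  have := Num.Theory.truncnS_gt (2 / e); rewrite -/k ltr_pdivrMr// => H.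
  by rewrite ltr_pdivrMr// mulrC.
have k0 : 0 < k.+1%:R^-1 :> R by rewrite invr_gt0.
have /choice[q qP] : forall i : 'I_n, exists q : rat,
    ratr q \in `](x ord0 i), (x ord0 i + k.+1%:R^-1)[.
  by move=> i; apply: rat_in_itvoo; rewrite ltrDl.
have := Hx (pickle (\row_i q i, k)); rewrite pickleK; apply.
  move=> y s By; apply: eW; apply/ball_rV => // i.
  have := By i; have := qP i; rewrite /lo /hi /= !in_itv/= !mxE => /andP[h1 h2] /andP[h3 h4].
  rewrite ltr_norml; move: k2 h1 h2 h3 h4.
  by move: (_^-1) => t *; apply/andP; split; lra.
move=> i; have := qP i; rewrite /lo /hi /= !in_itv/= !mxE => /andP[h1 h2].
by rewrite ltrBlDr h2/= (lt_trans h1)// ltrDl.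
Qed.

End translation_open.

(** * The Poincare inequality on convex sets *)

Section poincare.
Context (R : realType) (n : nat).
Local Notation mu := (lebesgue_rV R n).
Local Notation leb := (@lebesgue_measure R).
Local Notation I01 := (`[0, 1]%classic : set R).

Lemma rV_Tonelli (f : 'rV[R]_n * 'rV[R]_n -> \bar R) : measurable_fun setT f ->
  (forall p, 0 <= f p)%E ->
  (\int[mu]_x \int[mu]_z f (x, z) = \int[mu]_z \int[mu]_x f (x, z))%E.
Proof. by move=> mf f0; exact: (@fubini_tonelli _ _ _ _ R mu mu f mf f0). Qed.

(** The Cauchy-Schwarz inequality in [R^n]. *)
Lemma ext_grad_sqr_le W g (z : 'rV[R]_n) (eta : R) x : (forall i, `|z ord0 i| <= eta) ->
  ext_grad W g z x ^+ 2 <= n%:R * eta ^+ 2 * \sum_i ((g i \_ W) x) ^+ 2.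
Proof.
move=> zeta; rewrite ext_gradE.
have CS (a b : 'I_n -> R) : (\sum_i a i * b i) ^+ 2 <= (\sum_i a i ^+ 2) * (\sum_i b i ^+ 2).
  have H : 0 <= \sum_i \sum_j (a i * b j - a j * b i) ^+ 2.
    by apply: sumr_ge0 => i _; apply: sumr_ge0 => j _; exact: sqr_ge0.
  have E : \sum_i \sum_j (a i * b j - a j * b i) ^+ 2 =
     2 * ((\sum_i a i ^+ 2) * (\sum_i b i ^+ 2)) - 2 * (\sum_i a i * b i) ^+ 2.
    transitivity (\sum_i \sum_j (a i ^+ 2 * b j ^+ 2 + b i ^+ 2 * a j ^+ 2
       - 2 * ((a i * b i) * (a j * b j)))).
      by apply: eq_bigr => i _; apply: eq_bigr => j _; ring.
    under eq_bigr do rewrite big_split/= big_split/= -!mulr_sumr sumrN -mulr_sumr -mulr_sumr.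
    rewrite big_split/= big_split/= -!mulr_suml sumrN -mulr_sumr -mulr_suml.
    by ring.
  by move: H; rewrite E; lra.
apply: le_trans (CS _ _) _; rewrite ler_wpM2r//.
  by apply: sumr_ge0 => i _; exact: sqr_ge0.
apply: le_trans (ler_sum _ _ : _ <= \sum_(i < n) eta ^+ 2) _.
  move=> i _; rewrite -[X in X <= _]real_normK ?num_real//.
  by rewrite ler_pXn2r// ?nnegrE// (le_trans _ (zeta i)).
by rewrite sumr_const card_ord mulr_natl.
Qed.

(** Integrate the estimate along segments over [x] in [A] and exchange the
    integrals: every translate of the squared derivative, cut off outside [Q], has
    the same integral. *)
Lemma H1_translate_energy W u g (A Q : set 'rV[R]_n) (z : 'rV[R]_n) (eta : R) : open W -> H1 W u g ->
  measurable A -> measurable Q -> Q `<=` W ->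
  (forall i, `|z ord0 i| <= eta) ->
  (forall x s, A x -> 0 <= s <= 1 -> Q (x + s *: z)) ->
  (\int[mu]_(x in A) ((u (x + z)%R - u x)%R ^+ 2)%:E <=
   (n%:R * eta ^+ 2 * \sum_i L2dot Q (g i) (g i))%:E)%E.
Proof.
move=> oW ug mA mQ QW zeta AQ.
have mW : measurable W by exact: open_measurable_rV.
have [u2 g2 _] := ug.
have gQ i : L2 Q (g i) by exact: (L2_restr mW mQ QW).
have gT := L2_ext_grad z mW g2.
have A0 x : A x -> W x by move=> Ax; have := AQ x 0 Ax; rewrite scale0r addr0 lexx ler01 => /(_ isT) /QW.
have A1 x : A x -> W (x + z) by move=> Ax; have := AQ x 1 Ax; rewrite scale1r lexx ler01 => /(_ isT) /QW.
have mu' : measurable_fun setT (u \_ W).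
  by apply/measurable_restrict => //; rewrite setTI; exact: L2_measurable u2.
pose H (x : 'rV[R]_n) : \bar R := ((ext_grad W g z x ^+ 2) * \1_Q x)%:E.
have mH : measurable_fun setT H.
  apply/measurable_EFinP; apply: measurable_funM; last exact: measurable_indic.
  by apply: measurable_funX; exact: L2_measurable gT.
have H0 x : (0 <= H x)%E by rewrite lee_fin mulr_ge0 ?sqr_ge0.
have mHr : measurable_fun [set: measurableTypeR R * 'rV[R]_n] (fun p => H (p.2 + p.1 *: z)%R).
  exact: (measurableT_comp mH (measurable_ray z)).
pose I (x : 'rV[R]_n) := (\int[leb]_(s in I01) H (x + s *: z)%R)%E.
have mI : measurable_fun setT I.
  pose G (p : measurableTypeR R * 'rV[R]_n) : \bar R := (H (p.2 + p.1 *: z)%R * (\1_I01 p.1)%:E)%E.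
  have G0 p : (0 <= G p)%E by apply: mule_ge0 => //; rewrite lee_fin.
  have mI01 : measurable (I01 : set (measurableTypeR R)) by exact: measurable_itv.
  have mG : measurable_fun setT G.
    apply: emeasurable_funM => //; apply/measurable_EFinP.
    exact: (measurableT_comp (measurable_indic mI01) measurable_fst).
  have := @measurable_fun_fubini_tonelli_G _ _ _ _ R leb G mG G0.
  congr (measurable_fun _ _); apply/funext => x; by rewrite /I unit_integral_indic.
have I0 x : (0 <= I x)%E by apply: integral_ge0.
apply: (@le_trans _ _ (\int[mu]_(x in A) I x)%E).
  apply: ae_ge0_le_integral => //.
  - by move=> x _; rewrite lee_fin sqr_ge0.
  - suff : measurable_fun A (fun x => (((u \_ W) (x + z)%R - (u \_ W) x)%R ^+ 2)%:E).
      apply: eq_measurable_fun => x /set_mem Ax; rewrite /= !patchE !mem_set//; first [exact: A0|exact: A1].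
    apply: measurable_funTS; apply/measurable_EFinP; apply: measurable_funX.
    apply: measurable_funB => //; exact: (measurableT_comp mu' (measurable_shift z)).
  - exact: measurable_funTS.
  - apply: filterS (H1_translate_segment z oW ug) => x Hx Ax.
    have seg s : 0 <= s <= 1 -> W (x + s *: z) by move=> /(AQ x s Ax) /QW.
    apply: le_trans (Hx seg) _; rewrite /I le_eqVlt; apply/orP; left; apply/eqP.
    apply: eq_integral => s; rewrite inE/= in_itv/= => s01.
    by rewrite /H indicE mem_set ?mulr1//; exact: AQ.
apply: (@le_trans _ _ (\int[mu]_x I x)%E).
  by apply: ge0_subset_integral.
rewrite /I (unit_Tonelli (f := fun p => H (p.2 + p.1 *: z)))//.
under eq_integral => s _ do rewrite /= (ge0_integral_shift (s *: z) mH H0).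
rewrite integral_cst; last exact: measurable_itv.
rewrite [X in (_ * X)%E]lebesgue_unit mule1.
apply: (@le_trans _ _ (\int[mu]_(x in Q) ((n%:R * eta ^+ 2)%:E * (\sum_i (g i x) ^+ 2)%:E))%E).
  rewrite [X in (_ <= X)%E]integral_mkcond; apply: ge0_le_integral => //.
  - apply/measurable_restrict => //; rewrite setTI; apply: emeasurable_funM => //.
    apply/measurable_EFinP; apply: measurable_sum => i.
    by apply: measurable_funX; exact: L2_measurable (gQ i).
  - move=> x _; rewrite /H patchE indicE; case: ifPn => xQ; last by rewrite mulr0.
    rewrite mulr1 -EFinM lee_fin; apply: le_trans (ext_grad_sqr_le _ _ _ zeta) _.
    rewrite (eq_bigr (fun i => g i x ^+ 2))// => i _; rewrite patchE mem_set//.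
    exact/QW/set_mem.
rewrite ge0_integralZl_EFin//; last 3 first.
- by move=> x _; rewrite lee_fin; apply: sumr_ge0 => i _; exact: sqr_ge0.
- apply/measurable_EFinP; apply: measurable_sum => i.
  by apply: measurable_funX; exact: L2_measurable (gQ i).
- by rewrite mulr_ge0 ?sqr_ge0.
rewrite [X in (_ <= X)%E]EFinM; under eq_integral do rewrite -sumEFin.
rewrite ge0_integral_sum//; last 2 first.
- by move=> i; apply: measurable_sqr => //; exact: L2_measurable (gQ i).
- by move=> i x _; rewrite lee_fin sqr_ge0.
by rewrite -sumEFin; under eq_bigr do rewrite -L2dotE//.
Qed.

Variables (W : set 'rV[R]_n) (u : 'rV[R]_n -> R) (g : 'I_n -> 'rV[R]_n -> R).
Hypotheses (oW : open W) (ug : H1 W u g).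
Variables (Q : set 'rV[R]_n) (eta : R).
Hypotheses (mQ : measurable Q) (QW : Q `<=` W) (eta0 : 0 < eta)
  (cQ : forall x y s, Q x -> Q y -> 0 <= s <= 1 -> Q (x + s *: (y - x)))
  (dQ : forall x y i, Q x -> Q y -> `|y ord0 i - x ord0 i| <= eta)
  (muQ : mu Q = (eta ^+ n)%:E).

Let mW : measurable W. Proof. exact: open_measurable_rV. Qed.
Let E := \sum_i L2dot Q (g i) (g i).
Let uQ : L2 Q u. Proof. by case: ug => u2 _ _; exact: (L2_restr mW mQ QW). Qed.
Let gQ i : L2 Q (g i). Proof. by case: ug => _ g2 _; exact: (L2_restr mW mQ QW). Qed.
Let v := u \_ Q.
Let mv : measurable_fun setT v.
Proof. by apply/measurable_restrict => //; rewrite setTI; exact: L2_measurable uQ. Qed.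
Let m1 : measurable_fun setT (\1_Q : 'rV[R]_n -> R). Proof. exact: measurable_indic. Qed.

Let B : set 'rV[R]_n := boxset (fun _ => `[- eta, eta]%classic).
Let mB : measurable B. Proof. by apply: measurable_boxset => i; exact: measurable_itv. Qed.
Let muB : mu B = ((2 * eta) ^+ n)%:E.
Proof.
rewrite /B (@lebesgue_boxset _ _ _ (fun=> 2 * eta)).
- by rewrite prodr_const card_ord.
- by move=> i; exact: measurable_itv.
- move=> i; rewrite lebesgue_measure_itv/= lte_fin.
  rewrite gtrN ?eta0//.
  by rewrite -EFinB; congr (_%:E); ring.
Qed.

Let E0 : 0 <= E. Proof. by apply: sumr_ge0 => i _; exact: L2dot_ge0. Qed.

Let shift_in z : (\int[mu]_(x in Q) ((\1_Q (x + z)%R * (u (x + z)%R - u x)%R ^+ 2)%:E) <=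
   (\1_B z * (n%:R * eta ^+ 2 * E))%:E)%E.
Proof.
pose A := Q `&` (fun x => x + z) @^-1` Q.
have mA : measurable A.
  by apply: measurableI => //; rewrite -[X in measurable X]setTI; exact: measurable_shift.
rewrite [X in (X <= _)%E](_ : _ = \int[mu]_(x in A) ((u (x + z)%R - u x)%R ^+ 2)%:E)%E; last first.
  rewrite /A integral_mkcondr; apply: eq_integral => x xQ; rewrite patchE indicE.
  rewrite (_ : (x \in _) = (x + z \in Q)); last by apply/idP/idP => /set_mem H; exact/mem_set.
  by case: ifP => _; rewrite ?mul1r ?mul0r.
have [Bz|Bz] := boolP (z \in B).
  rewrite indicE Bz mul1r; apply: (H1_translate_energy oW ug) => //.
    by move=> i; have := (set_mem Bz) i; rewrite /= in_itv/= -ler_norml.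
  by move=> x s [Qx Qxz] s01; rewrite (_ : s *: z = s *: ((x + z) - x)); [exact: cQ|rewrite addrAC subrr add0r].
rewrite (_ : A = set0) ?integral_set0 ?indicE ?(negbTE Bz) ?mul0r//.
rewrite -subset0 => x [Qx Qxz]; move/negP: Bz; apply; apply/mem_set => i.
by rewrite /= in_itv/= -ler_norml; have := dQ i Qx Qxz; rewrite mxE addrAC subrr add0r.
Qed.

Let double_le : (\int[mu]_(x in Q) \int[mu]_(y in Q) ((u y - u x)%R ^+ 2)%:E <=
  ((2 * eta) ^+ n * (n%:R * eta ^+ 2 * E))%:E)%E.
Proof.
(* the integrand in the variables x and z = y - x *)
pose F (p : 'rV[R]_n * 'rV[R]_n) : \bar R :=
  (\1_Q p.1 * (\1_Q (p.1 + p.2) * (v (p.1 + p.2) - v p.1) ^+ 2))%:E.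
have msum : measurable_fun setT (fun p : 'rV[R]_n * 'rV[R]_n => p.1 + p.2).
  apply: measurable_fun_rV => i; under eq_fun do rewrite mxE.
  by apply: measurable_funD; [exact: (measurableT_comp (measurable_coord_rV i) measurable_fst)|
    exact: (measurableT_comp (measurable_coord_rV i) measurable_snd)].
have mF : measurable_fun setT F.
  apply/measurable_EFinP; apply: measurable_funM.
    exact: (measurableT_comp m1 measurable_fst).
  apply: measurable_funM; first exact: (measurableT_comp m1 msum).
  apply: measurable_funX; apply: measurable_funB; first exact: (measurableT_comp mv msum).
  exact: (measurableT_comp mv measurable_fst).
have F0 p : (0 <= F p)%E.
  rewrite lee_fin !indicE; apply: mulr_ge0; first exact: ler0n.
  by apply: mulr_ge0; [exact: ler0n|exact: sqr_ge0].
rewrite [X in (X <= _)%E](_ : _ = \int[mu]_x \int[mu]_z F (x, z))%E; last first.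
  rewrite integral_mkcond; apply: eq_integral => x _.
  rewrite patchE; case: ifPn => xQ; last first.
    rewrite integral0_eq// => z _; rewrite /F/= indicE (negbTE xQ) mul0r//.
  rewrite integral_mkcond -(@ge0_integral_shift _ _ x ((fun y => ((u y - u x)%R ^+ 2)%:E) \_ Q)).
  - apply: eq_integral => z _; rewrite patchE /F/= !indicE xQ mul1r [(z + x)%R]addrC.
    rewrite /v !patchE xQ; case: (boolP (x + z \in Q)) => Hz; rewrite ?mul1r ?mul0r//.
  - apply/(measurable_restrictT _ _).1 => //; apply/measurable_EFinP.
    by apply: measurable_funX; apply: measurable_funB => //; exact: L2_measurable uQ.
  - by move=> y; rewrite patchE; case: ifP => // _; rewrite lee_fin sqr_ge0.
rewrite rV_Tonelli//.
apply: le_trans (_ : \int[mu]_z (\1_B z * (n%:R * eta ^+ 2 * E))%:E <= _)%E.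
  apply: ge0_le_integral => //.
  - by move=> z _; apply: integral_ge0.
  - exact: (@measurable_fun_fubini_tonelli_G _ _ _ _ R mu F mF F0).
  - apply/measurable_EFinP; apply: measurable_funM => //.
  - move=> z _; apply: le_trans (shift_in z).
    rewrite [X in (_ <= X)%E]integral_mkcond le_eqVlt; apply/orP; left; apply/eqP.
    apply: eq_integral => x _.
    rewrite /F/= patchE !indicE; case: ifPn => xQ; last by rewrite mul0r.
    rewrite mul1r /v !patchE xQ; case: (boolP (x + z \in Q)) => Hz; rewrite ?mul1r ?mul0r//.
under eq_integral do rewrite EFinM.
rewrite ge0_integralZr//; last 2 first.
- exact/measurable_EFinP.
- rewrite lee_fin; apply: mulr_ge0 E0.
  by apply: mulr_ge0 (sqr_ge0 _); exact: ler0n.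
by rewrite integral_indic// setIT [X in (X * _)%E]muB -EFinM.
Qed.

Let double_eq : (\int[mu]_(x in Q) \int[mu]_(y in Q) ((u y - u x)%R ^+ 2)%:E =
  (2 * eta ^+ n * L2dot Q u u - 2 * L2dot Q u (cst 1%R) ^+ 2)%:E)%E.
Proof.
have icst (c : R) : mu.-integrable Q (fun=> c%:E).
  apply/integrableP; split; first by [].
  by rewrite integral_cst//= muQ -EFinM ltry.
have [L1 _] := L2_cst_finite mQ muQ.
have iu : mu.-integrable Q (EFin \o u).
  by apply: eq_integrable (L2M_integrable mQ uQ L1) => // x _; rewrite /= mulr1.
have iu2 : mu.-integrable Q (fun x => (u x ^+ 2)%:E) by case: uQ.
have Eu2 : (\int[mu]_(x in Q) (u x ^+ 2)%:E = (L2dot Q u u)%:E)%E by rewrite L2dotE.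
have Eu : (\int[mu]_(x in Q) (u x)%:E = (L2dot Q u (cst 1%R))%:E)%E.
  rewrite /L2dot /Rintegral fineK.
    by apply: eq_integral => x _; rewrite mulr1.
  by apply: integrable_fin_num => //; exact: (L2M_integrable mQ uQ L1).
have Ec (c : R) : (\int[mu]_(x in Q) c%:E = (c * eta ^+ n)%:E)%E by rewrite integral_cst// [X in (_ * X)%E]muQ.
have quad (a b c : R) : (\int[mu]_(y in Q) (a * u y ^+ 2 + b * u y + c)%:E =
   (a * L2dot Q u u + b * L2dot Q u (cst 1%R) + c * eta ^+ n)%:E)%E.
  have ia : mu.-integrable Q (fun y => (a%:E * (u y ^+ 2)%:E)%E) by exact: integrableZl.
  have ib : mu.-integrable Q (fun y => (b%:E * (u y)%:E)%E) by exact: integrableZl.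
  have ic : mu.-integrable Q (fun=> c%:E) by exact: icst.
  under eq_integral do rewrite !EFinD !EFinM.
  rewrite integralD//; last exact: integrableD.
  by rewrite integralD// !integralZl// Eu Eu2 Ec -!EFinM -!EFinD.
under eq_integral => x _.
  under eq_integral => y _.
    rewrite (_ : _ ^+ 2 = 1 * u y ^+ 2 + (- 2 * u x) * u y + u x ^+ 2)%R; last by ring.
    over.
  rewrite quad.
  rewrite (_ : (1 * _ + _ + _)%R = eta ^+ n * u x ^+ 2 + (- 2 * L2dot Q u (cst 1)) * u x
     + L2dot Q u u); last by ring.
  over.
by rewrite quad; congr EFin; ring.
Qed.

(** The double integral of [(u y - u x) ^ 2] over [Q] equals twice the measure of
    [Q] times the variance of [u]. With [y = x + z], only [z] in a cube of side [2
    eta] occur, and for each of them the translation estimate bounds the inner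
    integral by the energy of [u] in [Q]. *)
Lemma poincare_inequality : L2dot Q u u <= L2dot Q u (cst 1) ^+ 2 / eta ^+ n +
  2 ^+ n * n%:R * eta ^+ 2 * E.
Proof.
have := double_le; rewrite double_eq lee_fin exprMn => H.
have e0 : 0 < eta ^+ n by exact: exprn_gt0.
have H0 : 0 <= 2 ^+ n * n%:R * eta ^+ 2 * E by apply: mulr_ge0 E0; apply: mulr_ge0 (sqr_ge0 _); apply: mulr_ge0 => //; exact: exprn_ge0.
rewrite -(ler_pM2l e0) mulrDr.
have -> : eta ^+ n * (L2dot Q u (cst 1) ^+ 2 / eta ^+ n) = L2dot Q u (cst 1) ^+ 2.
  by rewrite mulrC divfK// gt_eqF.
move: H; rewrite (_ : 2 ^+ n * eta ^+ n * _ = eta ^+ n * (2 ^+ n * n%:R * eta ^+ 2 * E)); last by ring.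
by have := mulr_ge0 (ltW e0) H0; lra.
Qed.

End poincare.

(** * Grids of cubes *)

Section square_integral_sums.
Context (R : realType) (n : nat) (I : finType) (P : pred I).
Variables (F : I -> set 'rV[R]_n) (A : set 'rV[R]_n) (w : 'rV[R]_n -> R).
Hypotheses (mF : forall k, P k -> measurable (F k)) (mA : measurable A) (w2 : L2 A w)
  (FA : forall k, P k -> F k `<=` A).
Local Notation mu := (lebesgue_rV R n).

Let sumE : ((\sum_(k | P k) L2dot (F k) w w)%:E =
  \int[mu]_(x in A) (\sum_(k | P k) \1_(F k) x * w x ^+ 2)%:E)%E.
Proof.
under eq_integral do rewrite big_mkcond/= -sumEFin.
rewrite ge0_integral_sum//; last 2 first.
- move=> k; case: (boolP (P k)) => Pk //; apply/measurable_EFinP; apply: measurable_funM.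
    by apply: measurable_funTS; apply: measurable_indic; exact: mF.
  by apply: measurable_funX; exact: L2_measurable w2.
- by move=> k x _; case: (P k); rewrite lee_fin// mulr_ge0 ?sqr_ge0// indicE.
rewrite big_mkcond/= -sumEFin; apply: eq_bigr => k _.
case: (boolP (P k)) => Pk; last by rewrite integral0.
have mk := mF Pk; have kA := FA Pk.
rewrite (L2dotE mk (L2_restr mA mk kA w2)) -[in LHS](setIidr kA) integral_mkcondr.
apply: eq_integral => x _; rewrite patchE indicE.
by case: ifP => _; rewrite ?mul1r ?mul0r.
Qed.

Let pos x : 0 <= \sum_(k | P k) (\1_(F k) x : R) * w x ^+ 2.
Proof. by apply: sumr_ge0 => k _; rewrite indicE mulr_ge0 ?sqr_ge0. Qed.

Let mpos : measurable_fun A (fun x => (\sum_(k | P k) (\1_(F k) x : R) * w x ^+ 2)%:E).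
Proof.
apply/measurable_EFinP; under eq_fun do rewrite big_mkcond/=; apply: measurable_sum => k.
case: (boolP (P k)) => Pk //; apply: measurable_funM.
  by apply: measurable_funTS; apply: measurable_indic; exact: mF.
by apply: measurable_funX; exact: L2_measurable w2.
Qed.

(** The sum of the indicators is at most 1. *)
Lemma L2dot_sum_disjoint : trivIset [set k | P k] F ->
  \sum_(k | P k) L2dot (F k) w w <= L2dot A w w.
Proof.
move=> tF; rewrite -lee_fin sumE (L2dotE mA w2); apply: ge0_le_integral => //.
- by move=> x _; rewrite lee_fin pos.
- by apply: measurable_sqr => //; exact: L2_measurable w2.
- move=> x _; rewrite lee_fin -mulr_suml ler_piMl ?sqr_ge0//.
  have [[k Pk Fkx]|no] := pselect (exists2 k, P k & F k x); last first.
    rewrite big1 // => k Pk; rewrite indicE memNset//= => Fkx; apply: no; by exists k.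
  rewrite (bigD1 k)//= indicE mem_set// big1 ?addr0// => j /andP[Pj jk].
  rewrite indicE memNset//= => Fjx; move/eqP: jk; apply.
  by apply: (tF j k Pj Pk); exists x.
Qed.

(** The sum of the indicators is at least 1. *)
Lemma L2dot_le_cover : (forall x, A x -> exists2 k, P k & F k x) ->
  L2dot A w w <= \sum_(k | P k) L2dot (F k) w w.
Proof.
move=> cF; rewrite -lee_fin sumE (L2dotE mA w2); apply: ge0_le_integral => //.
- by move=> x _; rewrite lee_fin sqr_ge0.
- by apply: measurable_sqr => //; exact: L2_measurable w2.
- move=> x /cF[k Pk Fkx]; rewrite lee_fin -mulr_suml ler_peMl ?sqr_ge0//.
  rewrite (bigD1 k)//= indicE mem_set// lerDl; apply: sumr_ge0 => j _.
  by rewrite indicE.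
Qed.

End square_integral_sums.

Section grid.
Context (R : realType) (n : nat) (r eta : R) (eta0 : 0 < eta).
Local Notation mu := (lebesgue_rV R n).

(** Half-open cubes, so that they are disjoint and cover every point; the grid
    starts at the corner [(- r, ..., - r)]. *)
Definition grid_cube N (k : {ffun 'I_n -> 'I_N}) : set 'rV[R]_n :=
  boxset (fun i => `[- r + (k i)%:R * eta, - r + (k i).+1%:R * eta[%classic).

Lemma measurable_grid_cube N k : measurable (@grid_cube N k).
Proof. by apply: measurable_boxset => i; exact: measurable_itv. Qed.

Lemma lebesgue_grid_cube N k : mu (@grid_cube N k) = (eta ^+ n)%:E.
Proof.
rewrite /grid_cube (@lebesgue_boxset _ _ _ (fun=> eta)).
- by rewrite prodr_const card_ord.
- by move=> i; exact: measurable_itv.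
- move=> i; rewrite lebesgue_measure_itv/= lte_fin ltrD2l ltr_pM2r// ltr_nat ltnSn.
  by rewrite -EFinB; congr (_%:E); rewrite -[(k i).+1]addn1 natrD; ring.
Qed.

Lemma grid_cube_convex N k x y s : @grid_cube N k x -> grid_cube k y -> 0 <= s <= 1 ->
  grid_cube k (x + s *: (y - x)).
Proof.
move=> Qx Qy /andP[s0 s1] i; have := Qx i; have := Qy i.
rewrite /= !in_itv/= !mxE => /andP[a1 a2] /andP[b1 b2].
move: a1 a2 b1 b2; set l := - r + _; set h := - r + _ => a1 a2 b1 b2.
have -> : x ord0 i + s * (y ord0 i - x ord0 i) =
  (1 - s) * x ord0 i + s * y ord0 i by ring.
apply/andP; split; first by nra.
move: s0; rewrite le_eqVlt => /orP[/eqP <-|s0]; first by lra.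
by have := ltr_pM2l s0 (y ord0 i) h; rewrite a2 => h1; nra.
Qed.

Lemma grid_cube_diam N k x y i : @grid_cube N k x -> grid_cube k y ->
  `|y ord0 i - x ord0 i| < eta.
Proof.
move=> Qx Qy; have := Qx i; have := Qy i.
rewrite /= !in_itv/= => /andP[a1 a2] /andP[b1 b2].
have E : (k i).+1%:R * eta = (k i)%:R * eta + eta by rewrite -addn1 natrD mulrDl mul1r.
by move: a1 a2 b1 b2; rewrite E ltr_norml => *; apply/andP; split; lra.
Qed.

Lemma grid_cube_trivIset N (P : set {ffun 'I_n -> 'I_N}) : trivIset P (@grid_cube N).
Proof.
move=> k l _ _ [x [kx lx]]; apply/ffunP => i; apply/val_inj => /=.
have := kx i; have := lx i; rewrite /= !in_itv/= => /andP[a1 a2] /andP[b1 b2].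
have h (p q : nat) : - r + p%:R * eta < - r + q%:R * eta -> (p < q)%N.
  by rewrite ltrD2l ltr_pM2r// ltr_nat.
apply/eqP; rewrite eqn_leq -ltnS -[(l i <= _)%N]ltnS.
by rewrite !h//; [exact: le_lt_trans b2|exact: le_lt_trans a2].
Qed.

Lemma grid_cover N (x : 'rV[R]_n) : 2 * r <= N%:R * eta -> `|x| < r ->
  exists k, @grid_cube N k x.
Proof.
move=> rN xr.
have xi i : 0 <= x ord0 i + r /\ x ord0 i + r < N%:R * eta.
  have := le_lt_trans (coord_le_norm x i) xr; rewrite ltr_norml => /andP[h1 h2].
  by split; lra.
have fl i : (Num.truncn ((x ord0 i + r) / eta))%:R <= (x ord0 i + r) / eta <
     (Num.truncn ((x ord0 i + r) / eta)).+1%:R.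
  by apply: Num.Theory.truncn_itv; rewrite divr_ge0 ?(ltW eta0)//; have [] := xi i.
have kN i : (Num.truncn ((x ord0 i + r) / eta) < N)%N.
  rewrite -(ltr_nat R); have /andP[h _] := fl i; apply: le_lt_trans h _.
  by rewrite ltr_pdivrMr//; have [] := xi i.
exists [ffun i => Ordinal (kN i)] => i; rewrite /= in_itv/= ffunE/=.
have /andP[h1 h2] := fl i; move: h1 h2; rewrite ler_pdivlMr// ltr_pdivrMr// => h1 h2.
by apply/andP; split; lra.
Qed.

Variables (W : set 'rV[R]_n) (u : 'rV[R]_n -> R) (g : 'I_n -> 'rV[R]_n -> R).
Hypotheses (oW : open W) (ug : H1 W u g).

(** On each cube the mass exceeds the contribution of the mean value by at most a
    multiple of [eta ^ 2] times the energy; the energies add up. *)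
Lemma grid_poincare N (P : pred {ffun 'I_n -> 'I_N}) : (forall k, P k -> grid_cube k `<=` W) ->
  \sum_(k | P k) L2dot (grid_cube k) u u <=
  \sum_(k | P k) L2dot (grid_cube k) u (cst 1) ^+ 2 / eta ^+ n +
  2 ^+ n * n%:R * eta ^+ 2 * \sum_i L2dot W (g i) (g i).
Proof.
move=> PW; have mW := open_measurable_rV oW.
apply: (@le_trans _ _ (\sum_(k | P k) (L2dot (grid_cube k) u (cst 1) ^+ 2 / eta ^+ n +
   2 ^+ n * n%:R * eta ^+ 2 * \sum_i L2dot (grid_cube k) (g i) (g i)))).
  apply: ler_sum => k Pk; apply: (poincare_inequality oW ug) => //.
  - exact: measurable_grid_cube.
  - exact: PW.
  - by move=> x y s; exact: grid_cube_convex.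
  - by move=> x y i Qx Qy; apply: ltW; exact: (grid_cube_diam i Qx Qy).
  - exact: lebesgue_grid_cube.
rewrite big_split/= lerD2l -mulr_sumr ler_wpM2l//.
  by apply: mulr_ge0 (sqr_ge0 _); apply: mulr_ge0 (ler0n _ _); exact: exprn_ge0.
rewrite exchange_big/=; apply: ler_sum => i _.
apply: L2dot_sum_disjoint => //.
- by move=> k _; exact: measurable_grid_cube.
- by case: ug.
- exact: grid_cube_trivIset.
Qed.

Lemma grid_mean_bound N (k : {ffun 'I_n -> 'I_N}) : grid_cube k `<=` W ->
  L2dot (grid_cube k) u (cst 1) ^+ 2 <= eta ^+ n * L2dot W u u.
Proof.
move=> kW; have mW := open_measurable_rV oW; have mk := measurable_grid_cube k.
have [u2 _ _] := ug.
have [L1 E1] := L2_cst_finite mk (lebesgue_grid_cube k).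
have := form_CauchySchwarz (L2_subspace mk) (L2_form mk) (L2_restr mW mk kW u2) L1.
rewrite E1 mulrC => /le_trans; apply; rewrite ler_wpM2l ?exprn_ge0 ?(ltW eta0)//.
exact: L2dot_le.
Qed.

End grid.

(** * The form domains *)

Lemma sqr_le_all_eps0 (R : realType) (X M : R) : 0 <= M ->
  (forall e, 0 < e -> X ^+ 2 <= e * M) -> X = 0.
Proof.
move=> M0 H; apply/eqP; rewrite -sqrf_eq0 eq_le sqr_ge0 andbT.
apply/ler_addgt0Pr => e e0; rewrite add0r.
have M1 : 0 < M + 1 by lra.
have := H (e / (M + 1)) (divr_gt0 e0 M1) => /le_trans; apply.
by rewrite -mulrA ler_piMr ?(ltW e0)// mulrC ler_pdivrMr// mul1r; lra.
Qed.

Lemma partial_lin (R : realType) n (c : R) (f g : 'rV[R]_n -> R) i : smooth f -> smooth g ->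
  partial i (fun x => c * f x + g x) = (fun x => c * partial i f x + partial i g x).
Proof.
move=> sf sg; apply: partialE => x.
apply: (@is_deriveD _ _ _ (fun x => c * f x) g); last exact: smooth_is_derive.
by apply: (@is_deriveZ _ _ _ f c); exact: smooth_is_derive.
Qed.

Section form_bounds.
Context {R : realType} {V : lmodType R} (D : V -> Prop) (f : V -> V -> R).
Hypotheses (sD : subspace_on D) (ff : form_on D f).

Lemma form_sub_le x y : D x -> D y -> f (x - y) (x - y) <= 2 * f x x + 2 * f y y.
Proof.
move=> Dx Dy; rewrite -(form_parallelogram sD ff Dx Dy) lerDl.
exact: (form_ge0 ff (subspaceD sD Dx Dy)).
Qed.

Lemma form_lin_le c x y : D x -> D y ->
  f (c *: x + y) (c *: x + y) <= 2 * (c ^+ 2 * f x x) + 2 * f y y.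
Proof.
move=> Dx Dy; have Dcx := subspaceZ sD c Dx.
rewrite -(formZZ sD ff c Dx) -(form_parallelogram sD ff Dcx Dy) lerDr.
exact: (form_ge0 ff (subspaceB sD Dcx Dy)).
Qed.

End form_bounds.

Section form_domains.
Context (R : realType) (n : nat).
Implicit Types (U V : set 'rV[R]_n) (u v : 'rV[R]_n -> R) (g : 'I_n -> 'rV[R]_n -> R).
Local Notation pair := (('rV[R]_n -> R) * ('I_n -> 'rV[R]_n -> R))%type.

(** A pair consists of a function and its weak gradient; such pairs form a vector
    space on which mass and energy are bilinear, and the abstract spectral theory
    applies to these two forms. *)
Definition mass U (p q : pair) : R := L2dot U p.1 q.1.

Definition energy U (p q : pair) : R := \sum_i L2dot U (p.2 i) (q.2 i).

Definition in_form_domain bc U (p : pair) : Prop := form_domain bc U p.1 p.2.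

Definition smooth_pair (phi : 'rV[R]_n -> R) : pair := (phi, fun i => partial i phi).

Lemma form_on_le {W : lmodType R} (D D' : W -> Prop) f : (forall x, D x -> D' x) ->
  form_on D' f -> form_on D f.
Proof.
move=> DD' [fC f0 fl]; split=> // [x /DD'|z /DD' Dz c x y /DD' Dx /DD' Dy]; first exact: f0.
exact: fl.
Qed.

Lemma H1_of_domain bc U p : in_form_domain bc U p -> in_form_domain Neumann U p.
Proof. by case: bc => // -[]. Qed.

Section forms.
Variables (U : set 'rV[R]_n) (mU : measurable U).

Lemma mass_form : form_on (in_form_domain Neumann U) (mass U).
Proof.
have [fC f0 fl] := L2_form mU; split=> [x y|x [u2 _ _]|z [z2 _ _] c x y [x2 _ _] [y2 _ _]].
- exact: fC.
- exact: f0.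
- exact: fl.
Qed.

Lemma energy_form : form_on (in_form_domain Neumann U) (energy U).
Proof.
have [fC f0 fl] := L2_form mU; split=> [x y|x [_ g2 _]|z [_ z2 _] c x y [_ x2 _] [_ y2 _]].
- by apply: eq_bigr => i _; exact: fC.
- by apply: sumr_ge0 => i _; exact: f0.
- rewrite /energy mulr_sumr -big_split/=; apply: eq_bigr => i _.
  exact: (fl _ (z2 i) c _ _ (x2 i) (y2 i)).
Qed.

Lemma H1_subspace : subspace_on (in_form_domain Neumann U).
Proof.
have sL := L2_subspace mU; have fL := L2_form mU.
split.
  split=> [|i|phi tphi i]; [exact: L2_0|exact: L2_0|].
  have [_ _ fl] := fL.
  have l1 := functional0 sL (fl _ (test_L2 mU (test_partial i tphi))).
  have l2 := functional0 sL (fl _ (test_L2 mU tphi)).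
  by rewrite [LHS]l1 [X in - X]l2 oppr0.
move=> c x y [x2 gx wx] [y2 gy wy]; split.
- exact: L2_lin.
- by move=> i; exact: (L2_lin mU c (gx i) (gy i)).
- move=> phi tphi i.
  have t1 := test_L2 mU (test_partial i tphi); have t2 := test_L2 mU tphi.
  rewrite [LHS](L2dot_lin mU c x2 y2 t1) [X in - X](L2dot_lin mU c (gx i) (gy i) t2).
  by rewrite (wx _ tphi) (wy _ tphi) opprD mulrN.
Qed.

Lemma smooth_pair_H1 phi : test_function U phi ->
  in_form_domain Neumann U (smooth_pair phi).
Proof.
move=> tphi; split.
- exact: (test_L2 mU tphi).
- by move=> i; exact: (test_L2 mU (test_partial i tphi)).
- by apply: smooth_weak_gradient; case: tphi.
Qed.

Lemma mass_ge0 (p : pair) : 0 <= mass U p p.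
Proof. exact: L2dot_ge0. Qed.

Lemma energy_ge0 (p : pair) : 0 <= energy U p p.
Proof. by apply: sumr_ge0 => i _; exact: L2dot_ge0. Qed.

Lemma energy_coord (p : pair) i : L2dot U (p.2 i) (p.2 i) <= energy U p p.
Proof.
rewrite /energy (bigD1 i)//= lerDl; apply: sumr_ge0 => j _; exact: L2dot_ge0.
Qed.

(** The sequence of approximating test functions is traded for a statement with [e],
    which is easier to combine. *)
Lemma H1_0P p : in_form_domain Dirichlet U p <-> in_form_domain Neumann U p /\
  forall e : R, 0 < e -> exists2 phi, test_function U phi &
    energy U (p - smooth_pair phi) (p - smooth_pair phi) +
    mass U (p - smooth_pair phi) (p - smooth_pair phi) <= e.
Proof.
case: p => u g; split.
  move=> [Hu [phi tphi cphi]]; split=> // e e0.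
  have /cvgrPdist_le /(_ e e0) [k _ /(_ k (leqnn k))] := cphi.
  rewrite sub0r normrN => H; exists (phi k) => //.
  by rewrite addrC; exact: le_trans (ler_norm _) H.
move=> [Hu H]; split=> //.
have /choice[phi Hphi] : forall k : nat, exists phi, test_function U phi /\
    energy U ((u, g) - smooth_pair phi) ((u, g) - smooth_pair phi) +
    mass U ((u, g) - smooth_pair phi) ((u, g) - smooth_pair phi) <= k.+1%:R^-1.
  move=> k; have k0 : 0 < k.+1%:R^-1 :> R by rewrite invr_gt0.
  by have [phi] := H _ k0; exists phi.
exists phi; first by move=> k; have [] := Hphi k.
apply: (@squeeze_cvgr _ _ _ _ (cst 0) (@harmonic R)); last 2 first.
- exact: cvg_cst.
- exact: cvg_harmonic.
apply: nearW => k; apply/andP; split.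
  apply: addr_ge0; first by rewrite L2sqdistE L2dot_ge0.
  by apply: sumr_ge0 => i _; rewrite L2sqdistE L2dot_ge0.
by have [_] := Hphi k; rewrite addrC.
Qed.

(** By the Cauchy-Schwarz inequality both sides are continuous for the seminorm of
    [L2]. *)
Lemma L2dot_eq_limit (u g psi' psi : 'rV[R]_n -> R) : L2 U u -> L2 U g ->
  L2 U psi' -> L2 U psi ->
  (forall e : R, 0 < e -> exists v h, [/\ L2 U v, L2 U h, L2dot U v psi' = - L2dot U h psi,
     L2dot U (u - v) (u - v) <= e & L2dot U (g - h) (g - h) <= e]) ->
  L2dot U u psi' = - L2dot U g psi.
Proof.
move=> u2 g2 s2 t2 H; apply/eqP; rewrite -addr_eq0; apply/eqP.
have sL := L2_subspace mU; have fL := L2_form mU; have [fC f0 fl] := fL.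
apply: (@sqr_le_all_eps0 _ _ (2 * (L2dot U psi' psi' + L2dot U psi psi))).
  by rewrite mulr_ge0// addr_ge0// L2dot_ge0.
move=> e e0; have [v [h [v2 h2 E d1 d2]]] := H e e0.
have -> : L2dot U u psi' + L2dot U g psi = L2dot U (u - v) psi' + L2dot U (g - h) psi.
  rewrite (functionalB sL (fl _ s2))// (functionalB sL (fl _ t2))// E; ring.
have c1 := form_CauchySchwarz sL fL (L2B mU u2 v2) s2.
have c2 := form_CauchySchwarz sL fL (L2B mU g2 h2) t2.
have p1 := L2dot_ge0 U psi'; have p2 := L2dot_ge0 U psi.
have := ler_wpM2r p1 d1; have := ler_wpM2r p2 d2.
have := sqr_ge0 (L2dot U (u - v) psi' - L2dot U (g - h) psi); nra.
Qed.

(** In the Dirichlet case a linear combination is approximated by the linear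
    combination of the approximating test functions. *)
Lemma domain_subspace bc : subspace_on (in_form_domain bc U).
Proof.
case: bc; last exact: H1_subspace.
have sH := H1_subspace; have fm := mass_form; have fe := energy_form.
split.
  apply/H1_0P; split; first by case: sH.
  move=> e e0; exists (fun=> 0); first exact: test0.
  have -> : 0 - smooth_pair (fun=> 0) = 0 :> pair.
    rewrite sub0r; apply/eqP; rewrite oppr_eq0; apply/eqP.
    congr (_, _); apply/funext => i.
    exact: (partial_cst 0 i).
  have z f : form_on (in_form_domain Neumann U) f -> f 0 0 = 0.
    by move=> [_ _ fl]; exact: (functional0 sH (fl 0 (proj1 sH))).
  by rewrite !z// addr0 ltW.
move=> c x y /H1_0P[Hx Ax] /H1_0P[Hy Ay]; apply/H1_0P; split.
  by case: sH => _; exact.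
move=> e e0.
have d0 : 0 < e / (2 * (c ^+ 2 + 1)).
  by rewrite divr_gt0// mulr_gt0// ltr_wpDl ?sqr_ge0.
have [phi tphi Hphi] := Ax _ d0; have [psi tpsi Hpsi] := Ay _ d0.
exists (fun z => c * phi z + psi z); first exact: test_lin.
have sp : smooth_pair (fun z => c * phi z + psi z) = c *: smooth_pair phi + smooth_pair psi.
  have [sphi _ _] := tphi; have [spsi _ _] := tpsi.
  congr (_, _); apply/funext => i.
  exact: (partial_lin c i sphi spsi).
have -> : c *: x + y - smooth_pair (fun z => c * phi z + psi z) =
    c *: (x - smooth_pair phi) + (y - smooth_pair psi).
  by rewrite sp scalerBr opprD addrACA.
set X := x - _ in Hphi *; set Y := y - _ in Hpsi *.
have HX : in_form_domain Neumann U X by apply: (subspaceB sH Hx); exact: smooth_pair_H1.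
have HY : in_form_domain Neumann U Y by apply: (subspaceB sH Hy); exact: smooth_pair_H1.
have := form_lin_le sH fm c HX HY; have := form_lin_le sH fe c HX HY.
have := mass_ge0 X; have := mass_ge0 Y; have := energy_ge0 X; have := energy_ge0 Y.
move: Hphi Hpsi; rewrite !ler_pdivlMr ?mulr_gt0 ?ltr_wpDl ?sqr_ge0//.
move: (mass U X X) (mass U Y Y) (energy U X X) (energy U Y Y) (mass U _ _) (energy U _ _).
by move: (sqr_ge0 c) => c2 mX mY eX eY m' e'; move: (c ^+ 2) c2 => d; nra.
Qed.

Lemma mass_form_domain bc : form_on (in_form_domain bc U) (mass U).
Proof. by apply: form_on_le mass_form => x; exact: H1_of_domain. Qed.

Lemma energy_form_domain bc : form_on (in_form_domain bc U) (energy U).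
Proof. by apply: form_on_le energy_form => x; exact: H1_of_domain. Qed.

(** The function and each component of the gradient converge in [L2], and the
    defining identity of the weak gradient passes to the limit. *)
Lemma H1_complete : form_complete (in_form_domain Neumann U) (energy U) (mass U).
Proof.
move=> x Hx cx.
have ux k : L2 U (x k).1 by have [] := Hx k.
have gx i k : L2 U ((x k).2 i) by have [_ + _] := Hx k; exact.
have [v v2 cv] : exists2 v, L2 U v & forall e : R, 0 < e -> exists N, forall i, (N <= i)%N ->
     L2dot U ((x i).1 - v) ((x i).1 - v) <= e.
  apply: (L2_complete mU ux) => e e0; have [N HN] := cx e e0; exists N => i j Ni Nj.
  by apply: le_trans (HN i j Ni Nj); rewrite lerDr energy_ge0.
have /choice[h Hh] : forall i, exists h, L2 U h /\ forall e : R, 0 < e -> exists N,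
    forall k, (N <= k)%N -> L2dot U ((x k).2 i - h) ((x k).2 i - h) <= e.
  move=> i; have [|h h2 ch] := L2_complete mU (gx i); last by exists h.
  move=> e e0; have [N HN] := cx e e0; exists N => k j Nk Nj.
  apply: le_trans (energy_coord (x k - x j) i) _.
  by apply: le_trans (HN k j Nk Nj); rewrite lerDl mass_ge0.
have h2 i : L2 U (h i) by have [] := Hh i.
have ch (e : R) : 0 < e -> exists N, forall k, (N <= k)%N -> forall i,
    L2dot U ((x k).2 i - h i) ((x k).2 i - h i) <= e.
  move=> e0; have /choice[N HN] : forall i, exists N, forall k, (N <= k)%N ->
      L2dot U ((x k).2 i - h i) ((x k).2 i - h i) <= e.
    by move=> i; have [_ H] := Hh i; exact: H.
  exists (\max_i N i)%N => k Nk i; apply: HN; apply: leq_trans Nk.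
  exact: (leq_bigmax i).
exists (v, h).
  split=> // phi tphi i; apply: L2dot_eq_limit => //.
  - exact: (test_L2 mU (test_partial i tphi)).
  - exact: (test_L2 mU tphi).
  - move=> e e0; have [N1 H1N] := cv e e0; have [N2 H2N] := ch e e0.
    exists (x (maxn N1 N2)).1, ((x (maxn N1 N2)).2 i); split=> //.
    + by have [_ _ wx] := Hx (maxn N1 N2); exact: wx.
    + have := H1N _ (leq_maxl N1 N2).
      have [_ _ fl] := L2_form mU.
      have -> : (x (maxn N1 N2)).1 - v = (-1) *: (v - (x (maxn N1 N2)).1) :> ('rV[R]_n -> R).
        by rewrite scaleN1r opprB.
      rewrite (formZZ (L2_subspace mU) (L2_form mU)) ?sqrrN ?expr1n ?mul1r//.
      exact: L2B.
    + have := H2N _ (leq_maxr N1 N2) i.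
      have -> : (x (maxn N1 N2)).2 i - h i = (-1) *: (h i - (x (maxn N1 N2)).2 i) :> ('rV[R]_n -> R).
        by rewrite scaleN1r opprB.
      rewrite (formZZ (L2_subspace mU) (L2_form mU)) ?sqrrN ?expr1n ?mul1r//.
      exact: L2B.
move=> e e0; have d0 : 0 < e / (n%:R + 1) by rewrite divr_gt0// ltr_wpDl.
have [N1 H1N] := cv _ d0; have [N2 H2N] := ch _ d0.
exists (maxn N1 N2) => k; rewrite geq_max => /andP[k1 k2].
apply: (@le_trans _ _ (\sum_(i < n) e / (n%:R + 1) + e / (n%:R + 1))).
  apply: lerD; last exact: H1N.
  by apply: ler_sum => i _; exact: H2N.
have E : n%:R * (e / (n%:R + 1)) + e / (n%:R + 1) = e.
  transitivity ((n%:R + 1) * (e / (n%:R + 1))); first by ring.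
  by rewrite mulrC divfK// gt_eqF// ltr_wpDl.
by rewrite sumr_const card_ord -[X in X + _]mulr_natl E.
Qed.

(** [H1_0] is the closure of the test functions in [H1]. *)
Lemma domain_complete bc : form_complete (in_form_domain bc U) (energy U) (mass U).
Proof.
case: bc; last exact: H1_complete.
move=> x Dx cx.
have Hx k : in_form_domain Neumann U (x k) by apply: H1_of_domain (Dx k).
have [y Hy cy] := H1_complete Hx cx; exists y => //.
apply/H1_0P; split=> // e e0.
have e4 : 0 < e / 4 by rewrite divr_gt0.
have [N /(_ N (leqnn N)) HN] := cy _ e4.
have [_ /(_ _ e4)[phi tphi Hphi]] := (H1_0P _).1 (Dx N).
exists phi => //.
have sH := H1_subspace.
have Hp := smooth_pair_H1 tphi.
have -> : y - smooth_pair phi = (x N - smooth_pair phi) - (x N - y).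
  by rewrite opprB [RHS]addrC addrA subrK.
have HX := subspaceB sH (Hx N) Hp; have HY := subspaceB sH (Hx N) Hy.
set X := x N - smooth_pair phi in Hphi HX *; set Y := x N - y in HN HY *.
have := form_sub_le sH mass_form HX HY; have := form_sub_le sH energy_form HX HY.
move: Hphi HN.
move: (mass U X X) (mass U Y Y) (energy U X X) (energy U Y Y) (mass U _ _) (energy U _ _).
by move=> *; lra.
Qed.

End forms.
End form_domains.

(** * Min-max principles *)

Section min_max.
Context {R : realType} {V : lmodType R} (D : V -> Prop) (a b : V -> V -> R).
Hypotheses (sD : subspace_on D) (fa : form_on D a) (fb : form_on D b)
  (cplt : form_complete D a b) (cpct : form_compact D a b).

Lemma trial_space_weaken m C C' : C <= C' -> trial_space D a b m C -> trial_space D a b m C'.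
Proof.
move=> CC' [v [Dv H]]; exists v; split=> // c /=; have [h1 h2] := H c; split=> //.
apply: le_trans h1 _; apply: ler_wpM2r => //; apply: (form_ge0 fb).
exact: subspace_sum.
Qed.

Lemma form_compact_fin :
  (forall e, 0 < e -> exists (J : finType) (l : J -> V -> R) (K : R), [/\ 0 <= K,
    forall i, functional_on D (l i),
    forall i x, D x -> l i x ^+ 2 <= K * b x x &
    forall x, D x -> b x x <= \sum_i l i x ^+ 2 + e * (a x x + b x x)]) ->
  form_compact D a b.
Proof.
move=> H e e0; have [J [l [K [K0 fl lK lb]]]] := H e e0.
exists #|J|, (fun i => l (enum_val i)), K; split=> [//|i|i x Dx|x Dx]; [exact: fl|exact: lK|].
apply: le_trans (lb x Dx) _; rewrite lerD2r le_eqVlt; apply/orP; left.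
by rewrite (reindex (@enum_val J predT))//=; exact/onW_bij/enum_val_bij.
Qed.

(** The form of the max-min principle used here: if no trial space of dimension [m +
    1] has level below [nu], then at most [m] orthogonality conditions force a
    Rayleigh quotient at least [nu]. Only the eigenvalues below [nu] enter, and
    there may be fewer than [m] of them, hence the induction on [m]. *)
Lemma eigensystem_lower_bound m nu : (forall C, C < nu -> ~ trial_space D a b m.+1 C) ->
  exists k (s : 'I_k -> R) (u : 'I_k -> V), [/\ (k <= m)%N, eigensystem D a b s u &
    forall v, D v -> (forall j, b (u j) v = 0) -> nu * b v v <= a v v].
Proof.
elim: m => [|m IH] H.
  exists 0, (fun=> 0), (fun=> 0); split=> //.
    by split=> [[]//|[]//|[]//|v Dv _ []//].
  move=> v Dv _; rewrite leNgt; apply/negP => lt.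
  have b0 : 0 < b v v.
    rewrite lt_def (form_ge0 fb Dv) andbT; apply/eqP => b0.
    by move: lt; rewrite b0 mulr0 ltNge (form_ge0 fa Dv).
  have es : eigensystem D a b (fun=> 0 : R) (fun _ : 'I_0 => 0 : V)
    by split=> [[]//|[]//|[]//|w Dw _ []//].
  apply: (H (a v v / b v v)); first by rewrite ltr_pdivrMr.
  apply: (trial_space_extend sD fa fb es (v := v)) => //; first by split=> // -[].
  by rewrite divfK// gt_eqF.
have [[C Cnu tC]|no] := pselect (exists2 C, C < nu & trial_space D a b m.+1 C); last first.
  have [C Cnu tC|k [s [u [km es lb]]]] := IH; first by apply: no; exists C.
  by exists k, s, u; split=> //; exact: leqW.
have [s [u [es sC]]] := exists_eigensystem sD fa fb cplt cpct tC.
exists m.+1, s, u; split=> // v Dv vu; rewrite leNgt; apply/negP => lt.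
have b0 : 0 < b v v.
  rewrite lt_def (form_ge0 fb Dv) andbT; apply/eqP => b0.
  by move: lt; rewrite b0 mulr0 ltNge (form_ge0 fa Dv).
apply: (H (a v v / b v v)); first by rewrite ltr_pdivrMr.
apply: (trial_space_extend sD fa fb es (v := v)) => //.
by rewrite divfK// gt_eqF.
Qed.

(** Both sides of [s * b u v = a u v = t * b u v]. *)
Lemma eigenvectors_orthogonal u v s t : D u -> D v ->
  (forall w, D w -> a u w = s * b u w) -> (forall w, D w -> a v w = t * b v w) ->
  s <> t -> b u v = 0.
Proof.
move=> Du Dv Hu Hv st; have := Hu v Dv; rewrite (formC fa) Hv// (formC fb) => E.
apply/eqP; apply: contraPT (st) => b0 _; apply: st; apply/(mulIf b0); by rewrite E.
Qed.

(** The eigenvectors are not assumed orthogonal within an eigenspace, so the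
    difference [C * b x x - a x x] is recognized as the value of [b] at the vector
    whose coordinates are multiplied by [sqrt (C - s i)]: the cross terms between
    different eigenvalues vanish. *)
Lemma trial_space_of_eigenvectors m C (s : 'I_m -> R) (u : 'I_m -> V) :
  (forall j, [/\ s j <= C, D (u j) & forall w, D w -> a (u j) w = s j * b (u j) w]) ->
  (forall c : 'I_m -> R, b (\sum_i c i *: u i) (\sum_i c i *: u i) = 0 -> forall i, c i = 0) ->
  trial_space D a b m C.
Proof.
move=> Hu free; exists u; split=> [j|c]; first by have [] := Hu j.
split; last exact: free.
have Du j : D (u j) by have [] := Hu j.
have fal z Dz := form_funr fa (z := z) Dz; have fbl z Dz := form_funr fb (z := z) Dz.
have Dx c' : D (\sum_i c' i *: u i) by exact: subspace_sum.
set x := \sum_i _; pose w := \sum_i (c i * Num.sqrt (C - s i)) *: u i.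
have [_ _ fl] := fb; have [_ _ fal'] := fa.
have expb c1 c2 : b (\sum_i c1 i *: u i) (\sum_i c2 i *: u i) =
    \sum_i \sum_j c1 i * c2 j * b (u i) (u j).
  rewrite (functional_sum sD (fl _ (Dx c2)))//; apply: eq_bigr => i _.
  by rewrite (functional_sum sD (fbl _ (Du i)))// mulr_sumr; apply: eq_bigr => j _; rewrite mulrA.
rewrite -subr_ge0; suff -> : C * b x x - a x x = b w w.
  by apply: (form_ge0 fb); exact: Dx.
rewrite /x /w !expb (functional_sum sD (fal' _ (Dx c)))// mulr_sumr -sumrB.
apply: eq_bigr => i _; have [siC _ ei] := Hu i.
rewrite ei// (functional_sum sD (fbl _ (Du i)))// mulr_sumr mulr_sumr mulr_sumr -sumrB.
apply: eq_bigr => j _; have [sjC _ ej] := Hu j.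
have [sij|sij] := eqVneq (s i) (s j).
  rewrite -sij mulrACA -expr2 sqr_sqrtr ?subr_ge0//; ring.
by rewrite (eigenvectors_orthogonal (Du i) (Du j) ei ej) ?mulr0 ?subr0//; exact/eqP.
Qed.

End min_max.

(** * Zero extension and compactness under the Dirichlet condition *)

Section zero_extension.
Context (R : realType) (n : nat).
Local Notation pair := (('rV[R]_n -> R) * ('I_n -> 'rV[R]_n -> R))%type.

Definition zero_ext (A : set 'rV[R]_n) (p : pair) : pair := (p.1 \_ A, fun i => p.2 i \_ A).

Lemma L2dot_eq (A : set 'rV[R]_n) (u u' v v' : 'rV[R]_n -> R) :
  (forall x, A x -> u x = u' x) -> (forall x, A x -> v x = v' x) ->
  L2dot A u v = L2dot A u' v'.
Proof. by move=> uu' vv'; apply: eq_Rintegral => x /set_mem Ax; rewrite uu'// vv'. Qed.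

Variables (A V : set 'rV[R]_n) (mA : measurable A) (mV : measurable V) (AV : A `<=` V).

Lemma L2dot_zero_ext (u v : 'rV[R]_n -> R) : L2dot V (u \_ A) (v \_ A) = L2dot A u v.
Proof.
rewrite (L2dot_extl AV); apply: L2dot_eq => // x Ax.
by rewrite patchE mem_set.
Qed.

Lemma mass_zero_ext (p q : pair) : mass V (zero_ext A p) (zero_ext A q) = mass A p q.
Proof. exact: L2dot_zero_ext. Qed.

Lemma energy_zero_ext (p q : pair) : energy V (zero_ext A p) (zero_ext A q) = energy A p q.
Proof. by apply: eq_bigr => i _; exact: L2dot_zero_ext. Qed.

Lemma zero_ext_smooth (p : pair) phi : test_function A phi ->
  zero_ext A p - smooth_pair phi = zero_ext A (p - smooth_pair phi).
Proof.
move=> tphi; congr (_, _); [apply/funext => x|apply/funext => i; apply/funext => x].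
  change ((p.1 \_ A) x - phi x = ((fun y => p.1 y - phi y) \_ A) x).
  rewrite !patchE; case: ifPn => // /negP xA.
  rewrite (test_out tphi) ?oppr0 ?addr0// => Ax; apply: xA; exact: mem_set.
change ((p.2 i \_ A) x - partial i phi x = ((fun y => p.2 i y - partial i phi y) \_ A) x).
rewrite !patchE; case: ifPn => // /negP xA.
rewrite (test_out (test_partial i tphi)) ?oppr0 ?addr0// => Ax; apply: xA; exact: mem_set.
Qed.

(** The boundary of [A] does not contribute because [phi] vanishes near it, although
    [psi] does not. *)
Lemma test_parts phi psi i : test_function A phi -> test_function setT psi ->
  L2dot A phi (partial i psi) = - L2dot A (partial i phi) psi.
Proof.
move=> tphi tpsi; have [sphi _ _] := tphi.
rewrite (L2dotC A phi) (L2dotC A (partial i phi)).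
rewrite (test_L2dotT _ tphi) (test_L2dotT _ (test_partial i tphi)).
rewrite (L2dotC setT _ phi) (L2dotC setT _ (partial i phi)).
exact: (smooth_weak_gradient (U := setT) sphi tpsi).
Qed.

(** A function of [H1_0] is a limit of test functions, for which extension by zero
    commutes with differentiation. *)
Lemma domain_zero_ext (p : pair) : in_form_domain Dirichlet A p ->
  in_form_domain Dirichlet V (zero_ext A p).
Proof.
move=> /H1_0P[[u2 g2 _] Hap]; apply/H1_0P; split.
  split=> [|i|psi tpsi i]; [exact: L2_ext|exact: L2_ext|].
  rewrite [LHS](L2dot_extl AV) [X in - X](L2dot_extl AV).
  have tT : test_function setT psi by exact: testW tpsi.
  apply: (L2dot_eq_limit mA) => //.
  - exact: (test_L2 mA (test_partial i tpsi)).
  - exact: (test_L2 mA tpsi).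
  - move=> e e0; have [phi tphi H] := Hap e e0.
    exists phi, (partial i phi); split.
    + exact: (test_L2 mA tphi).
    + exact: (test_L2 mA (test_partial i tphi)).
    + exact: test_parts.
    + by apply: le_trans H; rewrite lerDr; exact: energy_ge0.
    + apply: le_trans (energy_coord A (p - smooth_pair phi) i) _.
      by apply: le_trans H; rewrite lerDl; exact: mass_ge0.
move=> e e0; have [phi tphi H] := Hap e e0; exists phi; first exact: testW tphi.
by rewrite zero_ext_smooth// energy_zero_ext mass_zero_ext.
Qed.

Lemma zero_ext_lin (c : R) (p q : pair) :
  zero_ext A (c *: p + q) = c *: zero_ext A p + zero_ext A q.
Proof.
congr (_, _); [apply/funext => x|apply/funext => i; apply/funext => x].
  change (((fun y => c * p.1 y + q.1 y) \_ A) x = c * (p.1 \_ A) x + (q.1 \_ A) x).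
  rewrite !patchE; case: ifP => // _.
  by rewrite /cst /= mulr0 addr0.
change (((fun y => c * p.2 i y + q.2 i y) \_ A) x = c * (p.2 i \_ A) x + (q.2 i \_ A) x).
rewrite !patchE; case: ifP => // _.
by rewrite /cst /= mulr0 addr0.
Qed.

End zero_extension.

Lemma exists_small (R : realType) (c e : R) : 0 <= c -> 0 < e ->
  exists2 eta0 : R, 0 < eta0 & forall eta, 0 < eta -> eta <= eta0 -> c * eta ^+ 2 <= e.
Proof.
move=> c0 e0; have c1 : 0 < c + 1 by lra.
exists (Num.min 1 (e / (c + 1))); first by rewrite lt_min ltr01 divr_gt0.
move=> eta eta0; rewrite le_min => /andP[e1]; rewrite ler_pdivlMr// => e2.
have : c * eta ^+ 2 <= c * eta by rewrite ler_wpM2l// expr2 ler_piMr// ltW.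
by move=> /le_trans; apply; nra.
Qed.

Section dirichlet_compactness.
Context (R : realType) (n : nat).
Local Notation pair := (('rV[R]_n -> R) * ('I_n -> 'rV[R]_n -> R))%type.

Lemma bounded_radius (U : set 'rV[R]_n) : bounded_set U ->
  exists2 r : R, 0 < r & forall x, U x -> `|x| < r.
Proof.
move=> [M [_ HM]]; exists (Num.max M 0 + 2); first by rewrite ltr_wpDl// le_max lexx orbT.
move=> x Ux; have := HM (Num.max M 0 + 1); rewrite ltr_pwDr ?le_max ?lexx// => /(_ isT x Ux).
by move=> /le_lt_trans; apply; rewrite ltrD2l ltr1n.
Qed.

Lemma exists_grid_size (r eta : R) : 0 < eta -> exists N : nat, 2 * r <= N%:R * eta.
Proof.
move=> eta0; exists (Num.truncn (2 * r / eta)).+1; rewrite -ler_pdivrMr//.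
exact/ltW/Num.Theory.truncnS_gt.
Qed.

Variables (r eta : R) (N : nat) (U : set 'rV[R]_n).
Hypotheses (eta0 : 0 < eta) (rN : 2 * r <= N%:R * eta) (oU : open U)
  (Ur : forall x, U x -> `|x| < r).
Let mU : measurable U. Proof. exact: open_measurable_rV. Qed.

(** The zero extension is a Sobolev function on the whole space, so every cube of
    the grid may be used, including those that cross the boundary. *)
Lemma dirichlet_grid_inequality (p : pair) : in_form_domain Dirichlet U p ->
  mass U p p <=
  \sum_(k : {ffun 'I_n -> 'I_N}) L2dot (grid_cube r eta k) (p.1 \_ U) (cst 1) ^+ 2 / eta ^+ n +
  2 ^+ n * n%:R * eta ^+ 2 * energy U p p.
Proof.
move=> Dp; have [Hp _] := Dp; have [u2 _ _] := Hp.
have UT : U `<=` setT by [].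
have [H _] := domain_zero_ext mU measurableT UT Dp.
have := grid_poincare (r := r) eta0 openT H (N := N) (P := predT) (fun k _ => @subsetT _ _).
rewrite (_ : \sum_i L2dot setT _ _ = energy U p p); last exact: energy_zero_ext.
apply: le_trans.
have mk (k : {ffun 'I_n -> 'I_N}) := measurable_grid_cube r eta k.
have mkU (k : {ffun 'I_n -> 'I_N}) : measurable (grid_cube r eta k `&` U) by exact: measurableI.
apply: (@le_trans _ _ (\sum_(k : {ffun 'I_n -> 'I_N}) L2dot (grid_cube r eta k `&` U) p.1 p.1)).
  apply: L2dot_le_cover => //.
  - by move=> x Ux; have [k Qx] := grid_cover eta0 rN (Ur Ux); exists k.
apply: ler_sum => k _.
have eT : L2 setT (p.1 \_ U) by case: H.
rewrite (L2dot_eq (u' := p.1 \_ U) (v' := p.1 \_ U)).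
- by apply: L2dot_le => //; exact: (L2_restr measurableT (mk k) (@subsetT _ _)).
- by move=> x [_ Ux]; rewrite patchE mem_set.
- by move=> x [_ Ux]; rewrite patchE mem_set.
Qed.

End dirichlet_compactness.

Section dirichlet_compact_embedding.
Context (R : realType) (n : nat).

Lemma L2_grid_cst r (eta : R) N (k : {ffun 'I_n -> 'I_N}) : 0 < eta ->
  L2 (grid_cube r eta k) (cst 1 : 'rV[R]_n -> R).
Proof.
move=> eta0.
by have [] := L2_cst_finite (measurable_grid_cube r eta k) (lebesgue_grid_cube r eta0 k).
Qed.

Lemma dirichlet_compact (U : set 'rV[R]_n) : open U -> bounded_set U ->
  form_compact (in_form_domain Dirichlet U) (energy U) (mass U).
Proof.
move=> oU /bounded_radius[r r0 Ur]; apply: form_compact_fin => e e0.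
have mU := open_measurable_rV oU; have UT : U `<=` setT by [].
have c0 : 0 <= 2 ^+ n * n%:R :> R by apply: mulr_ge0 (ler0n _ _); exact: exprn_ge0.
have [eta eta0 /(_ eta eta0 (lexx _)) He] := exists_small c0 e0.
have [N rN] := exists_grid_size r eta0.
have en : 0 < eta ^+ n by exact: exprn_gt0.
exists {ffun 'I_n -> 'I_N}, (fun k p => L2dot (grid_cube r eta k) (p.1 \_ U) (cst 1) *
   (Num.sqrt (eta ^+ n))^-1), 1.
have sqrt2 X : (X * (Num.sqrt (eta ^+ n))^-1) ^+ 2 = X ^+ 2 / eta ^+ n.
  by rewrite exprMn exprVn sqr_sqrtr// ltW.
have H p : in_form_domain Dirichlet U p -> H1 setT (p.1 \_ U) (fun i => p.2 i \_ U).
  by move=> Dp; have [] := domain_zero_ext mU measurableT UT Dp.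
split=> //.
- move=> k c p q Dp Dq; rewrite /= mulrA -mulrDl; congr (_ * _).
  have mk := measurable_grid_cube r eta k.
  have [p2 _ _] := H p Dp; have [q2 _ _] := H q Dq.
  have := L2dot_lin mk c (L2_restr measurableT mk (@subsetT _ _) p2)
    (L2_restr measurableT mk (@subsetT _ _) q2) (L2_grid_cst r k eta0).
  by move=> <-; congr (L2dot _ _ _); have [] := zero_ext_lin U c p q.
- move=> k p Dp; rewrite sqrt2 mul1r ler_pdivrMr// mulrC.
  have := grid_mean_bound (r := r) eta0 openT (H p Dp) (k := k) (@subsetT _ _).
  by rewrite L2dot_zero_ext.
- move=> p Dp; apply: le_trans (dirichlet_grid_inequality eta0 rN oU Ur Dp) _.
  under [X in _ <= X + _]eq_bigr do rewrite sqrt2.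
  rewrite lerD2l; apply: le_trans (ler_wpM2r (energy_ge0 U p) He) _.
  by rewrite ler_wpM2l ?(ltW e0)// lerDl mass_ge0.
Qed.

End dirichlet_compact_embedding.

(** * Boundary layers and compactness under the Neumann condition *)

Section strips.
Context (R : realType) (n : nat).
Local Notation mu := (lebesgue_rV R n).
Variables (U : set 'rV[R]_n) (u : 'rV[R]_n -> R) (g : 'I_n -> 'rV[R]_n -> R).
Hypotheses (oU : open U) (ug : H1 U u g).
Let mU : measurable U. Proof. exact: open_measurable_rV. Qed.

(** Compare [u] at [x] with [u] at the translated point [x + z] and bound the
    increment by the translation estimate. *)
Lemma translate_mass_le (T : set 'rV[R]_n) (z : 'rV[R]_n) (eta : R) : measurable T ->
  (forall i, `|z ord0 i| <= eta) ->
  (forall x t, T x -> 0 <= t <= 1 -> U (x + t *: z)) ->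
  L2dot T u u <= 2 * L2dot ((fun x => x - z) @^-1` T) u u +
    2 * (n%:R * eta ^+ 2 * \sum_i L2dot U (g i) (g i)).
Proof.
move=> mT zeta TU; have [u2 g2 _] := ug.
set S := _ @^-1` T.
have mS : measurable S.
  by rewrite -[S]setTI; exact: (measurable_shift (- z)).
have TU0 : T `<=` U by move=> x Tx; have := TU x 0 Tx; rewrite scale0r addr0 lexx ler01; exact.
have SU : S `<=` U.
  by move=> x Sx; have := TU (x - z) 1 Sx; rewrite scale1r subrK lexx ler01; exact.
have uT := L2_restr mU mT TU0 u2; have uS := L2_restr mU mS SU u2.
have mu_ : measurable_fun setT (u \_ U).
  by apply/measurable_restrict => //; rewrite setTI; exact: L2_measurable u2.
have shiftE : (\int[mu]_(x in T) ((u (x + z)%R) ^+ 2)%:E = (L2dot S u u)%:E)%E.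
  rewrite (L2dotE mS uS) [RHS]integral_mkcond -(ge0_integral_shift z).
  - rewrite [LHS]integral_mkcond; apply: eq_integral => x _; rewrite !patchE.
    have -> : (x + z \in S) = (x \in T).
      by apply/idP/idP => /set_mem H; apply/mem_set; move: H; rewrite /S/= addrK.
    by case: ifP.
  - apply: (measurable_restrictT _ mS).1; apply: measurable_sqr; exact: L2_measurable uS.
  - by move=> x; rewrite patchE; case: ifP => // _; rewrite lee_fin sqr_ge0.
have mshift : measurable_fun T (fun x => u (x + z)).
  have H : measurable_fun T (fun x => (u \_ U) (x + z)).
    by apply: measurable_funTS; exact: (measurableT_comp mu_ (measurable_shift z)).
  apply: eq_measurable_fun H => x /set_mem Tx; rewrite patchE mem_set//.
  by have := TU x 1 Tx; rewrite scale1r lexx ler01; exact.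
have E := H1_translate_energy oU ug mT mU (@subset_refl _ U) zeta TU.
have E0 : 0 <= n%:R * eta ^+ 2 * \sum_i L2dot U (g i) (g i).
  apply: mulr_ge0; first by apply: mulr_ge0 (sqr_ge0 _).
  by apply: sumr_ge0 => i _; exact: L2dot_ge0.
rewrite -lee_fin (L2dotE mT uT).
apply: (@le_trans _ _ (\int[mu]_(x in T) (2%:E * ((u (x + z)%R) ^+ 2)%:E +
    2%:E * ((u (x + z)%R - u x)%R ^+ 2)%:E))%E).
  apply: ge0_le_integral => //.
  - by move=> x _; rewrite lee_fin sqr_ge0.
  - by apply: measurable_sqr; exact: L2_measurable uT.
  - apply: emeasurable_funD; apply: emeasurable_funM => //; apply/measurable_EFinP.
      exact: measurable_funX.
    by apply: measurable_funX; apply: measurable_funB => //; exact: L2_measurable uT.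
  - move=> x _; rewrite -!EFinM -EFinD lee_fin.
    (* u ^ 2 <= 2 v ^ 2 + 2 (v - u) ^ 2 amounts to 0 <= (2 v - u) ^ 2 *)
    have := sqr_ge0 (2 * u (x + z) - u x); lra.
rewrite ge0_integralD//; last 4 first.
- by move=> x _; rewrite -EFinM lee_fin mulr_ge0// sqr_ge0.
- by apply: emeasurable_funM => //; apply/measurable_EFinP; exact: measurable_funX.
- by move=> x _; rewrite -EFinM lee_fin mulr_ge0// sqr_ge0.
- apply: emeasurable_funM => //; apply/measurable_EFinP; apply: measurable_funX.
  by apply: measurable_funB => //; exact: L2_measurable uT.
rewrite !ge0_integralZl_EFin//; last 4 first.
- by move=> x _; rewrite lee_fin sqr_ge0.
- apply/measurable_EFinP; apply: measurable_funX.
  by apply: measurable_funB => //; exact: L2_measurable uT.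
- by move=> x _; rewrite lee_fin sqr_ge0.
- by apply/measurable_EFinP; exact: measurable_funX.
rewrite shiftE [X in (_ <= X)%E]EFinD. apply: leeD; first by rewrite EFinM.
by rewrite [X in (_ <= X)%E]EFinM; apply: lee_wpmul2l.
Qed.

(** The [M] translates of [T] by multiples of [delta e] are disjoint subsets of [U],
    so on average [u] has at most [1 / M] of its mass on one of them; going back to
    [T] costs the energy along a segment of length [M delta]. *)
Lemma strip_estimate (T : set 'rV[R]_n) (e : 'rV[R]_n) (c delta : R) (M : nat) :
  measurable T -> 0 < delta -> (forall i, `|e ord0 i| <= c) ->
  (forall x t, T x -> 0 <= t <= M%:R * delta -> U (x + t *: e)) ->
  (forall x y (j l : nat), T x -> T y ->
     x + (j%:R * delta) *: e = y + (l%:R * delta) *: e -> j = l) ->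
  M%:R * L2dot T u u <= 2 * L2dot U u u +
    M%:R * (2 * (n%:R * (M%:R * delta * c) ^+ 2 * \sum_i L2dot U (g i) (g i))).
Proof.
move=> mT d0 ec TU disj; have [u2 g2 _] := ug.
pose z (j : 'I_M) := (j%:R * delta) *: e.
pose S j := (fun x => x - z j) @^-1` T.
have jM (j : 'I_M) : 0 <= j%:R * delta <= M%:R * delta.
  by rewrite mulr_ge0 ?(ltW d0)//= ler_wpM2r ?(ltW d0)// ler_nat ltnW.
have mS j : measurable (S j).
  by rewrite -[S j]setTI; exact: (measurable_shift (- z j)).
have SU j : S j `<=` U.
  by move=> x Sx; have := TU (x - z j) (j%:R * delta) Sx (jM j); rewrite subrK.
set K := 2 * (n%:R * (M%:R * delta * c) ^+ 2 * _).
have step j : L2dot T u u <= 2 * L2dot (S j) u u + K.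
  apply: translate_mass_le => //.
    move=> i; rewrite !mxE normrM ger0_norm; last by have /andP[] := jM j.
    by apply: ler_pM => //; have /andP[] := jM j.
  move=> x t Tx /andP[t0 t1]; rewrite scalerA; apply: TU => //.
  have /andP[j0 j1] := jM j; rewrite mulr_ge0//=; apply: le_trans j1.
  by rewrite ler_piMl.
have dis : \sum_(j < M) L2dot (S j) u u <= L2dot U u u.
  apply: L2dot_sum_disjoint => //.
  move=> j l _ _ [x [Sj Sl]]; apply/val_inj/(disj _ _ _ _ Sj Sl).
  by rewrite !subrK.
have : \sum_(j < M) L2dot T u u <= \sum_(j < M) (2 * L2dot (S j) u u + K).
  by apply: ler_sum => j _; exact: step.
rewrite big_split/= -mulr_sumr !sumr_const card_ord -[X in X <= _]mulr_natl.
rewrite -[X in _ + X]mulr_natl => /le_trans; apply.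
by rewrite lerD2r ler_wpM2l.
Qed.

End strips.

Section lipschitz_charts.
Context (R : realType) (n : nat).

(** Distances are measured in the sup norm, so that a grid cube of side [eta]
    through a point outside the layer lies in [U]. *)
Definition boundary_layer (U : set 'rV[R]_n) (eta : R) : set 'rV[R]_n :=
  [set x | U x /\ exists y, ~ U y /\ forall i, `|x ord0 i - y ord0 i| < eta].

(** The mass carried by the part of a thin boundary layer that lies in [A] is a
    small fraction of the graph norm. The layer is only required to be contained in
    a measurable set [T] with this property. *)
Definition thin_layer_at (U A : set 'rV[R]_n) := forall eps : R, 0 < eps ->
  exists2 eta0 : R, 0 < eta0 & forall eta, 0 < eta -> eta <= eta0 ->
  exists T, [/\ measurable T, T `<=` U, forall x, boundary_layer U eta x -> A x -> T x &
    forall p, in_form_domain Neumann U p ->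
      mass T p p <= eps * (energy U p p + mass U p p)].

Lemma L2dot_setU (T1 T2 : set 'rV[R]_n) u : measurable T1 -> measurable T2 ->
  L2 (T1 `|` T2) u -> L2dot (T1 `|` T2) u u <= L2dot T1 u u + L2dot T2 u u.
Proof.
move=> m1 m2 u2.
have := @L2dot_le_cover R n bool predT (fun b => if b then T1 else T2) (T1 `|` T2) u.
rewrite big_bool /=; apply.
- by case.
- exact: measurableU.
- by [].
- by case=> _; [exact: subsetUl|exact: subsetUr].
- by move=> x [T1x|T2x]; [exists true|exists false].
Qed.

Lemma thin_layer_setU U A B : measurable U -> thin_layer_at U A -> thin_layer_at U B ->
  thin_layer_at U (A `|` B).
Proof.
move=> mU HA HB eps eps0; have e2 : 0 < eps / 2 by rewrite divr_gt0.
have [ea ea0 Ha] := HA _ e2; have [eb eb0 Hb] := HB _ e2.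
exists (Num.min ea eb); first by rewrite lt_min ea0.
move=> eta eta0; rewrite le_min => /andP[ha hb].
have [T1 [m1 U1 c1 b1]] := Ha eta eta0 ha; have [T2 [m2 U2 c2 b2]] := Hb eta eta0 hb.
exists (T1 `|` T2); split.
- exact: measurableU.
- by move=> x [/U1|/U2].
- by move=> x lx [/(c1 x lx)|/(c2 x lx)]; [left|right].
- move=> p Hp; have [u2 _ _] := Hp.
  have sub : T1 `|` T2 `<=` U by move=> x [/U1|/U2].
  apply: le_trans (L2dot_setU m1 m2 (L2_restr mU (measurableU _ _ m1 m2) sub u2)) _.
  have := lerD (b1 p Hp) (b2 p Hp); rewrite -mulrDl -splitr; exact.
Qed.

Lemma thin_layer_sub U A B : A `<=` B -> thin_layer_at U B -> thin_layer_at U A.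
Proof.
move=> AB H eps eps0; have [e0 e00 He] := H _ eps0; exists e0 => // eta h1 h2.
have [T [mT TU c b]] := He eta h1 h2; exists T; split=> // x lx /AB; exact: c.
Qed.

Lemma thin_layer_empty U A e0 : 0 < e0 -> (forall x, boundary_layer U e0 x -> ~ A x) ->
  thin_layer_at U A.
Proof.
move=> e00 H eps eps0; exists e0 => // eta h1 h2; exists set0; split=> //.
  move=> x [Ux [y [Uy xy]]] Ax; apply: (H x) => //; split=> //; exists y; split=> // i.
  exact: lt_le_trans (xy i) h2.
move=> p Hp; rewrite /mass /L2dot /Rintegral integral_set0/=.
by rewrite mulr_ge0 ?(ltW eps0)// addr_ge0// ?energy_ge0 ?mass_ge0.
Qed.

(** The complements of the sets with a thin layer form a filter. If the conclusion
    failed it would be proper and would cluster at a point of the compact set [K],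
    which contradicts the hypothesis at that point. *)
Lemma thin_layer_compact (U K : set 'rV[R]_n) : measurable U -> compact K ->
  U `<=` K ->
  (forall x, K x -> exists2 A, nbhs x A & thin_layer_at U A) -> thin_layer_at U setT.
Proof.
move=> mU cK UK loc.
have [//|no] := pselect (thin_layer_at U setT).
pose F : set_system 'rV[R]_n := [set A | thin_layer_at U (~` A)].
have FK : F K by apply: (@thin_layer_empty _ _ 1) => // x [Ux _]; apply; exact: UK.
have PF : ProperFilter F.
  split; first by rewrite /F/= setC0.
  split.
  - rewrite /F/= setCT; apply: (@thin_layer_empty _ _ 1) => // x _ [].
  - by move=> A B FA FB; rewrite /F/= setCI; exact: thin_layer_setU.
  - by move=> A B AB; apply: thin_layer_sub; exact: subsetC.
have [x [Kx clx]] := cK F PF FK.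
have [A nA tA] := loc x Kx.
have FA : F (~` A) by rewrite /F/= setCK.
by have [y [nAy Ay]] := clx _ _ FA nA.
Qed.

Section chart.
Variables (U : set 'rV[R]_n) (Q : 'M[R]_n) (i0 : 'I_n) (gamma : 'rV[R]_n.-1 -> R) (L : R).
Hypotheses (oQ : Q *m Q^T = 1%:M) (lg : L.-lipschitz gamma).

Let h (x : 'rV[R]_n) : R := (x *m Q) ord0 i0 - gamma (col' i0 (x *m Q)).
Let C : R := \sum_k \sum_j `|Q k j|.

Let QC k j : `|Q k j| <= C.
Proof.
rewrite /C (bigD1 k)//= (bigD1 j)//= -addrA lerDl addr_ge0//.
  by apply: sumr_ge0.
by apply: sumr_ge0 => a _; apply: sumr_ge0.
Qed.

Let C0 : 0 <= C. Proof. by apply: sumr_ge0 => a _; apply: sumr_ge0. Qed.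

Let coordQ (x y : 'rV[R]_n) (eta : R) j : (forall i, `|x ord0 i - y ord0 i| <= eta) ->
  `|(x *m Q) ord0 j - (y *m Q) ord0 j| <= C * eta.
Proof.
move=> xy; rewrite !mxE -sumrB; apply: le_trans (ler_norm_sum _ _ _) _.
rewrite /C mulr_suml; apply: ler_sum => k _; rewrite -mulrBl normrM mulrC.
have e0 : 0 <= eta by apply: le_trans (xy k).
apply: ler_pM => //; rewrite (bigD1 j)//= lerDl; exact: sumr_ge0.
Qed.

Let Lam : R := C + Num.max L 0 * C.

Let Lam0 : 0 <= Lam.
Proof. by rewrite addr_ge0// mulr_ge0// le_max lexx orbT. Qed.

Let hlip (x y : 'rV[R]_n) (eta : R) : (forall i, `|x ord0 i - y ord0 i| <= eta) ->
  0 <= eta -> `|h x - h y| <= Lam * eta.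
Proof.
move=> xy e0; rewrite /h opprD addrACA -opprD.
apply: le_trans (ler_normD _ _) _; rewrite /Lam mulrDl; apply: lerD.
  exact: coordQ.
rewrite normrN; have := lg (x := (col' i0 (x *m Q), col' i0 (y *m Q))) (conj I I).
move=> /le_trans; apply; rewrite -mulrA.
apply: (@le_trans _ _ (Num.max L 0 * `|col' i0 (x *m Q) - col' i0 (y *m Q)|)).
  by rewrite ler_wpM2r// le_max lexx.
apply: ler_wpM2l; first by rewrite le_max lexx orbT.
apply: norm_le_coord; first exact: mulr_ge0.
move=> j; rewrite !mxE.
by have := coordQ (lift i0 j) xy; rewrite !mxE.
Qed.

Let e : 'rV[R]_n := row i0 Q^T.

Let eQ : e *m Q = delta_mx ord0 i0.
Proof. by rewrite /e -row_mul (mulmx1C oQ) row1. Qed.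

Let h_e x t : h (x + t *: e) = h x + t.
Proof.
rewrite /h mulmxDl -scalemxAl eQ.
have -> : col' i0 (x *m Q + t *: delta_mx ord0 i0) = col' i0 (x *m Q).
  by apply/rowP => j; rewrite !mxE (eq_sym (lift i0 j)) (negbTE (neq_lift i0 j)) andbF mulr0 addr0.
by rewrite !mxE !eqxx mulr1; ring.
Qed.

Variables (x0 : 'rV[R]_n) (rho : R).
Hypotheses (rho0 : 0 < rho) (oU : open U)
  (Uh : forall x, ball x0 rho x -> (U x <-> gamma (col' i0 (x *m Q)) < (x *m Q) ord0 i0)).

Let Uh' x : ball x0 rho x -> (U x <-> 0 < h x).
Proof. by move=> /Uh; rewrite subr_gt0. Qed.

(** In the chart, [h] is the height above the graph and increases at unit speed
    along the direction [e], which points into [U]. The part of the layer of height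
    less than [delta] and its translates by [delta e], [2 delta e], and so on are
    disjoint, and the strip estimate applies with [M] large and then [delta] small. *)
Lemma thin_layer_chart : thin_layer_at U (ball x0 (rho / 2)).
Proof.
move=> eps eps0.
(* M makes the averaged mass at most eps times the mass; delta then makes the energy
   term small and keeps the M translates inside the chart *)
pose M := (Num.truncn (2 / eps)).+1.
have M0 : 0 < M%:R :> R by [].
have M2 : 2 <= eps * M%:R.
  rewrite mulrC -ler_pdivrMr//; exact/ltW/Num.Theory.truncnS_gt.
have c0 : 0 <= 2 * (n%:R * (M%:R * C) ^+ 2) :> R by rewrite mulr_ge0// mulr_ge0// sqr_ge0.
have [d1 d10 Hd1] := exists_small c0 eps0.
have MC : 0 < M%:R * C + 1 by rewrite ltr_wpDl// mulr_ge0.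
pose delta := Num.min d1 (rho / 4 / (M%:R * C + 1)).
have delta0 : 0 < delta by rewrite lt_min d10 !divr_gt0.
have dd1 : 2 * (n%:R * (M%:R * C) ^+ 2) * delta ^+ 2 <= eps.
  by apply: Hd1 => //; rewrite ge_min lexx.
have dd2 : M%:R * delta * C <= rho / 4.
  have : delta <= rho / 4 / (M%:R * C + 1) by rewrite ge_min lexx orbT.
  rewrite ler_pdivlMr// => H.
  by move: (delta) delta0 H => d dpos H; lra.
exists (Num.min (rho / 4) (delta / 2 / (Lam + 1))).
  by rewrite lt_min !divr_gt0// ltr_wpDl.
move=> eta eta0; rewrite le_min => /andP[h1 h2].
have L1 : 0 < Lam + 1 by rewrite ltr_wpDl.
have {}h2 : Lam * eta < delta.
  by move: h2; rewrite ler_pdivlMr// => h2; nra.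
pose T := U `&` ball x0 (rho / 2) `&` [set x | h x < delta].
have oT : open [set x | h x < delta].
  rewrite openE => x /= hx; apply/nbhs_ballP.
  exists ((delta - h x) / (Lam + 1)); first by rewrite /= divr_gt0// subr_gt0.
  move=> y; rewrite ball_rV ?divr_gt0 ?subr_gt0// => Bxy /=.
  have := @hlip x y ((delta - h x) / (Lam + 1)) (fun i => ltW (Bxy i)).
  rewrite ltW ?divr_gt0 ?subr_gt0// => /(_ isT).
  have p : 0 < (delta - h x) / (Lam + 1) by rewrite divr_gt0// subr_gt0.
  have q : (Lam + 1) * ((delta - h x) / (Lam + 1)) = delta - h x.
    by rewrite mulrC divfK// gt_eqF.
  rewrite ler_norml => /andP[H _]; move: p q H; set w := (_ / _) => p q H; lra.
have oB : open (ball x0 (rho / 2)) by exact: ball_open.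
have r2 : 0 < rho / 2 by rewrite divr_gt0.
have mT : measurable T by apply: open_measurable_rV; apply: openI => //; exact: openI.
have bb x : ball x0 (rho / 2) x -> ball x0 rho x.
  by rewrite !ball_rV// => H i; apply: lt_trans (H i) _; lra.
exists T; split=> //.
- by move=> x [[]].
- move=> x [Ux [y [Uy xy]]] Bx; split; first by split.
  have By : ball x0 rho y.
    move: Bx; rewrite !ball_rV// => H i; have := H i; have := xy i.
    rewrite !ltr_norml => /andP[a1 a2] /andP[b1 b2]; apply/andP; split; lra.
  have hy : h y <= 0 by rewrite leNgt; apply/negP => /(Uh' By).
  have := hlip (fun i => ltW (xy i)) (ltW eta0).
  by rewrite ler_norml /= => /andP[_ H]; lra.
- move=> p Hp.
  have seg x t : T x -> 0 <= t <= M%:R * delta -> U (x + t *: e).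
    move=> [[Ux Bx] _] /andP[t0 tM].
    have hx : 0 < h x by apply/(Uh' (bb _ Bx)).
    apply/Uh'; last by rewrite h_e; lra.
    move: Bx; rewrite !ball_rV// => H i; rewrite !mxE.
    have : `|t * Q i i0| <= rho / 4.
      rewrite normrM ger0_norm//; apply: le_trans dd2; exact: ler_pM.
    have := H i; rewrite !ltr_norml ler_norml => /andP[a1 a2] /andP[b1 b2].
    by apply/andP; split; lra.
  have disj x y (j l : nat) : T x -> T y ->
     x + (j%:R * delta) *: e = y + (l%:R * delta) *: e -> j = l.
    move=> [[Ux Bx] dx] [[Uy By] dy] E.
    have hx : 0 < h x by apply/(Uh' (bb _ Bx)).
    have hy : 0 < h y by apply/(Uh' (bb _ By)).
    have : h x + j%:R * delta = h y + l%:R * delta by rewrite -!h_e E.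
    move: dx dy => /= dx dy {}E.
    (* heights in the strip are between 0 and delta, so they determine the multiple
       of delta *)
    have lt (a b : nat) (s t : R) : s < delta -> 0 < t ->
        t + a%:R * delta = s + b%:R * delta -> (a <= b)%N.
      move=> sd t0 E'; rewrite -ltnS -(ltr_nat R) -(ltr_pM2r delta0).
      by rewrite -[b.+1]addn1 natrD; lra.
    by apply/eqP; rewrite eqn_leq (lt j l _ _ dy hx E) (lt l j _ _ dx hy (esym E)).
  have := @strip_estimate R n U p.1 p.2 oU Hp T e C delta M mT delta0 _ seg disj.
  have ec : forall i, `|e ord0 i| <= C by move=> i; rewrite !mxE.
  move=> /(_ ec).
  have -> : 2 * (n%:R * (M%:R * delta * C) ^+ 2 * \sum_i L2dot U (p.2 i) (p.2 i)) =
     (2 * (n%:R * (M%:R * C) ^+ 2) * delta ^+ 2) * energy U p p by rewrite /energy; ring.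
  move=> H; rewrite -(ler_pM2l M0); apply: le_trans H _.
  have m0 := mass_ge0 U p; have e0' := energy_ge0 U p.
  rewrite -/(mass U p p) [eps * _]mulrDr [X in _ <= X]mulrDr addrC; apply: lerD.
    by rewrite ler_wpM2l// ler_wpM2r.
  by rewrite mulrA ler_wpM2r// mulrC.
Qed.

End chart.
End lipschitz_charts.

Section neumann_compactness.
Context (R : realType) (n : nat).

(** Near an interior point or an exterior point a thin layer is empty; near a
    boundary point there is a Lipschitz chart. *)
Lemma thin_layer_domain (U : set 'rV[R]_n) : domain U -> thin_layer_at U setT.
Proof.
move=> [oU bU lU]; have mU := open_measurable_rV oU.
have [r r0 Ur] := bounded_radius bU.
apply: (@thin_layer_compact _ _ U (closed_box (fun=> - r) (fun=> r))) => //.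
- exact: compact_closed_box.
- move=> x /Ur xr i; rewrite /= in_itv/= -ler_norml.
  exact: le_trans (coord_le_norm x i) (ltW xr).
move=> x _; have [Ux|nUx] := pselect (U x).
  have /nbhs_ballP[e /= e0 eU] := oU x Ux.
  have e2 : 0 < e / 2 by rewrite divr_gt0.
  exists (ball x (e / 2)); first exact: nbhsx_ballx.
  apply: (thin_layer_empty e2) => y [_ [z [Uz yz]]]; rewrite ball_rV// => xy.
  apply/Uz/eU; rewrite ball_rV// => i; have := xy i; have := yz i.
  by rewrite !ltr_norml => /andP[a1 a2] /andP[b1 b2]; apply/andP; split; lra.
have [cx|ncx] := pselect (closure U x); last first.
  have [A nA AU] : exists2 A, nbhs x A & A `&` U = set0.
    apply: contrapT => H; apply: ncx => A nA; apply/set0P/eqP => AU.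
    by apply: H; exists A => //; rewrite setIC.
  exists A => //; apply: (@thin_layer_empty _ _ _ _ 1) => // y [Uy _] Ay.
  by have : (A `&` U) y by []; rewrite AU.
have nint : ~ U° x by move=> /interior_subset.
have [Q [i [gamma [L [oQ lg near_x]]]]] := lU x cx nint.
have /nbhs_ballP[rho /= rho0 Hrho] := near_x.
exists (ball x (rho / 2)); first by apply: nbhsx_ballx; rewrite divr_gt0.
exact: (thin_layer_chart oQ lg rho0 oU Hrho).
Qed.

(** A point outside a thin boundary layer lies in a grid cube contained in [U]. The
    Poincare inequality controls the mass on those cubes by finitely many mean
    values, and the layer carries little mass. *)
Lemma neumann_compact (U : set 'rV[R]_n) : domain U ->
  form_compact (in_form_domain Neumann U) (energy U) (mass U).
Proof.
move=> dU; have [oU bU _] := dU; have mU := open_measurable_rV oU.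
have [r r0 Ur] := bounded_radius bU.
apply: form_compact_fin => e e0; have e2 : 0 < e / 2 by rewrite divr_gt0.
have c0 : 0 <= 2 ^+ n * n%:R :> R by apply: mulr_ge0 (ler0n _ _); exact: exprn_ge0.
have [eta1 eta10 He] := exists_small c0 e2.
have [eta2 eta20 Hlayer] := thin_layer_domain dU e2.
pose eta := Num.min eta1 eta2.
have eta0 : 0 < eta by rewrite lt_min eta10.
have {}He : 2 ^+ n * n%:R * eta ^+ 2 <= e / 2 by apply: He; rewrite // ge_min lexx.
have [|T [mT TU layT HT]] := Hlayer eta eta0; first by rewrite ge_min lexx orbT.
have [N rN] := exists_grid_size r eta0.
have en : 0 < eta ^+ n by exact: exprn_gt0.
pose P (k : {ffun 'I_n -> 'I_N}) := `[< grid_cube r eta k `<=` U >].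
pose s := (Num.sqrt (eta ^+ n))^-1.
have sqrt2 X : (X * s) ^+ 2 = X ^+ 2 / eta ^+ n.
  by rewrite exprMn exprVn sqr_sqrtr// ltW.
exists {ffun 'I_n -> 'I_N}, (fun k p => if P k then L2dot (grid_cube r eta k) p.1 (cst 1) * s else 0), 1.
split=> //.
- move=> k c p q [p2 _ _] [q2 _ _]; case: (boolP (P k)) => [/asboolP kU|_]; last by rewrite mulr0 addr0.
  rewrite /= mulrA -mulrDl; congr (_ * _).
  have mk := measurable_grid_cube r eta k.
  exact: (L2dot_lin mk c (L2_restr mU mk kU p2) (L2_restr mU mk kU q2) (L2_grid_cst r k eta0)).
- move=> k p Hp; case: (boolP (P k)) => [/asboolP kU|_].
    rewrite sqrt2 mul1r ler_pdivrMr// mulrC; exact: (grid_mean_bound eta0 oU Hp kU).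
  by rewrite expr0n/= mul1r mass_ge0.
- move=> p Hp; have [u2 _ _] := Hp.
  have mk (k : {ffun 'I_n -> 'I_N}) := measurable_grid_cube r eta k.
  have mD : measurable (U `\` T) by exact: measurableD.
  have DU : U `\` T `<=` U by move=> x [].
  have uD := L2_restr mU mD DU u2.
  have UTE : T `|` U `\` T = U by exact: setDUK.
  have H1 : mass U p p <= mass T p p + mass (U `\` T) p p.
    by rewrite /mass -[X in L2dot X _ _]UTE; apply: L2dot_setU => //; rewrite UTE.
  have H2 : mass (U `\` T) p p <= \sum_(k | P k) L2dot (grid_cube r eta k) p.1 p.1.
    apply: (@le_trans _ _ (\sum_(k | P k) L2dot (grid_cube r eta k `&` (U `\` T)) p.1 p.1)).
      apply: L2dot_le_cover => //.
      - by move=> k _; exact: measurableI.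
      - move=> x [Ux nTx]; have [k Qx] := grid_cover eta0 rN (Ur x Ux); exists k => //.
        apply/asboolP => y Qy; apply: contrapT => Uy; apply: nTx; apply: layT => //.
        split=> //; exists y; split=> // i.
        exact: (grid_cube_diam i Qy Qx).
    apply: ler_sum => k /asboolP kU; apply: L2dot_le => //; first exact: measurableI.
    exact: (L2_restr mU (mk k) kU u2).
  have H3 := grid_poincare eta0 oU Hp (r := r) (P := P) (fun k => @asboolW _).
  under eq_bigr do rewrite (fun_if (fun X => X ^+ 2)) sqrt2 expr0n/=.
  rewrite -big_mkcond/=.
  have := HT p Hp; have := ler_wpM2r (energy_ge0 U p) He; have := mass_ge0 U p.
  have hm := mass_ge0 U p; have := mulr_ge0 (ltW e0) hm.
  rewrite -/(energy U p p) in H3.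
  move: H1 H2 H3; set S := \sum_(k | P k) _; set S' := \sum_(k | P k) _.
  move: (mass U p p) (mass T p p) (mass (U `\` T) p p) (energy U p p) S S'.
  by move: (2 ^+ n * n%:R * eta ^+ 2) => K mU' mT' mD' E S S' *; nra.
Qed.

Lemma domain_compact bc (U : set 'rV[R]_n) : domain U ->
  form_compact (in_form_domain bc U) (energy U) (mass U).
Proof.
by move=> dU; case: bc; [case: dU => oU bU _; exact: dirichlet_compact|exact: neumann_compact].
Qed.

End neumann_compactness.

(** * Eigenvalues and trial spaces *)

Section spectrum.
Context (R : realType) (n : nat) (bc : boundary_condition).
Local Notation pair := (('rV[R]_n -> R) * ('I_n -> 'rV[R]_n -> R))%type.

Definition has_trial_space (U : set 'rV[R]_n) m (C : R) :=
  trial_space (in_form_domain bc U) (energy U) (mass U) m C.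

Lemma fst_sum m (c : 'I_m -> R) (v : 'I_m -> pair) x :
  (\sum_i c i *: v i).1 x = \sum_i c i * (v i).1 x.
Proof.
have -> : (\sum_i c i *: v i).1 = \sum_i c i *: (v i).1.
  by rewrite (big_morph (fun p : pair => p.1) (id1 := 0) (op1 := +%R)).
by rewrite fct_sumE.
Qed.

(** Eigenfunctions span a trial space; linear independence modulo null functions is
    what makes the mass nondegenerate on their span. *)
Lemma trial_space_of_count (U : set 'rV[R]_n) m t : measurable U ->
  eigenvalue_count_ge bc U m t -> has_trial_space U m t.
Proof.
move=> mU [s [u [Hu free]]].
have /choice[g Hg] : forall a, exists g, form_domain bc U (u a) g /\
    forall v h, form_domain bc U v h -> \sum_i L2dot U (g i) (h i) = s a * L2dot U (u a) v.
  by move=> a; have [_ [g Dg eg]] := Hu a; exists g.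
pose p a : pair := (u a, g a).
have sD := domain_subspace mU bc.
have Dp a : in_form_domain bc U (p a) by have [] := Hg a.
apply: (@trial_space_of_eigenvectors _ _ _ _ _ sD (energy_form_domain mU bc)
   (mass_form_domain mU bc) m t s p).
  move=> a; split; [by have [] := Hu a|exact: Dp|].
  by move=> w Dw; have [_ H] := Hg a; exact: H.
move=> c /=; set x := \sum_i _ => b0 a.
have Dx : in_form_domain bc U x by exact: subspace_sum.
have [x2 _ _] := H1_of_domain Dx.
apply: free; have := (L2dot_eq0P mU x2).1 b0; apply: filterS => y H Uy.
by have := H Uy; rewrite /x fst_sum.
Qed.

(** The abstract spectral theorem turns a trial space into an orthonormal system of
    eigenfunctions, and orthonormal functions are linearly independent almost
    everywhere. *)
Lemma count_of_trial_space (U : set 'rV[R]_n) m t : domain U ->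
  has_trial_space U m t -> eigenvalue_count_ge bc U m t.
Proof.
move=> dU tr; have [oU _ _] := dU; have mU := open_measurable_rV oU.
have sD := domain_subspace mU bc.
have fa := energy_form_domain mU bc; have fb := mass_form_domain mU bc.
have [s [u [es sC]]] := exists_eigensystem sD fa fb (domain_complete mU (bc := bc))
  (domain_compact bc dU) tr.
have [Du ev orth _] := es.
exists s, (fun a => (u a).1); split.
  move=> a; split=> //; exists (u a).2; first exact: Du.
  by move=> v h Dvh; exact: (ev a (v, h)).
move=> c H a; pose x := \sum_i c i *: u i.
have Dx : in_form_domain bc U x by exact: subspace_sum.
have [x2 _ _] := H1_of_domain Dx.
have b0 : mass U x x = 0.
  apply/(L2dot_eq0P mU x2); apply: filterS H => y H Uy.
  by rewrite fst_sum H.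
have := form_CauchySchwarz sD fb (Du a) Dx.
rewrite b0 mulr0 (eigensystem_coord sD fb es) => c2.
by apply/eqP; rewrite -sqrf_eq0 eq_le c2 sqr_ge0.
Qed.

Lemma trial_space_vector (U : set 'rV[R]_n) m C : measurable U -> has_trial_space U m.+1 C ->
  exists x, [/\ in_form_domain bc U x, 0 < mass U x x & energy U x x <= C * mass U x x].
Proof.
move=> mU tr; have sD := domain_subspace mU bc.
have f0 (j : 'I_m) : functional_on (in_form_domain bc U) (fun=> 0 : R).
  by move=> c x y _ _; rewrite mulr0 addr0.
have [x [Dx _ b0 le]] := trial_space_meet sD (mass_form_domain mU bc) f0 tr.
by exists x.
Qed.

Lemma trial_space_ge0 (U : set 'rV[R]_n) m C : measurable U -> has_trial_space U m.+1 C -> 0 <= C.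
Proof.
move=> mU /(trial_space_vector mU)[x [_ b0 le]].
by have := le_trans (energy_ge0 U x) le; rewrite pmulr_lge0.
Qed.

Lemma nth_eigenvalue_le (U : set 'rV[R]_n) m C : domain U ->
  has_trial_space U m.+1 C -> nth_eigenvalue bc U m.+1 <= C.
Proof.
move=> dU tr; apply: ge_inf; last exact: count_of_trial_space.
have [oU _ _] := dU; have mU := open_measurable_rV oU.
by exists 0 => t /= /(trial_space_of_count mU); exact: trial_space_ge0.
Qed.

Lemma no_trial_space (U : set 'rV[R]_n) m C : domain U ->
  C < nth_eigenvalue bc U m.+1 -> ~ has_trial_space U m.+1 C.
Proof. by move=> dU lt /(nth_eigenvalue_le dU); rewrite leNgt lt. Qed.

(** The existence of a trial space is required because the infimum of the empty set
    is 0 by convention. *)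
Lemma nth_eigenvalue_ge (U : set 'rV[R]_n) m C T : domain U -> has_trial_space U m C ->
  (forall t, has_trial_space U m t -> T <= t) -> T <= nth_eigenvalue bc U m.
Proof.
move=> dU tr H; have [oU _ _] := dU; have mU := open_measurable_rV oU.
apply: lb_le_inf; first by exists C; exact: count_of_trial_space.
by move=> t /= /(trial_space_of_count mU); exact: H.
Qed.

Lemma nth_eigenvalue_lt (U : set 'rV[R]_n) m C tau : domain U -> has_trial_space U m C ->
  nth_eigenvalue bc U m < tau -> exists2 t, t < tau & has_trial_space U m t.
Proof.
move=> dU tr lt; have [oU _ _] := dU; have mU := open_measurable_rV oU.
apply: contrapT => no; move: lt; apply/negP; rewrite -leNgt.
apply: (nth_eigenvalue_ge dU tr) => t trt; rewrite leNgt; apply/negP => ltt.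
by apply: no; exists t.
Qed.

End spectrum.

(** * Direct sums of trial spaces *)

Section direct_sums.
Context {R : realType} {V : lmodType R} (D : V -> Prop) (a b : V -> V -> R).
Hypotheses (sD : subspace_on D) (fa : form_on D a) (fb : form_on D b).

Lemma form_sum_orthogonal f (I : finType) (x : I -> V) : form_on D f ->
  (forall i, D (x i)) -> (forall i j, i != j -> f (x i) (x j) = 0) ->
  f (\sum_i x i) (\sum_i x i) = \sum_i f (x i) (x i).
Proof.
move=> ff Dx orth; have [_ _ fl] := ff.
have E : \sum_i x i = \sum_i 1 *: x i by apply: eq_bigr => i _; rewrite scale1r.
have Ds : D (\sum_i x i) by rewrite E; exact: subspace_sum.
rewrite {1}E (functional_sum sD (fl _ Ds))//; apply: eq_bigr => i _.
rewrite mul1r E (functional_sum sD (form_funr ff (Dx i)))// (bigD1 i)//= mul1r.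
by rewrite big1 ?addr0// => j ji; rewrite mul1r orth// eq_sym.
Qed.

Lemma trial_space_fin (T : finType) m C (v : T -> V) : #|T| = m -> (forall t, D (v t)) ->
  (forall c : T -> R, let x := \sum_t c t *: v t in
    a x x <= C * b x x /\ (b x x = 0 -> forall t, c t = 0)) ->
  trial_space D a b m C.
Proof.
move=> <- Dv H; exists (fun i => v (enum_val i)); split=> [i //|c].
have E : \sum_i c i *: v (enum_val i) = \sum_t c (enum_rank t) *: v t.
  rewrite (reindex (@enum_val T predT))/=; last exact/onW_bij/enum_val_bij.
  by apply: eq_bigr => i _; rewrite enum_valK.
rewrite /= E; have [h1 h2] := H (fun t => c (enum_rank t)); split=> // /h2 h3 i.
by have := h3 (enum_val i); rewrite enum_valK.
Qed.

(** Mutually orthogonal trial spaces with a common level: both forms split into the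
    sum of their restrictions. *)
Lemma trial_space_direct_sum p (d : 'I_p -> nat) C (v : forall j : 'I_p, 'I_(d j) -> V) :
  (forall j l, D (v j l)) ->
  (forall j (c : 'I_(d j) -> R), let x := \sum_l c l *: v j l in
    a x x <= C * b x x /\ (b x x = 0 -> forall l, c l = 0)) ->
  (forall j k l l', j != k -> a (v j l) (v k l') = 0 /\ b (v j l) (v k l') = 0) ->
  trial_space D a b (\sum_j d j) C.
Proof.
move=> Dv H orth.
apply: (@trial_space_fin {j : 'I_p & 'I_(d j)} _ _ (fun t => v (tag t) (tagged t))).
- rewrite card_tagged sumnE big_map big_enum/=; apply: eq_bigr => j _; exact: card_ord.
- by move=> t; exact: Dv.
move=> c; pose x j := \sum_(l < d j) c (Tagged (fun j => 'I_(d j)) l) *: v j l.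
have -> : \sum_t c t *: v (tag t) (tagged t) = \sum_j x j.
  by rewrite /x sig_big_dep/=; apply: eq_bigr => -[j l] _.
have Dx j : D (x j) by exact: subspace_sum.
have ox f : form_on D f -> (forall j k l l', j != k -> f (v j l) (v k l') = 0) ->
    f (\sum_j x j) (\sum_j x j) = \sum_j f (x j) (x j).
  move=> ff of_; apply: form_sum_orthogonal => // j k jk; have [_ _ fl] := ff.
  rewrite /x (functional_sum sD (fl _ (Dx k)))// big1// => l _.
  rewrite (functional_sum sD (form_funr ff (Dv j l)))// big1 ?mulr0// => l' _.
  by rewrite of_ ?mulr0.
rewrite /= (ox a)//; last by move=> j k l l' /orth -/(_ l l')[].
rewrite (ox b)//; last by move=> j k l l' /orth -/(_ l l')[].
split.
  by rewrite mulr_sumr; apply: ler_sum => j _; have [] := H j (fun l => c (Tagged _ l)).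
move=> /eqP; rewrite psumr_eq0; last by move=> j _; exact: (form_ge0 fb).
move=> /allP b0 [j l]; have [_ h] := H j (fun l => c (Tagged _ l)).
by apply: h; apply/eqP; apply: (implyP (b0 j _)); rewrite ?mem_index_enum.
Qed.

End direct_sums.

Section infinite_dimension.
Context (R : realType) (n : nat).

Lemma smooth_pair_domain bc (U : set 'rV[R]_n) phi : measurable U -> test_function U phi ->
  in_form_domain bc U (smooth_pair phi).
Proof.
move=> mU tphi; have Hp := smooth_pair_H1 mU tphi; case: bc => //.
apply/H1_0P; split=> // e e0; exists phi => //; rewrite subrr.
have z f : form_on (in_form_domain Neumann U) f -> f 0 0 = 0.
  by move=> [_ _ fl]; exact: (functional0 (H1_subspace mU) (fl 0 (proj1 (H1_subspace mU)))).
by rewrite (z _ (energy_form mU)) (z _ (mass_form mU)) addr0 ltW.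
Qed.

(** A bump is positive on a box of positive measure. *)
Lemma mass_bump_gt0 (U : set 'rV[R]_n) c (a b : 'I_n -> R) : measurable U ->
  0 < c -> closed_box a b `<=` U -> (forall i, a i < b i) ->
  0 < mass U (smooth_pair (bump c a b)) (smooth_pair (bump c a b)).
Proof.
move=> mU c0 abU ab; rewrite lt_def mass_ge0 andbT; apply/eqP.
have tb : test_function U (bump c a b) by exact: test_bump.
move=> /(L2dot_eq0P mU (test_L2 mU tb))[N [mN N0 HN]].
have sub : open_box a b `<=` N.
  move=> x abx; apply: HN => /= H.
  have Ux : U x by apply: abU => i; have := abx i; rewrite /= !in_itv/= => /andP[? ?]; rewrite !ltW.
  by have := bump_gt0 c abx; rewrite (H Ux) ltxx.
have := le_measure (lebesgue_rV R n) (mem_set (measurable_open_box a b)) (mem_set mN) sub.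
rewrite [X in (_ <= X)%E]N0 [X in (X <= _)%E](lebesgue_open_box a b) lee_fin leNgt => /negP; apply.
by apply: prodr_gt0 => i _; rewrite lt_max subr_gt0 ab.
Qed.

(** Bumps supported in [m] disjoint boxes along the diagonal of a small cube: the
    forms are diagonal on their span. *)
Lemma exists_trial_space bc (U : set 'rV[R]_n) m : (0 < n)%N -> open U -> U !=set0 ->
  exists C, has_trial_space bc U m C.
Proof.
move=> n0 oU [x0 Ux0]; have mU := open_measurable_rV oU.
have /nbhs_ballP[e /= e0 eU] := oU x0 Ux0.
pose d := e / (4 * m.+1%:R); have d0 : 0 < d by rewrite divr_gt0// mulr_gt0.
have dm (j : nat) : (j < m)%N -> (j.*2.+1)%:R * d < e.
  move=> jm; rewrite /d mulrCA gtr_pMr// ltr_pdivrMr ?mulr_gt0// mul1r -natrM ltr_nat.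
  by rewrite -addnn; lia.
(* consecutive boxes are separated by a gap, so that even their closures are
   disjoint *)
pose lo (j : 'I_m) (i : 'I_n) := x0 ord0 i + j.*2%:R * d.
pose hi (j : 'I_m) (i : 'I_n) := x0 ord0 i + j.*2.+1%:R * d.
have lohi j i : lo j i < hi j i by rewrite ltrD2l ltr_pM2r// ltr_nat.
have boxU j : closed_box (lo j) (hi j) `<=` U.
  move=> x Bx; apply: eU; rewrite ball_rV// => i; have := Bx i.
  rewrite /= in_itv/= /lo /hi => /andP[h1 h2].
  have := dm j (ltn_ord j) => h3; have : 0 <= j.*2%:R * d by rewrite mulr_ge0// ltW.
  by rewrite ltr_norml => h4; apply/andP; split; lra.
pose phi j := bump 1 (lo j) (hi j).
have tphi j : test_function (closed_box (lo j) (hi j)) (phi j) by exact: test_bump.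
have tU j : test_function U (phi j) by exact: testW (tphi j).
have dis j k x : j != k -> closed_box (lo j) (hi j) x -> ~ closed_box (lo k) (hi k) x.
  move=> jk /(_ (Ordinal n0)) + /(_ (Ordinal n0)).
  rewrite /= !in_itv/= /lo /hi => /andP[h1 h2] /andP[h3 h4].
  have h5 : j.*2%:R * d <= k.*2.+1%:R * d by lra.
  have h6 : k.*2%:R * d <= j.*2.+1%:R * d by lra.
  move: h5 h6; rewrite !ler_pM2r// !ler_nat => h5 h6.
  move: jk; rewrite -val_eqE/= => jk; move: h5 h6 jk; rewrite -!addnn; lia.
have dot0 (f g : 'rV[R]_n -> R) j k : j != k -> test_function (closed_box (lo j) (hi j)) f ->
    test_function (closed_box (lo k) (hi k)) g -> L2dot U f g = 0.
  move=> jk tf tg; rewrite /L2dot (@eq_Rintegral _ _ _ _ _ (cst 0)); last first.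
    move=> x _ /=; have [jx|jx] := pselect (closed_box (lo j) (hi j) x).
      by rewrite (test_out tg) ?mulr0//; exact: (dis j k).
    by rewrite (test_out tf) ?mul0r.
  by rewrite /Rintegral integral0.
pose b j := mass U (smooth_pair (phi j)) (smooth_pair (phi j)).
pose a j := energy U (smooth_pair (phi j)) (smooth_pair (phi j)).
have b0 j : 0 < b j by exact: mass_bump_gt0.
exists (\sum_j a j / b j); set C := \sum_j a j / b j.
suff : has_trial_space bc U (\sum_(j < m) 1)%N C by rewrite sum1_card card_ord.
apply: (trial_space_direct_sum (domain_subspace mU bc) (energy_form_domain mU bc)
  (mass_form_domain mU bc) (v := fun j _ => smooth_pair (phi j))).
- by move=> j _; exact: smooth_pair_domain.
- move=> j c /=; rewrite big_ord1.
  have Dj : in_form_domain bc U (smooth_pair (phi j)) by exact: smooth_pair_domain.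
  rewrite (formZZ (domain_subspace mU bc) (energy_form_domain mU bc) _ Dj).
  rewrite (formZZ (domain_subspace mU bc) (mass_form_domain mU bc) _ Dj).
  rewrite -/(a j) -/(b j); split.
    rewrite mulrCA ler_wpM2l ?sqr_ge0// -ler_pdivrMr// /C (bigD1 j)//= lerDl.
    apply: sumr_ge0 => k _; apply: divr_ge0; [exact: energy_ge0|exact: ltW].
  by move=> /eqP; rewrite mulf_eq0 (gt_eqF (b0 j)) orbF sqrf_eq0 => /eqP c0 l; rewrite ord1.
- move=> j k _ _ jk; split; last exact: (dot0 _ _ j k).
  rewrite /energy big1// => i _; apply: (dot0 _ _ j k jk); exact: test_partial.
Qed.

End infinite_dimension.

(** * A lower bound of Faber-Krahn type *)

Section faber_krahn.
Context (R : realType) (n : nat).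
Local Notation mu := (lebesgue_rV R n).

(** An explicit constant that suffices; it is not the optimal one. *)
Definition faber_krahn_constant : R := 8 * (2 ^+ n * n%:R).

(** Use the grid of cubes of side 2, whose volume is at least twice that of [U]: by
    the Cauchy-Schwarz inequality the mean values of the zero extension account for
    at most half of the mass. *)
Lemma faber_krahn (U : set 'rV[R]_n) p : (0 < n)%N -> open U -> bounded_set U ->
  (mu U <= 1)%E -> in_form_domain Dirichlet U p ->
  mass U p p <= faber_krahn_constant * energy U p p.
Proof.
move=> n0 oU bU U1 Dp; have mU := open_measurable_rV oU.
have [r r0 Ur] := bounded_radius bU.
have [N rN] := exists_grid_size r (ltr0n R 2).
have := dirichlet_grid_inequality (ltr0n R 2) rN oU Ur Dp.
have [[u2 _ _] _] := Dp.
set S := \sum_k _ => H.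
have mk (k : {ffun 'I_n -> 'I_N}) : measurable (grid_cube r 2 k `&` U).
  by apply: measurableI => //; exact: measurable_grid_cube.
have S2 : S <= mass U p p / 2.
  apply: (@le_trans _ _ (\sum_(k : {ffun 'I_n -> 'I_N})
      L2dot (grid_cube r 2 k `&` U) p.1 p.1 / 2)); last first.
    rewrite -mulr_suml ler_wpM2r//; apply: L2dot_sum_disjoint => //.
    move=> k l _ _ [x [[kx _] [lx _]]].
    by apply: (@grid_cube_trivIset R n r 2 _ N setT) => //; exists x.
  apply: ler_sum => k _.
  have kU : grid_cube r 2 k `&` U `<=` U by [].
  have -> : L2dot (grid_cube r 2 k) (p.1 \_ U) (cst 1) =
      L2dot (grid_cube r 2 k `&` U) p.1 (cst 1).
    rewrite -(@L2dot_extl _ _ (grid_cube r 2 k) (grid_cube r 2 k `&` U)) //; apply: L2dot_eq => // x kx.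
    by rewrite !patchE in_setI (mem_set kx).
  (* the part of U in one cube has measure at most 1, and the cube has measure 2 ^ n *)
  have [m muk m1] : exists2 m, mu (grid_cube r 2 k `&` U) = m%:E & m <= 1.
    have le1 : (mu (grid_cube r 2 k `&` U) <= 1)%E.
      apply: le_trans U1; apply: le_measure => //; exact/mem_set.
    exists (fine (mu (grid_cube r 2 k `&` U))).
      by rewrite fineK// ge0_fin_numE// (le_lt_trans le1)// ltry.
    by rewrite -lee_fin fineK// ge0_fin_numE// (le_lt_trans le1)// ltry.
  have [L1 E1] := L2_cst_finite (mk k) muk.
  have ge := L2dot_ge0 (grid_cube r 2 k `&` U) p.1.
  have := form_CauchySchwarz (L2_subspace (mk k)) (L2_form (mk k)) (L2_restr mU (mk k) kU u2) L1.
  rewrite E1 => cs; rewrite ler_pdivrMr ?exprn_gt0// mulrAC ler_pdivlMr//.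
  have n2 : 2 <= 2 ^+ n :> R.
    by rewrite -natrX ler_nat -[X in (X <= _)%N]expn1 leq_exp2l.
  apply: le_trans (_ : L2dot (grid_cube r 2 k `&` U) p.1 p.1 * 2 <= _).
    by rewrite ler_wpM2r//; apply: le_trans cs _; rewrite ler_piMr.
  by rewrite ler_wpM2l.
have m0 := mass_ge0 U p; have e0 := energy_ge0 U p.
move: H S2; rewrite /faber_krahn_constant.
move: (mass U p p) (energy U p p) S (2 ^+ n * n%:R) => m e s K; lra.
Qed.

End faber_krahn.

(** * The unit cube *)

Section orthogonal_completion.
Context (R : realType) (n : nat).

(** The Householder reflection that exchanges [w] with a basis vector. *)
Lemma exists_orthogonal_column (w : 'cV[R]_n) (i : 'I_n) : \sum_j w j ord0 ^+ 2 = 1 ->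
  exists2 Q : 'M[R]_n, Q *m Q^T = 1%:M & forall j, Q j i = w j ord0.
Proof.
move=> w1; pose d : 'cV[R]_n := delta_mx i ord0.
have [wd|wd] := eqVneq w d.
  exists 1%:M; first by rewrite trmx1 mulmx1.
  by move=> j; rewrite wd !mxE eqxx andbT.
have [v vE] : exists v : 'cV[R]_n, forall j, v j ord0 = (j == i)%:R - w j ord0.
  by exists (d - w) => j; rewrite !mxE eqxx andbT.
pose q := \sum_j v j ord0 ^+ 2.
have qE : q = 2 * v i ord0.
  rewrite vE eqxx /q (eq_bigr (fun j => ((j == i)%:R - 2 * ((j == i)%:R * w j ord0)) + w j ord0 ^+ 2)).
    rewrite big_split/= w1 sumrB -mulr_sumr.
    rewrite (bigD1 i)//= eqxx big1; last by move=> j /negbTE ->.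
    rewrite [X in 2 * X](bigD1 i)//= eqxx big1; last by move=> j /negbTE ->; rewrite mul0r.
    by rewrite /=; ring.
  by move=> j _; rewrite vE; case: (j == i) => /=; ring.
have q0 : q != 0.
  apply: contra wd; rewrite psumr_eq0; last by move=> j _; exact: sqr_ge0.
  move=> /allP H; apply/eqP/matrixP => j k; rewrite ord1.
  have := H j (mem_index_enum j); rewrite sqrf_eq0 vE subr_eq0 => /eqP E.
  by rewrite -E mxE eqxx andbT.
pose c := 2 / q.
have cv : c * v i ord0 = 1 by rewrite /c qE; field; move: q0; rewrite qE mulf_eq0 negb_or => /andP[].
have vv : v^T *m v = q%:M.
  apply/matrixP => a b; rewrite !ord1 !mxE eqxx mulr1n /q; apply: eq_bigr => j _.
  by rewrite mxE expr2.
pose Q := 1%:M - c *: (v *m v^T).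
have QT : Q^T = Q by rewrite /Q raddfB/= trmx1 linearZ/= trmx_mul trmxK.
exists Q; last first.
  move=> j; have -> : Q j i = (j == i)%:R - c * (v j ord0 * v i ord0).
    by rewrite /Q !mxE big_ord1 [v^T _ _]mxE.
  by rewrite mulrCA cv mulr1 vE opprB addrC subrK.
pose B := v *m v^T.
have BB : B *m B = q *: B.
  by rewrite /B -mulmxA [v^T *m _]mulmxA vv mul_scalar_mx -scalemxAr.
rewrite QT /Q -/B mulmxBl mul1mx mulmxBr mulmx1 -scalemxAl -scalemxAr BB !scalerA.
have -> : c * c * q = 2 * c by rewrite /c; field.
by apply/matrixP => a b; rewrite !mxE; ring.
Qed.

End orthogonal_completion.

Section unit_cube.
Context (R : realType) (n : nat).

Definition unit_cube : set 'rV[R]_n.+1 := open_box (fun=> 0) (fun=> 1).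

Lemma unit_cube_ball : unit_cube = ball (\row__ (2^-1 : R)) 2^-1.
Proof.
have h20 : 0 < 2^-1 :> R by rewrite invr_gt0.
apply/seteqP; split=> x.
  move=> H; apply/(ball_rV _ _ h20) => i; have := H i; rewrite /= in_itv/= !mxE ltr_norml => /andP[h1 h2].
  by apply/andP; split; lra.
move=> /(ball_rV _ _ h20) H i; have := H i; rewrite /= in_itv/= !mxE ltr_norml => /andP[h1 h2].
by apply/andP; split; lra.
Qed.

Lemma open_unit_cube : open unit_cube.
Proof. by rewrite unit_cube_ball; exact: ball_open. Qed.

Lemma lebesgue_unit_cube : lebesgue_rV R n.+1 unit_cube = 1%E.
Proof.
rewrite [LHS]lebesgue_open_box; congr (_%:E); apply: big1 => i _.
by rewrite subr0 max_l.
Qed.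

Lemma bounded_unit_cube : bounded_set unit_cube.
Proof.
exists 1; split=> // M M1 x Hx; apply: norm_le_coord; first exact: (le_trans ler01 (ltW M1)).
move=> i; have := Hx i; rewrite /= in_itv/= => /andP[h1 h2].
by rewrite ger0_norm ?(ltW h1)// (le_trans (ltW h2))// ltW.
Qed.

Lemma closure_unit_cube x : closure unit_cube x -> forall i, 0 <= x ord0 i <= 1.
Proof.
move=> cx i; have : closure (closed_box (fun=> 0) (fun=> 1)) x.
  apply: closure_subset cx => y Hy j; have := Hy j.
  by rewrite /= !in_itv/= => /andP[h1 h2]; rewrite !ltW.
rewrite -((closure_id _).1 (@closed_closed_box R n.+1 (fun=> 0) (fun=> 1))).
by move=> /(_ i); rewrite /= in_itv.
Qed.

Lemma bigmax_lipschitz m (I : finType) (P : pred I) (i1 : I) (f : I -> 'rV[R]_m -> R) (L : R) :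
  P i1 -> (forall i y z, f i y <= f i z + L * `|y - z|) ->
  L.-lipschitz (fun y => \big[Num.max/f i1 y]_(i | P i) f i y).
Proof.
move=> Pi1 Hf [y z] _ /=.
have key y' z' : \big[Num.max/f i1 y']_(i | P i) f i y' <=
    \big[Num.max/f i1 z']_(i | P i) f i z' + L * `|y' - z'|.
  apply/bigmax_leP; split.
    by apply: le_trans (Hf _ _ z') _; rewrite lerD2r; exact: le_bigmax_cond.
  by move=> i Pi; apply: le_trans (Hf _ _ z') _; rewrite lerD2r; exact: le_bigmax_cond.
rewrite ler_norml; have := key y z; have := key z y; rewrite distrC => h1 h2.
by apply/andP; split; lra.
Qed.

(** Near a boundary point the cube is the cone given by the active constraints. In
    orthonormal coordinates whose last axis points along the diagonal of the active
    faces, each active constraint bounds the last coordinate below by an affine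
    function of the others, and the graph is that of their maximum. *)
Lemma unit_cube_lipschitz : lipschitz_boundary unit_cube.
Proof.
move=> x0 cx nx; have x01 := closure_unit_cube cx.
have {}nx : ~ unit_cube x0 by move=> Cx; apply: nx; exact: (open_unit_cube Cx).
pose P (i : 'I_n.+1) := (x0 ord0 i == 0) || (x0 ord0 i == 1).
(* the inward normal of an active face is plus or minus a basis vector *)
pose sg (i : 'I_n.+1) : R := if x0 ord0 i == 0 then 1 else -1.
have [i1 Pi1] : exists i1, P i1.
  apply: contrapT => no; apply: nx => i; rewrite /= in_itv/=.
  have /andP[h1 h2] := x01 i; rewrite !lt_def h1 h2 !andbT.
  apply/andP; split; apply/negP => h; apply: no; exists i; rewrite /P ?h ?orbT//.
  by rewrite (eq_sym (x0 ord0 i) 1) h orbT.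
have sg2 i : sg i ^+ 2 = 1 by rewrite /sg; case: ifP; rewrite ?sqrrN expr1n.
pose k : R := \sum_(i | P i) 1.
have k0 : 0 < k by rewrite /k (bigD1 i1)//= ltr_wpDr// sumr_ge0.
pose s := Num.sqrt k; have s0 : 0 < s by rewrite sqrtr_gt0.
have s2 : s ^+ 2 = k by rewrite sqr_sqrtr// ltW.
pose w : 'cV[R]_n.+1 := \col_i (if P i then sg i / s else 0).
have w1 : \sum_j w j ord0 ^+ 2 = 1.
  rewrite (eq_bigr (fun j => if P j then k^-1 else 0)); last first.
    by move=> j _; rewrite mxE; case: ifP => _; rewrite ?expr0n// exprMn sg2 mul1r exprVn s2.
  rewrite -big_mkcond/= -[LHS]mulr1 (eq_bigr (fun=> 1 * k^-1)); last by move=> *; rewrite mul1r.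
  by rewrite -mulr_suml -/k mulr1 divff// gt_eqF.
have [Q oQ Qw] := exists_orthogonal_column ord0 w1.
(* the bound on the first chart coordinate given by the active face i *)
pose f (i : 'I_n.+1) (y : 'rV[R]_n) : R :=
  s * sg i * (x0 ord0 i - \sum_l y ord0 l * Q i (lift ord0 l)).
pose L : R := s * \sum_i \sum_l `|Q i (lift ord0 l)|.
exists Q, ord0, (fun y => \big[Num.max/f i1 y]_(i | P i) f i y), L; split=> //.
  apply: bigmax_lipschitz => // i y z; rewrite -lerBlDl; apply: le_trans (ler_norm _) _.
  have -> : f i y - f i z = s * sg i * \sum_l (z - y) ord0 l * Q i (lift ord0 l).
    rewrite (eq_bigr (fun l => z ord0 l * Q i (lift ord0 l) - y ord0 l * Q i (lift ord0 l))).
      by rewrite sumrB /f; ring.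
    by move=> l _; rewrite !mxE mulrBl.
  have nsg : `|sg i| = 1 by rewrite /sg; case: ifP; rewrite ?normrN normr1.
  rewrite !normrM nsg mulr1 gtr0_norm// /L -mulrA ler_wpM2l ?(ltW s0)//.
  apply: le_trans (ler_norm_sum _ _ _) _.
  apply: (@le_trans _ _ ((\sum_l `|Q i (lift ord0 l)|) * `|y - z|)).
    rewrite mulr_suml; apply: ler_sum => l _; rewrite normrM mulrC ler_wpM2l//.
    by rewrite distrC; exact: coord_le_norm.
  rewrite ler_wpM2r// (bigD1 i)//= lerDl; apply: sumr_ge0 => j _; exact: sumr_ge0.
have coord (x : 'rV[R]_n.+1) i : P i ->
    (0 < sg i * (x ord0 i - x0 ord0 i) <-> f i (col' ord0 (x *m Q)) < (x *m Q) ord0 ord0).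
  move=> Pi.
  have xE : x ord0 i = (x *m Q) ord0 ord0 * (sg i / s) +
      \sum_l (col' ord0 (x *m Q)) ord0 l * Q i (lift ord0 l).
    have -> : x ord0 i = (x *m Q *m Q^T) ord0 i by rewrite -mulmxA oQ mulmx1.
    rewrite mxE big_ord_recl/= [Q^T _ _]mxE Qw [w _ _]mxE Pi; congr (_ + _).
    by apply: eq_bigr => l _; rewrite [Q^T _ _]mxE; congr (_ * _); rewrite [RHS]mxE.
  rewrite /f; set S := \sum_l _ in xE *; set t := (x *m Q) ord0 ord0 in xE *.
  have -> : sg i * (x ord0 i - x0 ord0 i) = s^-1 * (t - s * sg i * (x0 ord0 i - S)).
    rewrite xE; have := sg2 i; move: (sg i) => g g2; have sn : s != 0 by rewrite gt_eqF.
    have -> : g * (t * (g / s) + S - x0 ord0 i) = g ^+ 2 * t / s + g * (S - x0 ord0 i) by ring.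
    by rewrite g2; field.
  by rewrite pmulr_rgt0 ?invr_gt0// subr_gt0.
(* inside this radius the inactive constraints remain satisfied *)
pose rho i := if P i then 1 else Num.min (x0 ord0 i) (1 - x0 ord0 i).
have rho0 i : 0 < rho i.
  rewrite /rho; case: ifPn => //; rewrite negb_or lt_min subr_gt0 => /andP[h1 h2].
  have /andP[h3 h4] := x01 i; rewrite !lt_def h1 h3/= h4 andbT eq_sym //.
pose r := \big[Num.min/1]_i rho i.
have r0 : 0 < r by apply/bigmin_gtP; split=> // i _; exact: rho0.
apply/nbhs_ballP; exists r => //= x /(ball_rV _ _ r0) Bx.
have near_i i : `|x0 ord0 i - x ord0 i| < rho i.
  by apply: lt_le_trans (Bx i) _; exact: bigmin_le.
have loc i : (x ord0 i \in `]0, 1[) <-> (P i -> 0 < sg i * (x ord0 i - x0 ord0 i)).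
  have := near_i i; rewrite /rho in_itv/= ltr_norml; case: ifPn => [Pi|nPi].
    move=> /andP[h1 h2]; split=> [/andP[a1 a2] _|/(_ isT)].
      move: Pi; rewrite /P /sg; case: eqP => [e _|_ /eqP e]; rewrite e in h1 h2 *; lra.
    by move: Pi; rewrite /P /sg; case: eqP => [e _|_ /eqP e]; rewrite e in h1 h2 *;
      move=> a; apply/andP; split; lra.
  rewrite lt_min => /andP[h1 /andP[h2 h3]].
  split=> // _; move: h1; rewrite ltrNl lt_min => /andP[h4 h5].
  by apply/andP; split; lra.
split=> [Ux|].
  apply/bigmax_ltP; split; first by apply/(coord _ _ Pi1)/(loc i1).1 => //; exact: Ux.
  by move=> i Pi; apply/(coord _ _ Pi)/(loc i).1 => //; exact: Ux.
move=> /bigmax_ltP[_ H] i; apply/(loc i).2 => Pi; apply/(coord _ _ Pi); exact: H.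
Qed.

Lemma unit_cube_domain : unit_domains R n.+1 unit_cube.
Proof.
split; last exact: lebesgue_unit_cube.
by split; [exact: open_unit_cube|exact: bounded_unit_cube|exact: unit_cube_lipschitz].
Qed.

Lemma unit_cube_poincare p : in_form_domain Neumann unit_cube p ->
  mass unit_cube p p <= L2dot unit_cube p.1 (cst 1) ^+ 2 +
    2 ^+ n.+1 * n.+1%:R * energy unit_cube p p.
Proof.
move=> Hp; have mC : measurable unit_cube by apply: measurable_open_box.
have := poincare_inequality open_unit_cube Hp mC (@subset_refl _ _) (eta := 1) ltr01.
rewrite expr1n divr1 expr1n mulr1; apply.
- move=> x y s Cx Cy /andP[s0 s1] i; have := Cx i; have := Cy i.
  rewrite /= !in_itv/= !mxE => /andP[a1 a2] /andP[b1 b2].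
  have -> : x ord0 i + s * (y ord0 i - x ord0 i) = (1 - s) * x ord0 i + s * y ord0 i by ring.
  move: (x ord0 i) (y ord0 i) a1 a2 b1 b2 => X Y a1 a2 b1 b2.
  have [->|s00] := eqVneq s 0; first by rewrite subr0 mul1r mul0r addr0 b1.
  have sp : 0 < s by rewrite lt_def s00.
  by apply/andP; split; nra.
- move=> x y i Cx Cy; have := Cx i; have := Cy i.
  rewrite /= !in_itv/= => /andP[a1 a2] /andP[b1 b2]; rewrite ler_norml.
  by apply/andP; split; lra.
- exact: lebesgue_unit_cube.
Qed.

End unit_cube.

(** * Scaling and translation *)

Section affine_test_functions.
Context (R : realType) (n : nat).

Lemma affineK (t : R) (z : 'rV[R]_n) : t != 0 ->
  cancel (affine t z) (affine t^-1 (- (t^-1 *: z))) /\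
  cancel (affine t^-1 (- (t^-1 *: z))) (affine t z).
Proof.
move=> t0; split=> x; rewrite /affine.
  by rewrite scalerDr scalerA mulVf// scale1r addrK.
by rewrite scalerDr scalerN !scalerA mulfV// !scale1r subrK.
Qed.

Lemma affine_preimage (t : R) (z : 'rV[R]_n) (K : set 'rV[R]_n) : t != 0 ->
  affine t z @^-1` K = affine t^-1 (- (t^-1 *: z)) @` K.
Proof.
move=> t0; have [AK KA] := affineK z t0; apply/seteqP; split=> x.
  by move=> Kx; exists (affine t z x) => //; exact: AK.
by move=> [y Ky <-] /=; rewrite KA.
Qed.

Lemma continuous_affine (t : R) (z : 'rV[R]_n) : continuous (affine t z).
Proof.
by move=> x; apply: continuousD; [exact: scaler_continuous | exact: cst_continuous].
Qed.

Lemma test_affine (t : R) (z : 'rV[R]_n) U f : t != 0 -> test_function U f ->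
  test_function (affine t z @^-1` U) (f \o affine t z).
Proof.
move=> t0 [sf cf fU].
have sub : support (f \o affine t z) `<=` affine t z @^-1` support f.
  apply: support_sub.
    apply: preimage_closed; [by move=> x _; exact: continuous_affine|exact: closed_support].
  by move=> x /= H; exact: support_out.
split.
- by have [] := smooth_affine t z sf.
- apply: (subclosed_compact _ _ sub); first exact: closed_support.
  rewrite affine_preimage//; apply: continuous_compact cf.
  exact/continuous_subspaceT/continuous_affine.
- by move=> x /sub; exact: fU.
Qed.

End affine_test_functions.

Section affine_forms.
Context (R : realType) (n : nat) (t : R) (z : 'rV[R]_n) (t0 : 0 < t).
Local Notation mu := (lebesgue_rV R n).
Local Notation A := (affine t z).
Local Notation pair := (('rV[R]_n -> R) * ('I_n -> 'rV[R]_n -> R))%type.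
Variables (U : set 'rV[R]_n) (mU : measurable U).
Let t1 : t != 0. Proof. by rewrite gt_eqF. Qed.

Let mP : measurable (A @^-1` U).
Proof. by rewrite -[X in measurable X]setTI; exact: measurable_affine. Qed.

Let int_sqr u : L2 U u ->
  (\int[mu]_(x in A @^-1` U) (u (A x) ^+ 2)%:E = (t ^+ n)^-1%:E * (L2dot U u u)%:E)%E.
Proof.
move=> u2; rewrite (L2dotE mU u2) [in RHS]integral_mkcond -(ge0_integral_affine z t0).
- rewrite integral_mkcond; apply: eq_integral => x _; rewrite !patchE.
  have -> : (x \in A @^-1` U) = (A x \in U) by apply/idP/idP => /set_mem H; exact/mem_set.
  by case: ifP.
- by apply: (measurable_restrictT _ mU).1; apply: measurable_sqr; exact: L2_measurable u2.
- by move=> x; rewrite patchE; case: ifP => // _; rewrite lee_fin sqr_ge0.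
Qed.

Lemma L2_affine u : L2 U u -> L2 (A @^-1` U) (u \o A).
Proof.
move=> u2; apply: L2P => //.
  have H : measurable_fun (A @^-1` U) ((u \_ U) \o A).
    apply: measurable_funTS; apply: measurableT_comp (measurable_affine t z).
    by apply/measurable_restrict => //; rewrite setTI; exact: L2_measurable u2.
  by apply: eq_measurable_fun H => x /set_mem Ux; rewrite /= patchE mem_set.
by rewrite [X in (X < _)%E]int_sqr// -EFinM ltry.
Qed.

(** By polarization, from the substitution rule for the integral of a square. *)
Lemma L2dot_affine u v : L2 U u -> L2 U v ->
  L2dot (A @^-1` U) (u \o A) (v \o A) = (t ^+ n)^-1 * L2dot U u v.
Proof.
have sqr w : L2 U w -> L2dot (A @^-1` U) (w \o A) (w \o A) = (t ^+ n)^-1 * L2dot U w w.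
  move=> w2; apply/EFin_inj; rewrite (L2dotE mP (L2_affine w2)) EFinM; exact: int_sqr.
move=> u2 v2; have sL := L2_subspace mU; have sP := L2_subspace mP.
have e1 := formD sL (L2_form mU) u2 v2.
have e2 := formD sP (L2_form mP) (L2_affine u2) (L2_affine v2).
have := sqr _ (L2D mU u2 v2).
have -> : (u + v) \o A = (u \o A) + (v \o A) by [].
rewrite e1 e2 !sqr// => H.
have {}H : 2 * L2dot (A @^-1` U) (u \o A) (v \o A) = 2 * ((t ^+ n)^-1 * L2dot U u v).
  by move: H; move: (_^-1) => c H; lra.
by apply: (mulfI _ H).
Qed.

(** The chain rule multiplies the gradient by [t]. *)
Definition affine_pair (p : pair) : pair := (p.1 \o A, fun i => t *: (p.2 i \o A)).

Lemma mass_affine p q : in_form_domain Neumann U p -> in_form_domain Neumann U q ->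
  mass (A @^-1` U) (affine_pair p) (affine_pair q) = (t ^+ n)^-1 * mass U p q.
Proof. by move=> [p2 _ _] [q2 _ _]; exact: L2dot_affine. Qed.

Lemma energy_affine p q : in_form_domain Neumann U p -> in_form_domain Neumann U q ->
  energy (A @^-1` U) (affine_pair p) (affine_pair q) = t ^+ 2 * ((t ^+ n)^-1 * energy U p q).
Proof.
move=> [_ p2 _] [_ q2 _]; rewrite /energy !mulr_sumr; apply: eq_bigr => i _.
rewrite -(L2dot_affine (p2 i) (q2 i)).
have [_ _ fl] := L2_form mP; have sP := L2_subspace mP.
have pa := L2_affine (p2 i); have qa := L2_affine (q2 i).
rewrite [LHS](functionalZ sP (fl _ (L2Z mP t qa)) t pa).
rewrite (L2dotC (A @^-1` U) (p.2 i \o A)).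
rewrite [X in t * X](functionalZ sP (fl _ pa) t qa) (L2dotC _ (q.2 i \o A)).
by rewrite expr2 mulrA.
Qed.

Lemma test_pullback phi : test_function (A @^-1` U) phi ->
  exists2 psi, test_function U psi & phi = psi \o A.
Proof.
move=> tphi; have [AK KA] := affineK z t1.
exists (phi \o affine t^-1 (- (t^-1 *: z))).
  have := test_affine (- (t^-1 *: z)) (invr_neq0 t1) tphi.
  by rewrite -comp_preimage (_ : A \o _ = id) ?preimage_id//; apply/funext => x; exact: KA.
by apply/funext => x /=; rewrite AK.
Qed.

Lemma H1_affine p : in_form_domain Neumann U p ->
  in_form_domain Neumann (A @^-1` U) (affine_pair p).
Proof.
move=> [u2 g2 wg]; split=> [|i|phi /test_pullback[psi tpsi ->] i].
- exact: L2_affine.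
- by apply: L2Z => //; exact: L2_affine.
have [spsi _ _] := tpsi; have [_ /(_ i) ->] := smooth_affine t z spsi.
have psi2 := test_L2 mU tpsi; have dpsi2 := test_L2 mU (test_partial i tpsi).
have [_ _ fl] := L2_form mP; have sP := L2_subspace mP.
rewrite /affine_pair/=.
rewrite (_ : (fun x => t * partial i psi (A x)) = t *: (partial i psi \o A))//.
rewrite (L2dotC (A @^-1` U) (p.1 \o A)).
rewrite [LHS](functionalZ sP (fl _ (L2_affine u2)) t (L2_affine dpsi2)).
rewrite [X in - X](functionalZ sP (fl _ (L2_affine psi2)) t (L2_affine (g2 i))).
by rewrite L2dotC !L2dot_affine// wg// !mulrN.
Qed.

Lemma affine_pair_sub_smooth p phi : smooth phi ->
  affine_pair p - smooth_pair (phi \o A) = affine_pair (p - smooth_pair phi).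
Proof.
move=> sphi; have [_ dphi] := smooth_affine t z sphi.
congr (_, _); apply/funext => i.
change (t *: (p.2 i \o A) - partial i (phi \o A) = t *: ((p.2 i - partial i phi) \o A)).
by rewrite dphi; apply/funext => x; exact: (esym (mulrBr t _ _)).
Qed.

Lemma domain_affine bc p : in_form_domain bc U p ->
  in_form_domain bc (A @^-1` U) (affine_pair p).
Proof.
case: bc; last exact: H1_affine.
move=> /H1_0P[Hp Ap]; apply/H1_0P; split; first exact: H1_affine.
move=> e e0; have c0 : 0 < (1 + t ^+ 2) * (t ^+ n)^-1.
  by rewrite mulr_gt0 ?invr_gt0 ?exprn_gt0// ltr_wpDr ?sqr_ge0.
have [phi tphi H] := Ap _ (divr_gt0 e0 c0); have [sphi _ _] := tphi.
exists (phi \o A); first exact: test_affine.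
have HX : in_form_domain Neumann U (p - smooth_pair phi).
  by apply: (subspaceB (H1_subspace mU) Hp); exact: smooth_pair_H1.
rewrite affine_pair_sub_smooth// energy_affine// mass_affine//.
move: H; rewrite ler_pdivlMr// => H; apply: le_trans H.
have := mass_ge0 U (p - smooth_pair phi); have := energy_ge0 U (p - smooth_pair phi).
have : 0 < (t ^+ n)^-1 by rewrite invr_gt0 exprn_gt0.
have := sqr_ge0 t.
move: (mass U _ _) (energy U _ _) (_^-1) (t ^+ 2) => m e' c d d0 c1 e1 m1.
have := mulr_ge0 (ltW c1) m1; have := mulr_ge0 (ltW c1) e1.
have := mulr_ge0 d0 (mulr_ge0 (ltW c1) m1); lra.
Qed.

Lemma trial_space_affine bc m C : has_trial_space bc U m C ->
  has_trial_space bc (A @^-1` U) m (t ^+ 2 * C).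
Proof.
move=> [v [Dv H]]; exists (fun i => affine_pair (v i)); split.
  by move=> i; exact: domain_affine.
move=> c; have {H} := H c; set x := \sum_i _ => -[h1 h2].
have -> : \sum_i c i *: affine_pair (v i) = affine_pair x.
  have lin (d : R) p q : affine_pair (d *: p + q) = d *: affine_pair p + affine_pair q.
    congr (_, _); apply/funext => i; apply/funext => y.
    rewrite /= -[LHS]/(t * (d * p.2 i (A y) + q.2 i (A y))).
    by rewrite -[RHS]/(d * (t * p.2 i (A y)) + t * q.2 i (A y)); ring.
  have a0 : affine_pair 0 = 0.
    by have := lin (-1) 0 0; rewrite scaler0 addr0 scaleN1r addNr.
  rewrite /x; elim: (index_enum _) => [|i s IH]; first by rewrite !big_nil a0.
  by rewrite !big_cons IH lin.
have Dx : in_form_domain Neumann U x.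
  have Dx : in_form_domain bc U x by apply: (subspace_sum (domain_subspace mU bc)).
  exact: H1_of_domain Dx.
have c0 : 0 < (t ^+ n)^-1 by rewrite invr_gt0 exprn_gt0.
rewrite /= mass_affine// energy_affine//; split.
  by rewrite -mulrA ler_wpM2l ?sqr_ge0// mulrCA ler_wpM2l// ltW.
by move=> /eqP; rewrite mulf_eq0 (gt_eqF c0)/= => /eqP; exact: h2.
Qed.

End affine_forms.

Section affine_domains.
Context (R : realType) (n : nat) (t : R) (z : 'rV[R]_n) (t0 : 0 < t).
Local Notation A := (affine t z).
Variable U : set 'rV[R]_n.

Let t1 : t != 0. Proof. by rewrite gt_eqF. Qed.

Lemma domain_affine_preimage : domain U -> domain (A @^-1` U).
Proof.
move=> [oU bU lU]; split.
- by apply: open_comp => // x _; exact: continuous_affine.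
- have [r r0 Ur] := bounded_radius bU.
  exists (t^-1 * (r + `|z|)); split; first exact: num_real.
  move=> M HM x /= Ux; apply: le_trans (ltW HM).
  rewrite -[x]scale1r -(mulVf t1) -scalerA normrZ gtr0_norm ?invr_gt0//.
  rewrite ler_wpM2l ?invr_ge0 ?(ltW t0)//.
  have -> : t *: x = A x - z by rewrite /affine addrK.
  by apply: le_trans (ler_normB _ _) _; rewrite lerD2r ltW// Ur.
- move=> x0 cx nx.
  have cA : closure U (A x0).
    move=> B nB; have := cx (A @^-1` B) (@continuous_affine _ _ t z x0 _ nB).
    by move=> [y [Uy By]]; exists (A y).
  have nA : ~ U° (A x0).
    by move=> iA; apply: nx; exact: (@continuous_affine _ _ t z x0 _ iA).
  have [Q [i [gamma [L [oQ lg near_x]]]]] := lU _ cA nA.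
  exists Q, i, (fun y => t^-1 * (gamma (t *: y + col' i (z *m Q)) - (z *m Q) ord0 i)), L.
  split=> //.
    move=> [y1 y2] _ /=.
    have E (a b c : R) : t^-1 * (a - c) - t^-1 * (b - c) = t^-1 * (a - b) by ring.
    rewrite E normrM gtr0_norm ?invr_gt0// ler_pdivrMl//.
    have := lg (t *: y1 + col' i (z *m Q), t *: y2 + col' i (z *m Q)) (conj I I).
    move=> /= /le_trans; apply; rewrite opprD addrACA subrr addr0 -scalerBr normrZ.
    by rewrite gtr0_norm// mulrCA.
  have near_x' : \forall x \near x0, U (A x) <->
      gamma (col' i (A x *m Q)) < (A x *m Q) ord0 i.
    exact: (@continuous_affine _ _ t z x0 _ near_x).
  apply: filterS near_x' => x H.
  suff -> : (t^-1 * (gamma (t *: col' i (x *m Q) + col' i (z *m Q)) - (z *m Q) ord0 i) <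
      (x *m Q) ord0 i) = (gamma (col' i (A x *m Q)) < (A x *m Q) ord0 i) by exact: H.
  have -> : A x *m Q = t *: (x *m Q) + z *m Q by rewrite /affine mulmxDl scalemxAl.
  have -> : col' i (t *: (x *m Q) + z *m Q) = t *: col' i (x *m Q) + col' i (z *m Q).
    by apply/rowP => j; rewrite !mxE.
  have -> : (t *: (x *m Q) + z *m Q) ord0 i = t * (x *m Q) ord0 i + (z *m Q) ord0 i.
    by rewrite [LHS]mxE [X in X + _]mxE.
  by rewrite ltr_pdivrMl// ltrBlDr.
Qed.

(** A trial space on [U] is carried to one on the preimage, with the level
    multiplied by [t ^ 2], and back by the inverse map. *)
Lemma nth_eigenvalue_affine bc m C : domain U -> has_trial_space bc U m.+1 C ->
  nth_eigenvalue bc (A @^-1` U) m.+1 = t ^+ 2 * nth_eigenvalue bc U m.+1.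
Proof.
move=> dU tr; have dP := domain_affine_preimage dU.
have mU : measurable U by have [oU _ _] := dU; exact: open_measurable_rV.
have mP : measurable (A @^-1` U) by have [oU _ _] := dP; exact: open_measurable_rV.
have t2 : 0 < t ^+ 2 by exact: exprn_gt0.
apply/eqP; rewrite eq_le; apply/andP; split.
  rewrite -ler_pdivrMl//; apply: (nth_eigenvalue_ge dU tr) => s trs.
  rewrite ler_pdivrMl//; apply: (nth_eigenvalue_le dP); exact: trial_space_affine.
apply: (nth_eigenvalue_ge dP (trial_space_affine z t0 mU tr)) => s trs.
rewrite -ler_pdivlMl//; apply: (nth_eigenvalue_le dU).
have [AK KA] := affineK z t1.
have ti : 0 < t^-1 by rewrite invr_gt0.
have := trial_space_affine (- (t^-1 *: z)) ti mP trs.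
rewrite -comp_preimage (_ : A \o _ = id) ?preimage_id; last by apply/funext => x; exact: KA.
by rewrite exprVn.
Qed.

End affine_domains.

(** * An upper bound of Kroger type *)

(** Split [x] into its projection on the eigensystem and an orthogonal remainder, to
    which the lower bound [nu] applies. Bessel sums are bounded from above and the
    energy of the remainder is at most that of [x]. *)
Lemma eigensystem_bessel_gap (R : realType) (V : lmodType R) (D : V -> Prop) (a b : V -> V -> R)
    (sD : subspace_on D) (fa : form_on D a) (fb : form_on D b)
    m (s : 'I_m -> R) (u : 'I_m -> V) (nu : R) : eigensystem D a b s u -> 0 <= nu ->
  (forall v, D v -> (forall j, b (u j) v = 0) -> nu * b v v <= a v v) ->
  forall x, D x -> nu * b x x <= a x x + nu * \sum_j b (u j) x ^+ 2.
Proof.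
move=> es nu0 H x Dx; have [Du _ _ _] := es.
pose c j := b (u j) x; pose S := \sum_j c j *: u j; pose w := x - S.
have [Dw wu] := eigen_perp_proj sD fb es Dx.
have DS : D S by exact: subspace_sum.
have xE : x = w + S by rewrite subrK.
have [bS _] := eigensystem_span sD fa fb es c DS.
have [bw aw] := eigensystem_span sD fa fb es c Dw.
have bSS : b S S = \sum_j c j ^+ 2.
  rewrite bS; apply: eq_bigr => j _; rewrite (eigensystem_coord sD fb es); by rewrite expr2.
have bwS : b w S = 0 by rewrite (formC fb) bw big1// => j _; rewrite wu mulr0.
have awS : a w S = 0 by rewrite (formC fa) aw big1// => j _; rewrite wu mulr0.
have bx : b x x = b w w + b S S by rewrite {1 2}xE (formD sD fb Dw DS) bwS mulr0 addr0.
have ax : a x x = a w w + a S S by rewrite {1 2}xE (formD sD fa Dw DS) awS mulr0 addr0.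
have := H w Dw wu; have := form_ge0 fa DS.
rewrite bx ax -bSS; lra.
Qed.

Section translated_bumps.
Context (R : realType) (n : nat) (delta : R) (d0 : 0 < delta).
Local Notation mu := (lebesgue_rV R n).
Variables (U : set 'rV[R]_n) (mU : measurable U).
Implicit Types (w h : 'rV[R]_n -> R).

(** [h \o place y] is the function [h] scaled to size [delta] and translated by [-
    y]; this form makes the substitution in [y] an affine map with positive ratio. *)
Definition place (y : 'rV[R]_n) : 'rV[R]_n -> 'rV[R]_n := affine delta^-1 (delta^-1 *: y).

Definition averaged w h (y : 'rV[R]_n) : \bar R :=
  \int[mu]_(x in U) (w x * h (place y x))%:E.

Let F w h (p : 'rV[R]_n * 'rV[R]_n) : \bar R := ((w \_ U) p.1 * h (place p.2 p.1))%:E.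

Let FE w h y : averaged w h y = (\int[mu]_x F w h (x, y))%E.
Proof.
rewrite /averaged integral_mkcond; apply: eq_integral => x _; rewrite /F/= !patchE.
by case: ifP => // _; rewrite mul0r.
Qed.

Let mF w h : measurable_fun U w -> measurable_fun setT h -> measurable_fun setT (F w h).
Proof.
move=> mw mh; apply/measurable_EFinP; apply: measurable_funM.
  apply: measurableT_comp measurable_fst.
  by apply/measurable_restrict => //; rewrite setTI.
apply: (measurableT_comp mh); apply: measurable_fun_rV => i.
under eq_fun do rewrite /place /affine !mxE.
apply: measurable_funD; apply: measurable_funM => //.
  exact: (measurableT_comp (measurable_coord_rV i) measurable_fst).
exact: (measurableT_comp (measurable_coord_rV i) measurable_snd).
Qed.

Let F0 w h : (forall x, 0 <= w x) -> (forall x, 0 <= h x) -> forall p, (0 <= F w h p)%E.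
Proof.
by move=> w0 h0 p; rewrite lee_fin mulr_ge0// patchE; case: ifP.
Qed.

Lemma measurable_averaged w h : measurable_fun U w -> measurable_fun setT h ->
  (forall x, 0 <= w x) -> (forall x, 0 <= h x) -> measurable_fun setT (averaged w h).
Proof.
move=> mw mh w0 h0; rewrite (_ : averaged w h = fun y => (\int[mu]_x F w h (x, y))%E).
  2: by apply/funext => y; exact: FE.
exact: (@measurable_fun_fubini_tonelli_G _ _ _ _ R mu (F w h) (mF mw mh) (F0 w0 h0)).
Qed.

Lemma averaged_ge0 w h y : (forall x, 0 <= w x) -> (forall x, 0 <= h x) ->
  (0 <= averaged w h y)%E.
Proof. by move=> w0 h0; apply: integral_ge0 => x _; rewrite lee_fin mulr_ge0. Qed.

(** Averaging over all translations replaces the scaled function [h] by its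
    integral. *)
Lemma integral_averaged w h (I J : R) : measurable_fun U w -> measurable_fun setT h ->
  (forall x, 0 <= w x) -> (forall x, 0 <= h x) ->
  (\int[mu]_(x in U) (w x)%:E = I%:E)%E -> (\int[mu]_x (h x)%:E = J%:E)%E ->
  (\int[mu]_y averaged w h y = (I * (delta ^+ n * J))%:E)%E.
Proof.
move=> mw mh w0 h0 EI EJ; under eq_integral do rewrite FE.
rewrite -(rV_Tonelli (mF mw mh) (F0 w0 h0)).
have J0 : 0 <= delta ^+ n * J.
  rewrite mulr_ge0 ?exprn_ge0 ?(ltW d0)// -lee_fin -EJ.
  by apply: integral_ge0 => x _; rewrite lee_fin.
have mwT : measurable_fun setT (w \_ U) by apply/measurable_restrict => //; rewrite setTI.
have inner x : (\int[mu]_y F w h (x, y) = ((w \_ U) x)%:E * (delta ^+ n * J)%:E)%E.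
  rewrite /F/=; under eq_integral do rewrite EFinM.
  have di : 0 < delta^-1 by rewrite invr_gt0.
  have E y : h (place y x) = h (affine delta^-1 (delta^-1 *: x) y).
    by rewrite /place /affine addrC.
  have mhp : measurable_fun setT (fun y => (h (place y x))%:E).
    apply/measurable_EFinP; under eq_fun do rewrite E.
    exact: (measurableT_comp mh (measurable_affine _ _)).
  rewrite ge0_integralZl_EFin//; last 2 first.
  - by move=> y _; rewrite lee_fin.
  - by rewrite patchE; case: ifP.
  congr (_ * _)%E; under eq_integral do rewrite E.
  rewrite (ge0_integral_affine (delta^-1 *: x) di (f := fun y => (h y)%:E)).
  - by rewrite EJ -EFinM exprVn invrK.
  - exact/measurable_EFinP.
  - by move=> y; rewrite lee_fin.
under eq_integral do rewrite inner.
rewrite ge0_integralZr//; last 2 first.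
- exact/measurable_EFinP.
- by move=> x _; rewrite lee_fin patchE; case: ifP.
rewrite [RHS]EFinM; congr (_ * _)%E; rewrite -EI [RHS]integral_mkcond.
by apply: eq_integral => x _; rewrite !patchE; case: ifP.
Qed.

End translated_bumps.

Section kroger.
Context (R : realType) (n : nat).
Local Notation mu := (lebesgue_rV R n).

Definition standard_bump : 'rV[R]_n -> R := bump 1 (fun=> -1) (fun=> 1).

Let B : set 'rV[R]_n := closed_box (fun=> -1) (fun=> 1).

Let tB : test_function B standard_bump. Proof. exact: test_bump. Qed.
Let tT : test_function setT standard_bump. Proof. exact: testW tB. Qed.
Let sB : smooth standard_bump. Proof. by case: tB. Qed.

Let mB : measurable B. Proof. by apply: measurable_boxset => i; exact: measurable_itv. Qed.

Let muB : mu B = (2 ^+ n)%:E.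
Proof.
rewrite /B /closed_box (@lebesgue_boxset _ _ _ (fun=> 2)).
- by rewrite prodr_const card_ord.
- by move=> i; exact: measurable_itv.
- move=> i; rewrite lebesgue_measure_itv/= lte_fin gtrN ?ltr01//.
  by rewrite -EFinB; congr (_%:E); ring.
Qed.

Definition bump_mass : R := mass setT (smooth_pair standard_bump) (smooth_pair standard_bump).
Definition bump_energy : R := energy setT (smooth_pair standard_bump) (smooth_pair standard_bump).

Lemma bump_mass_gt0 : 0 < bump_mass.
Proof. by apply: mass_bump_gt0 => // i; rewrite gtrN ltr01. Qed.

(** Take all translates of a bump of size [delta] as trial functions. Each of them
    satisfies [eigensystem_bessel_gap]; integrated over the translations, the mass
    and the energy become those of the bump times the volume 1 of [U], while the
    components along the [k <= m] normalized eigenfunctions are of the smaller order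
    [delta ^ (2 n)]. For [delta] small they absorb at most half of the mass. *)
Lemma kroger_bound (m : nat) (delta : R) (U : set 'rV[R]_n) : 0 < delta ->
  m%:R * (4 ^+ n * delta ^+ n) <= bump_mass / 2 -> domain U -> mu U = 1%E ->
  nth_eigenvalue Neumann U m.+1 <= 2 * bump_energy / (bump_mass * delta ^+ 2).
Proof.
move=> d0 small dU U1; have [oU bU _] := dU; have mU := open_measurable_rV oU.
set nu := nth_eigenvalue _ _ _.
have E0 : 0 <= bump_energy by exact: energy_ge0.
have c0 := bump_mass_gt0; have d2 : 0 < delta ^+ 2 by exact: exprn_gt0.
have dn : 0 < delta ^+ n by exact: exprn_gt0.
have [nu0|nu0] := leP nu 0.
  by apply: le_trans nu0 _; rewrite divr_ge0 ?mulr_ge0// ltW.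
have sH := H1_subspace mU; have fm := mass_form mU; have fe := energy_form mU.
have [k [s [u [km es lb]]]] := eigensystem_lower_bound sH fe fm (H1_complete mU)
  (neumann_compact dU) (fun C => @no_trial_space R n Neumann U m C dU).
have [Du _ orth _] := es.
pose f (y : 'rV[R]_n) := standard_bump \o place delta y.
have di : delta^-1 != 0 by rewrite invr_eq0 gt_eqF.
have tf y : test_function setT (f y).
  by have := test_affine (delta^-1 *: y) di tT; rewrite preimage_setT.
have Df y : in_form_domain Neumann U (smooth_pair (f y)).
  have [sf _ _] := tf y; split; last exact: smooth_weak_gradient.
    exact: (test_L2 mU (tf y)).
  by move=> i; exact: (test_L2 mU (test_partial i (tf y))).
pose one : 'rV[R]_n -> R := cst 1.
pose h0 x := standard_bump x ^+ 2.
pose h1 x := \sum_i partial i standard_bump x ^+ 2.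
pose h2 : 'rV[R]_n -> R := \1_B.
have mh0 : measurable_fun setT h0.
  by apply: measurable_funX; exact: L2_measurable (test_L2 measurableT tT).
have mh1 : measurable_fun setT h1.
  apply: measurable_sum => i; apply: measurable_funX.
  exact: L2_measurable (test_L2 measurableT (test_partial i tT)).
have mh2 : measurable_fun setT h2 by exact: measurable_indic.
have h00 x : 0 <= h0 x by exact: sqr_ge0.
have h10 x : 0 <= h1 x by apply: sumr_ge0 => i _; exact: sqr_ge0.
have h20 x : 0 <= h2 x by rewrite /h2 indicE.
have m1 : measurable_fun U one by exact: measurable_cst.
have one0 x : 0 <= one x by rewrite /one.
have u2 j : L2 U (u j).1 by have [] := Du j.
pose w j x := (u j).1 x ^+ 2.
have mw j : measurable_fun U (w j) by apply: measurable_funX; exact: L2_measurable (u2 j).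
have w0 j x : 0 <= w j x by exact: sqr_ge0.
have Iw j : (\int[mu]_(x in U) (w j x)%:E = 1%:E)%E.
  by rewrite -(L2dotE mU (u2 j)) -[L2dot _ _ _]/(mass U (u j) (u j)) orth eqxx.
have I1 : (\int[mu]_(x in U) (one x)%:E = 1%:E)%E.
  by rewrite -[LHS]/(\int[mu]_(x in U) (cst 1%:E x))%E integral_cst// mul1e [LHS]U1.
have J0 : (\int[mu]_x (h0 x)%:E = bump_mass%:E)%E.
  by rewrite /bump_mass [X in X%:E]/(L2dot _ _ _) (L2dotE measurableT (test_L2 measurableT tT)).
have J1 : (\int[mu]_x (h1 x)%:E = bump_energy%:E)%E.
  have t2 i := test_L2 measurableT (test_partial i tT).
  under eq_integral do rewrite -sumEFin.
  rewrite ge0_integral_sum//; last 2 first.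
  - by move=> i; apply: measurable_sqr => //; exact: L2_measurable (t2 i).
  - by move=> i x _; rewrite lee_fin sqr_ge0.
  by rewrite /bump_energy /energy -sumEFin; apply: eq_bigr => i _; rewrite -(L2dotE measurableT (t2 i)).
have J2 : (\int[mu]_x (h2 x)%:E = (2 ^+ n)%:E)%E.
  by rewrite integral_indic// setIT; exact: muB.
have massE y : (averaged delta U one h0 y = (mass U (smooth_pair (f y)) (smooth_pair (f y)))%:E)%E.
  rewrite [X in X%:E]/(L2dot _ _ _) (L2dotE mU (test_L2 mU (tf y))).
  by apply: eq_integral => x _; rewrite mul1r.
have energyE y : ((delta^-1 ^+ 2)%:E * averaged delta U one h1 y =
    (energy U (smooth_pair (f y)) (smooth_pair (f y)))%:E)%E.
  have -> : energy U (smooth_pair (f y)) (smooth_pair (f y)) =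
      \sum_i delta^-1 ^+ 2 * L2dot U (partial i standard_bump \o place delta y)
        (partial i standard_bump \o place delta y).
    apply: eq_bigr => i _; have [_ /(_ i) dE] := smooth_affine delta^-1 (delta^-1 *: y) sB.
    rewrite [(smooth_pair (f y)).2 i]dE.
    rewrite [LHS](formZZ (L2_subspace mU) (L2_form mU) delta^-1
      (x := partial i standard_bump \o place delta y))//.
    have := test_affine (delta^-1 *: y) di (test_partial i tT).
    by rewrite preimage_setT; exact: test_L2.
  have tp i : L2 U (partial i standard_bump \o place delta y).
    have := test_affine (delta^-1 *: y) di (test_partial i tT).
    by rewrite preimage_setT; exact: test_L2.
  rewrite -mulr_sumr [RHS]EFinM -sumEFin; congr (_ * _)%E; rewrite /averaged.
  under eq_integral do rewrite mul1r /h1 -sumEFin.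
  rewrite ge0_integral_sum//; last 2 first.
  - by move=> i; apply: measurable_sqr; exact: L2_measurable (tp i).
  - by move=> i x _; rewrite lee_fin sqr_ge0.
  by apply: eq_bigr => i _; rewrite (L2dotE mU (tp i)).
(* the Cauchy-Schwarz inequality on the cube that supports the translated bump *)
have coefE y j : ((mass U (u j) (smooth_pair (f y)) ^+ 2)%:E <=
    (2 ^+ n * delta ^+ n)%:E * averaged delta U (w j) h2 y)%E.
  pose Bu := U `&` place delta y @^-1` B.
  have mBy : measurable (place delta y @^-1` B).
    by rewrite -[X in measurable X]setTI; exact: measurable_affine.
  have mBu : measurable Bu by exact: measurableI.
  have BuU : Bu `<=` U by move=> x [].
  have uB := L2_restr mU mBu BuU (u2 j).
  have fB : L2 Bu (f y) by exact: (test_L2 mBu (tf y)).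
  have massB : mass U (u j) (smooth_pair (f y)) = L2dot Bu (u j).1 (f y).
    rewrite -[LHS]/(L2dot U (u j).1 (f y)) (L2dotC U (u j).1) (L2dotC Bu (u j).1) -(@L2dot_extl _ _ U Bu)//.
    apply: L2dot_eq => // x Ux; rewrite patchE; case: ifPn => // /negP xB.
    apply: (test_out tB) => Bx; apply: xB; exact/mem_set.
  have fbound : L2dot Bu (f y) (f y) <= 2 ^+ n * delta ^+ n.
    have muBy : mu (place delta y @^-1` B) = (2 ^+ n * delta ^+ n)%:E.
      rewrite [LHS](lebesgue_affine (delta^-1 *: y) _ mB) ?invr_gt0//.
      by rewrite [X in (_ * X)%E]muB -EFinM exprVn invrK mulrC.
    rewrite -lee_fin (L2dotE mBu fB) -muBy.
    apply: (@le_trans _ _ (\int[mu]_(x in Bu) 1%:E)%E).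
      apply: ge0_le_integral => //.
      - by move=> x _; rewrite lee_fin sqr_ge0.
      - by apply: measurable_sqr; exact: L2_measurable fB.
      - move=> x _; rewrite lee_fin expr_le1//; [exact: bump_le1|exact: bump_ge0].
    by rewrite integral_cst// mul1e; apply: le_measure; [exact/mem_set|exact/mem_set|by move=> x []].
  have EK : (averaged delta U (w j) h2 y = (L2dot Bu (u j).1 (u j).1)%:E)%E.
    rewrite (L2dotE mBu uB) /Bu integral_mkcondr; apply: eq_integral => x _.
    rewrite patchE /h2 indicE (_ : (x \in _) = (place delta y x \in B)).
      by case: ifP => _; rewrite ?mulr1 ?mulr0.
    by apply/idP/idP => /set_mem H; exact/mem_set.
  rewrite EK -EFinM lee_fin massB.
  apply: le_trans (form_CauchySchwarz (L2_subspace mBu) (L2_form mBu) uB fB) _.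
  by rewrite mulrC ler_wpM2r// L2dot_ge0.
have main y : (nu%:E * averaged delta U one h0 y <=
    (delta^-1 ^+ 2)%:E * averaged delta U one h1 y +
    \sum_j (nu * (2 ^+ n * delta ^+ n))%:E * averaged delta U (w j) h2 y)%E.
  have := eigensystem_bessel_gap sH fe fm es (ltW nu0) lb (Df y).
  rewrite massE energyE -EFinM => H.
  apply: (@le_trans _ _ (energy U (smooth_pair (f y)) (smooth_pair (f y)) +
     nu * \sum_j mass U (u j) (smooth_pair (f y)) ^+ 2)%:E); first by rewrite lee_fin.
  rewrite EFinD leeD2l// mulr_sumr -sumEFin; apply: lee_sum => j _.
  rewrite [X in (X <= _)%E]EFinM [X in (_ <= X * _)%E]EFinM -muleA.
  by apply: lee_wpmul2l => //; rewrite lee_fin ltW.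
have main_int : (\int[mu]_y (nu%:E * averaged delta U one h0 y) <=
   \int[mu]_y ((delta^-1 ^+ 2)%:E * averaged delta U one h1 y +
    \sum_j (nu * (2 ^+ n * delta ^+ n))%:E * averaged delta U (w j) h2 y))%E.
  apply: ge0_le_integral => //.
  - by move=> y _; apply: mule_ge0; [rewrite lee_fin ltW|exact: averaged_ge0].
  - by apply: emeasurable_funM => //; exact: measurable_averaged.
  - apply: emeasurable_funD; first by apply: emeasurable_funM => //; exact: measurable_averaged.
    by apply: emeasurable_sum => j; apply: emeasurable_funM => //; exact: measurable_averaged.
move: main_int.
have c2 : 0 <= nu * (2 ^+ n * delta ^+ n).
  by rewrite mulr_ge0 ?(ltW nu0)// mulr_ge0 ?exprn_ge0// ltW.
have dd : 0 <= delta^-1 ^+ 2 by exact: sqr_ge0.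
have mA0 := measurable_averaged delta mU m1 mh0 one0 h00.
have mA1 := measurable_averaged delta mU m1 mh1 one0 h10.
have mA2 j := measurable_averaged delta mU (mw j) mh2 (w0 j) h20.
have A0 y : setT y -> (0 <= averaged delta U one h0 y)%E by move=> _; exact: averaged_ge0.
have A1 y : setT y -> (0 <= averaged delta U one h1 y)%E by move=> _; exact: averaged_ge0.
have A2 j y : setT y -> (0 <= averaged delta U (w j) h2 y)%E by move=> _; exact: averaged_ge0.
have B1 y : setT y -> (0 <= (delta^-1 ^+ 2)%:E * averaged delta U one h1 y)%E.
  by move=> /A1 ?; rewrite mule_ge0// lee_fin.
have mB1 : measurable_fun setT (fun y => (delta^-1 ^+ 2)%:E * averaged delta U one h1 y)%E.
  by apply: emeasurable_funM.
have B2 j y : setT y ->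
    (0 <= (nu * (2 ^+ n * delta ^+ n))%:E * averaged delta U (w j) h2 y)%E.
  by move=> /(A2 j) ?; rewrite mule_ge0// lee_fin.
have mB2 j : measurable_fun setT
    (fun y => (nu * (2 ^+ n * delta ^+ n))%:E * averaged delta U (w j) h2 y)%E.
  by apply: emeasurable_funM.
have B3 y : setT y ->
    (0 <= \sum_j (nu * (2 ^+ n * delta ^+ n))%:E * averaged delta U (w j) h2 y)%E.
  by move=> Ty; apply: sume_ge0 => j _; exact: B2.
have mB3 : measurable_fun setT
    (fun y => \sum_j (nu * (2 ^+ n * delta ^+ n))%:E * averaged delta U (w j) h2 y)%E.
  by apply: emeasurable_sum.
rewrite (ge0_integralZl_EFin mu measurableT A0 mA0 (ltW nu0)).
rewrite (ge0_integralD mu measurableT B1 mB1 B3 mB3).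
rewrite (ge0_integralZl_EFin mu measurableT A1 mA1 dd).
rewrite (ge0_integral_sum mu measurableT mB2 (fun j x => B2 j x)).
under eq_bigr => j _.
  rewrite (ge0_integralZl_EFin mu measurableT (A2 j) (mA2 j) c2).
  rewrite (integral_averaged d0 mU (mw j) mh2 (w0 j) h20 (Iw j) J2) -EFinM.
  over.
rewrite (integral_averaged d0 mU m1 mh0 one0 h00 I1 J0).
rewrite (integral_averaged d0 mU m1 mh1 one0 h10 I1 J1).
rewrite sumEFin -!EFinM -EFinD lee_fin sumr_const card_ord !mul1r -(mulr_natl _ k).
move=> H; rewrite ler_pdivlMr ?mulr_gt0//.
have km' : k%:R <= m%:R :> R by rewrite ler_nat.
have small' : k%:R * (4 ^+ n * delta ^+ n) <= bump_mass / 2.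
  by apply: le_trans small; rewrite ler_wpM2r// mulr_ge0 ?exprn_ge0// ltW.
have E4 : 4 ^+ n = 2 ^+ n * 2 ^+ n :> R by rewrite -exprMn; congr (_ ^+ n); ring.
have H1 : k%:R * (nu * (2 ^+ n * delta ^+ n) * (delta ^+ n * 2 ^+ n)) <=
    nu * delta ^+ n * (bump_mass / 2).
  have -> : k%:R * (nu * (2 ^+ n * delta ^+ n) * (delta ^+ n * 2 ^+ n)) =
    nu * delta ^+ n * (k%:R * (4 ^+ n * delta ^+ n)) by rewrite E4; ring.
  by rewrite ler_wpM2l// mulr_ge0// ltW.
have H2 : delta ^+ n * (nu * bump_mass) <= delta ^+ n * (2 * (delta^-1 ^+ 2 * bump_energy)).
  by move: H H1; lra.
move: H2; rewrite ler_pM2l// => H2.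
have := ler_wpM2r (ltW d2) H2.
have -> : 2 * (delta^-1 ^+ 2 * bump_energy) * delta ^+ 2 = 2 * bump_energy.
  by field; rewrite gt_eqF.
by move=> H3; lra.
Qed.

End kroger.

(** * Disjoint unions *)

Section unions.
Context (R : realType) (n p : nat) (A : 'I_p -> set 'rV[R]_n).
Local Notation mu := (lebesgue_rV R n).
Local Notation V := (\bigcup_j A j).

(** Distances are measured in the sup norm. *)
Definition separated_by (r : R) := forall j l x y, j != l -> A j x -> A l y ->
  exists i, r <= `|x ord0 i - y ord0 i|.

Lemma separated_trivIset r : 0 < r -> separated_by r -> trivIset setT A.
Proof.
move=> r0 sep j l _ _ [x [Aj Al]]; apply/eqP; apply: contrapT => /negP jl.
by have [i] := sep j l x x jl Aj Al; rewrite subrr normr0 leNgt r0.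
Qed.

(** Near a boundary point only one of the pieces is present, and its chart is a
    chart of the union. *)
Lemma domain_separated_union r : 0 < r -> separated_by r -> (forall j, domain (A j)) -> domain V.
Proof.
move=> r0 sep dA; split.
- by apply: bigcup_open => j _; have [] := dA j.
- have /choice[rr Hr] : forall j, exists r, forall x, A j x -> `|x| < r.
    by move=> j; have [_ /bounded_radius[s s0 Hs] _] := dA j; exists s.
  exists (\sum_j `|rr j|); split; first exact: num_real.
  move=> M HM x [j _ /Hr xr]; apply: (le_trans _ (ltW HM)); apply: (le_trans (ltW xr)).
  rewrite (bigD1 j)//= (le_trans (ler_norm _))// lerDl; exact: sumr_ge0.
- move=> x0 cx nx; have r2 : 0 < r / 2 by rewrite divr_gt0.
  have nb : nbhs x0 (ball x0 (r / 2)) by exact: nbhsx_ballx.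
  have [y [[j _ Ajy] By]] := cx _ nb.
  have loc x : ball x0 (r / 2) x -> V x -> A j x.
    move=> Bx [l _ Alx]; have [<-//|lj] := eqVneq l j.
    have [i] := sep l j x y lj Alx Ajy; rewrite leNgt => /negP[].
    move: Bx By; rewrite !ball_rV// => /(_ i) h1 /(_ i) h2; move: h1 h2.
    rewrite !ltr_norml => /andP[a1 a2] /andP[b1 b2]; apply/andP; split; lra.
  have cA : closure (A j) x0.
    move=> B nB; have [z [Vz [Bz B2]]] := cx _ (filterI nB nb).
    by exists z; split=> //; exact: loc.
  have nA : ~ (A j)° x0.
    move=> iA; apply: nx; apply: filterS iA => z Az; by exists j.
  have [_ _ lA] := dA j.
  have [Q [i [gamma [L [oQ lg near_x]]]]] := lA _ cA nA.
  exists Q, i, gamma, L; split=> //.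
  apply: filterS2 near_x nb => x Hx Bx; split.
    by move=> /(loc _ Bx) /Hx.
  by move=> /Hx Ax; exists j.
Qed.

Hypothesis tA : trivIset setT A.
Hypothesis oA : forall j, open (A j).

Let mA j : measurable (A j). Proof. exact: open_measurable_rV. Qed.
Let AV j : A j `<=` V. Proof. by move=> x Ax; exists j. Qed.
Let oV : open V. Proof. exact: bigcup_open. Qed.
Let mV : measurable V. Proof. exact: open_measurable_rV. Qed.

(** Extension by zero keeps the trial spaces of the pieces, and functions with
    disjoint supports are orthogonal for both forms. *)
Lemma dirichlet_union_trial_space (d : 'I_p -> nat) C :
  (forall j, has_trial_space Dirichlet (A j) (d j) C) ->
  has_trial_space Dirichlet V (\sum_j d j) C.
Proof.
move=> H; pose v j := projT1 (cid (H j)).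
have vP j := projT2 (cid (H j)).
have sV := domain_subspace mV Dirichlet.
apply: (trial_space_direct_sum sV (energy_form_domain mV _) (mass_form_domain mV _)
  (v := fun j l => zero_ext (A j) (v j l))).
- move=> j l. apply: (domain_zero_ext (mA j) mV (@AV j)).
  by have [Dv _] := vP j; exact: Dv.
- move=> j c /=.
  have -> : \sum_l c l *: zero_ext (A j) (v j l) = zero_ext (A j) (\sum_l c l *: v j l).
    have z0 : zero_ext (A j) 0 = 0.
      by have := zero_ext_lin (A j) (-1) 0 0; rewrite scaler0 addr0 scaleN1r addNr.
    elim: (index_enum _) => [|l s IH]; first by rewrite !big_nil z0.
    by rewrite !big_cons IH zero_ext_lin.
  by rewrite energy_zero_ext// mass_zero_ext//; have [_] := vP j; exact.
- move=> j k l l' jk.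
  have dot0 (f g : 'rV[R]_n -> R) : L2dot V (f \_ (A j)) (g \_ (A k)) = 0.
    rewrite /L2dot (@eq_Rintegral _ _ _ _ _ (cst 0)) ?/Rintegral ?integral0// => x _ /=.
    rewrite !patchE; case: ifPn => xj; last by rewrite mul0r.
    case: ifPn => xk; last by rewrite mulr0.
    move/eqP: jk; case; apply: (tA (i := j) (j := k)) => //.
    by exists x; split; exact: set_mem.
  by split; [rewrite /energy big1// => i _; exact: dot0|exact: dot0].
Qed.

Lemma H1_restr j q : in_form_domain Neumann V q -> in_form_domain Neumann (A j) q.
Proof.
move=> [u2 g2 wg]; split=> [|i|phi tphi i].
- exact: (L2_restr mV (mA j) (@AV j)).
- exact: (L2_restr mV (mA j) (@AV j) (g2 i)).
- have tV := testW (@AV j) tphi.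
  rewrite (test_L2dotT _ tphi) (test_L2dotT _ (test_partial i tphi)).
  by rewrite -(test_L2dotT _ tV) -(test_L2dotT _ (test_partial i tV)) wg.
Qed.

(** A trial space of dimension [d_1 + ... + d_p + 1] contains a vector that is
    orthogonal, on every piece, to the eigenfunctions given by the max-min principle
    there; its restriction to each piece has Rayleigh quotient at least [nu]. *)
Lemma neumann_union_lower_bound (d : 'I_p -> nat) nu t : 0 <= nu ->
  (forall j, domain (A j)) ->
  (forall j C, C < nu -> ~ has_trial_space Neumann (A j) (d j).+1 C) ->
  has_trial_space Neumann V (\sum_j d j).+1 t -> nu <= t.
Proof.
move=> nu0 dA no tr.
have low j := eigensystem_lower_bound (H1_subspace (mA j)) (energy_form (mA j))
  (mass_form (mA j)) (H1_complete (mA j)) (neumann_compact (dA j)) (no j).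
pose k j := projT1 (cid (low j)).
have low2 j := projT2 (cid (low j)).
pose s j := projT1 (cid (low2 j)); have low3 j := projT2 (cid (low2 j)).
pose u j : 'I_(k j) -> _ := projT1 (cid (low3 j)).
have uP j : [/\ (k j <= d j)%N, eigensystem (in_form_domain Neumann (A j)) (energy (A j))
    (mass (A j)) (s j) (u j) & forall v, in_form_domain Neumann (A j) v ->
    (forall l, mass (A j) (u j l) v = 0) -> nu * mass (A j) v v <= energy (A j) v v].
  exact: (projT2 (cid (low3 j))).
pose T := {j : 'I_p & 'I_(k j)}.
have cT : #|{: T}| = (\sum_j k j)%N.
  rewrite card_tagged sumnE big_map big_enum/=; apply: eq_bigr => j _; exact: card_ord.
have kd : (#|{: T}| <= \sum_j d j)%N by rewrite cT; apply: leq_sum => j _; have [] := uP j.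
pose l (a : 'I_#|{: T}|) q := mass (A (tag (enum_val a))) (u _ (tagged (enum_val a))) q.
have fl a : functional_on (in_form_domain Neumann V) (l a).
  move=> c x y Hx Hy; rewrite /l; set j := tag _.
  have [_ [Du _ _ _] _] := uP j.
  exact: (form_funr (mass_form (mA j)) (Du _) c (H1_restr j Hx) (H1_restr j Hy)).
have sV := H1_subspace mV.
have tr' := @trial_space_leq R _ _ (energy V) (mass V) _ _ t (kd : (_.+1 <= _.+1)%N) tr.
have [x [Hx lx b0 le]] := trial_space_meet sV (mass_form mV) fl tr'.
have perp j a : mass (A j) (u j a) x = 0.
  by have := lx (enum_rank (Tagged (fun j => 'I_(k j)) a)); rewrite /l enum_rankK.
have piece j : nu * mass (A j) x x <= energy (A j) x x.
  by have [_ _ H] := uP j; apply: H (perp j); exact: H1_restr.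
have [x2 g2 _] := Hx.
have cover : mass V x x <= \sum_j mass (A j) x x.
  apply: (@L2dot_le_cover R n _ predT A V) => //.
  by move=> y [j _ Aj]; exists j.
have split_ : \sum_j energy (A j) x x <= energy V x x.
  rewrite /energy exchange_big/=; apply: ler_sum => i _.
  apply: (@L2dot_sum_disjoint R n _ predT A V) => //.
  by move=> a b _ _; exact: tA.
have : nu * mass V x x <= t * mass V x x.
  apply: le_trans le; apply: le_trans split_.
  apply: (@le_trans _ _ (\sum_j nu * mass (A j) x x)); last exact: ler_sum.
  by rewrite -mulr_sumr ler_wpM2l.
by rewrite ler_pM2r.
Qed.

End unions.

Section placement.
Context (R : realType) (n p : nat).
Local Notation mu := (lebesgue_rV R n.+1).

(** The scaled copies are translated along the diagonal by multiples of three times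
    a common radius. *)
Lemma exists_separated_copies (U : 'I_p -> set 'rV[R]_n.+1) (t : 'I_p -> R) :
  (forall j, 0 < t j) -> (forall j, domain (U j)) ->
  exists (z : 'I_p -> 'rV[R]_n.+1) (r : R), 0 < r /\
    separated_by (fun j => affine (t j) (z j) @^-1` U j) r.
Proof.
move=> t0 dU.
have /choice[rr Hr] : forall j, exists r, 0 < r /\ forall x, U j x -> `|x| < r.
  by move=> j; have [_ /bounded_radius[s s0 Hs] _] := dU j; exists s.
pose r : R := 1 + \sum_j rr j / t j.
have rj j : rr j / t j <= r.
  rewrite /r (bigD1 j)//= addrCA lerDl addr_ge0//; apply: sumr_ge0 => l _.
  by rewrite divr_ge0// ltW//; have [] := Hr l.
have r0 : 0 < r.
  by rewrite ltr_wpDr//; apply: sumr_ge0 => l _; rewrite divr_ge0// ltW//; have [] := Hr l.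
exists (fun j => - (t j *: \row__ (3 * j%:R * r))), r; split=> // j l x y jl Ajx Aly.
exists ord0.
have close (a : 'I_p) w : (affine (t a) (- (t a *: \row__ (3 * a%:R * r))) @^-1` U a) w ->
    `|w ord0 ord0 - 3 * a%:R * r| < r.
  move=> Uw; have [_ /(_ _ Uw) nw] := Hr a.
  have := le_lt_trans (coord_le_norm _ ord0) nw; rewrite !mxE -mulrBr normrM gtr0_norm//.
  by rewrite mulrC -ltr_pdivlMr// => /lt_le_trans; apply; exact: rj.
have := close j x Ajx; have := close l y Aly.
have jl3 : 3 <= `|3 * j%:R - 3 * l%:R| :> R.
  rewrite -mulrBr normrM ger0_norm// ler_peMr//.
  have [jl'|lj'|e] := ltngtP j l; last by move: jl; rewrite -val_eqE/= e eqxx.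
    rewrite distrC ger0_norm ?subr_ge0 ?ler_nat 1?ltnW//.
    by rewrite lerBrDr -[1]/(1%:R) -natrD ler_nat add1n.
  rewrite ger0_norm ?subr_ge0 ?ler_nat 1?ltnW//.
  by rewrite lerBrDr -[1]/(1%:R) -natrD ler_nat add1n.
have : 3 * r <= `|3 * j%:R * r - 3 * l%:R * r|.
  by rewrite -mulrBl normrM (gtr0_norm r0) ler_wpM2r// ltW.
move: (3 * j%:R * r) (3 * l%:R * r) (x ord0 ord0) (y ord0 ord0) => a b X Y.
rewrite !ltr_norml => h /andP[h1 h2] /andP[h3 h4].
case: (lerP 0 (a - b)) h => [ab|ab]; [rewrite ger0_norm//|rewrite ltr0_norm//] => h.
  by rewrite ler_normr; apply/orP; left; lra.
by rewrite ler_normr; apply/orP; right; lra.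
Qed.

End placement.

(** * The extremal eigenvalues *)

Section extremal_eigenvalues.
Context (R : realType) (n' : nat).
Local Notation n := n'.+1.
Local Notation mu := (lebesgue_rV R n).

Lemma unit_domain_nonempty (U : set 'rV[R]_n) : unit_domains R n U -> U !=set0.
Proof.
move=> [_ U1]; apply/set0P/eqP => U0; move: U1; rewrite U0 measure0 => /eqP.
by rewrite eqe eq_sym oner_eq0.
Qed.

Lemma unit_domain_trial_space bc m (U : set 'rV[R]_n) : unit_domains R n U ->
  exists C, has_trial_space bc U m C.
Proof.
move=> UU; have [[oU _ _] _] := UU.
exact: (exists_trial_space bc m (ltn0Sn n') oU (unit_domain_nonempty UU)).
Qed.

Lemma faber_krahn_constant_gt0 : 0 < faber_krahn_constant R n.
Proof. by rewrite /faber_krahn_constant !mulr_gt0// exprn_gt0. Qed.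

(** All eigenvalues are bounded below by the first one, which Faber-Krahn controls. *)
Lemma dirichlet_eigenvalue_ge m (U : set 'rV[R]_n) : unit_domains R n U ->
  (faber_krahn_constant R n)^-1 <= nth_eigenvalue Dirichlet U m.+1.
Proof.
move=> UU; have [dU U1] := UU; have [oU bU _] := dU.
have mU := open_measurable_rV oU; have K0 := faber_krahn_constant_gt0.
have [C tr] := unit_domain_trial_space Dirichlet m.+1 UU.
apply: (nth_eigenvalue_ge dU tr) => t /(trial_space_vector mU)[x [Dx b0 le]].
have U1' : (mu U <= 1)%E by rewrite U1.
have := faber_krahn (ltn0Sn n') oU bU U1' Dx.
move=> /le_trans /(_ (ler_wpM2l (ltW K0) le)); rewrite mulrA -[X in X <= _]mul1r.
by rewrite ler_pM2r// -ler_pdivrMl// mulr1.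
Qed.

Let dirichlet_set m := [set dirichlet_eigenvalue m.+1 U | U in unit_domains R n].

Let dirichlet_inf m : has_inf (dirichlet_set m).
Proof.
split; first by exists (dirichlet_eigenvalue m.+1 (@unit_cube R n')), (@unit_cube R n') => //;
  exact: (@unit_cube_domain R n').
by exists (faber_krahn_constant R n)^-1 => _ [U UU <-]; exact: dirichlet_eigenvalue_ge.
Qed.

Lemma lambda_star_gt0 m : 0 < lambda_star R n m.+1.
Proof.
apply: (@lt_le_trans _ _ (faber_krahn_constant R n)^-1).
  by rewrite invr_gt0 faber_krahn_constant_gt0.
apply: lb_le_inf; first by have [] := dirichlet_inf m.
by move=> _ [U UU <-]; exact: dirichlet_eigenvalue_ge.
Qed.

Lemma lambda_star_le m (U : set 'rV[R]_n) : unit_domains R n U ->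
  lambda_star R n m.+1 <= dirichlet_eigenvalue m.+1 U.
Proof. by move=> UU; apply: ge_inf; [have [] := dirichlet_inf m|exists U]. Qed.

Lemma lambda_star_approx m tau : lambda_star R n m.+1 < tau ->
  exists2 U, unit_domains R n U & dirichlet_eigenvalue m.+1 U < tau.
Proof.
move=> lt; have := inf_adherent (_ : 0 < tau - lambda_star R n m.+1) (dirichlet_inf m).
rewrite subr_gt0 => /(_ lt)[_ [U UU <-]]; rewrite addrC subrK => H.
by exists U.
Qed.

Let neumann_set m := [set neumann_eigenvalue m U | U in unit_domains R n].

Let neumann_sup m : has_sup (neumann_set m).
Proof.
split; first by exists (neumann_eigenvalue m (@unit_cube R n')), (@unit_cube R n') => //;
  exact: (@unit_cube_domain R n').
have c0 := @bump_mass_gt0 R n.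
have q0 : 0 < bump_mass R n / 2 / (m%:R * 4 ^+ n + 1).
  by rewrite !divr_gt0// ltr_wpDl// mulr_ge0// exprn_ge0.
(* delta <= 1 gives delta ^ n <= delta *)
pose delta : R := Num.min 1 (bump_mass R n / 2 / (m%:R * 4 ^+ n + 1)).
have d0 : 0 < delta by rewrite lt_min ltr01.
exists (2 * bump_energy R n / (bump_mass R n * delta ^+ 2)) => _ [U [dU U1] <-].
apply: kroger_bound => //.
have dn : delta ^+ n <= delta.
  by rewrite exprS ler_piMr ?(ltW d0)// exprn_ile1 ?(ltW d0)// ge_min lexx.
have d1 : delta <= bump_mass R n / 2 / (m%:R * 4 ^+ n + 1) by rewrite ge_min lexx orbT.
have m4 : 0 <= m%:R * 4 ^+ n :> R by rewrite mulr_ge0// exprn_ge0.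
move: d1; rewrite ler_pdivlMr ?ltr_wpDl// => d1; rewrite mulrA.
by move: dn d1 d0 m4; move: (delta) (delta ^+ n) (m%:R * 4 ^+ n) => *; nra.
Qed.

Lemma mu_star_ge m (U : set 'rV[R]_n) : unit_domains R n U ->
  neumann_eigenvalue m U <= mu_star R n m.
Proof. by move=> UU; apply: ub_le_sup; [have [] := neumann_sup m|exists U]. Qed.

Lemma mu_star_approx m tau : tau < mu_star R n m ->
  exists2 U, unit_domains R n U & tau < neumann_eigenvalue m U.
Proof.
move=> lt; have := sup_adherent (_ : 0 < mu_star R n m - tau) (neumann_sup m).
rewrite subr_gt0 => /(_ lt)[_ [U UU <-]]; rewrite opprB addrC subrK => H.
by exists U.
Qed.

(** The unit cube is a competitor. A trial space of dimension at least 2 contains a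
    function of mean value zero, to which the Poincare inequality on the cube
    applies. *)
Lemma mu_star_gt0 m : (0 < m)%N -> 0 < mu_star R n m.
Proof.
move=> m0; have CC := @unit_cube_domain R n'; have [dC _] := CC.
pose K : R := 2 ^+ n * n%:R; have K0 : 0 < K by rewrite mulr_gt0// exprn_gt0.
apply: lt_le_trans (mu_star_ge m CC); apply: (@lt_le_trans _ _ K^-1); first by rewrite invr_gt0.
have [C tr] := unit_domain_trial_space Neumann m.+1 CC.
have mC : measurable (@unit_cube R n') by have [oC _ _] := dC; exact: open_measurable_rV.
apply: (nth_eigenvalue_ge dC tr) => t trt.
have [L1 _] := L2_cst_finite mC (@lebesgue_unit_cube R n').
have fl (j : 'I_1) : functional_on (in_form_domain Neumann (@unit_cube R n'))
    (fun p => L2dot (@unit_cube R n') p.1 (cst 1)).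
  by move=> c x y [x2 _ _] [y2 _ _]; exact: (L2dot_lin mC c x2 y2 L1).
have tr2 : has_trial_space Neumann (@unit_cube R n') 2 t.
  by apply: trial_space_leq trt; rewrite ltnS.
have [x [Dx l0 b0 le]] := trial_space_meet (H1_subspace mC) (mass_form mC) fl tr2.
have := unit_cube_poincare Dx; rewrite (l0 ord0) expr0n add0r -/K.
move=> /le_trans /(_ (ler_wpM2l (ltW K0) le)); rewrite mulrA -[X in X <= _]mul1r.
by rewrite ler_pM2r// -ler_pdivrMl// mulr1.
Qed.

(** A copy of [U j] scaled to volume [w j] has its eigenvalues multiplied by [w j ^
    (- 2 / n)]. *)
Lemma exists_scaled_union p (U : 'I_p -> set 'rV[R]_n) (w : 'I_p -> R) :
  (forall j, 0 < w j) -> \sum_j w j = 1 -> (forall j, unit_domains R n (U j)) ->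
  exists A : 'I_p -> set 'rV[R]_n, [/\ forall j, domain (A j), trivIset setT A,
    unit_domains R n (\bigcup_j A j), forall j, volume (A j) = w j &
    forall j bc m, nth_eigenvalue bc (A j) m.+1 =
      (w j `^ (2 / n%:R))^-1 * nth_eigenvalue bc (U j) m.+1].
Proof.
move=> w0 w1 UU; pose t j := w j `^ (- n%:R^-1).
have t0 j : 0 < t j by exact: powR_gt0.
have dU j : domain (U j) by have [] := UU j.
have [z [r [r0 sep]]] := exists_separated_copies t0 dU.
pose A j := affine (t j) (z j) @^-1` U j.
have dA j : domain (A j) by exact: domain_affine_preimage.
have nn : n%:R != 0 :> R by rewrite pnatr_eq0.
have tn j : t j ^+ n = (w j)^-1.
  rewrite /t -powR_mulrn ?powR_ge0// -powRrM mulNr mulVf// powRN powRr1// ltW//.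
have t2 j : t j ^+ 2 = (w j `^ (2 / n%:R))^-1.
  by rewrite /t -powR_mulrn ?powR_ge0// -powRrM mulNr powRN mulrC.
have mU j : measurable (U j) by have [oU _ _] := dU j; exact: open_measurable_rV.
have muA j : mu (A j) = (w j)%:E.
  have [_ U1] := UU j.
  by rewrite [LHS](lebesgue_affine (z j) (t0 j) (mU j)) tn invrK U1 mule1.
have tA := separated_trivIset r0 sep.
exists A; split=> //.
- split; first exact: domain_separated_union sep dA.
  have oA j : open (A j) by have [] := dA j.
  have mA j : measurable (A j) by exact: open_measurable_rV.
  have -> : \bigcup_j A j = \big[setU/set0]_(j < p) A j.
    rewrite -bigcup_seq; apply/seteqP; split=> x [j _ Aj]; exists j => //=.
    by rewrite mem_index_enum.
  rewrite [LHS]measure_bigsetU_ord//.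
  rewrite -w1 -sumEFin; apply: eq_bigr => j _; exact: muA.
- by move=> j; rewrite /volume muA.
- move=> j bc m; have [C tr] := unit_domain_trial_space bc m.+1 (UU j).
  by rewrite /A (nth_eigenvalue_affine (z j) (t0 j) (dU j) tr) t2.
Qed.

End extremal_eigenvalues.

(** * Optimal configurations *)

Section optimal_weights.
Context (R : realType) (n' p : nat) (L : 'I_p -> R).
Local Notation n := n'.+1.
Hypotheses (p0 : (0 < p)%N) (L0 : forall j, 0 < L j).

Definition power_sum : R := \sum_j L j `^ (n%:R / 2).
(** The common value of the rescaled eigenvalues when the volumes are given by
    [weight]. *)
Definition combined_level : R := power_sum `^ (2 / n%:R).
(** Volumes for which the rescaled optimal eigenvalues [L j / weight j ^ (2 / n)] of
    the pieces all coincide. *)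
Definition weight (j : 'I_p) : R := L j `^ (n%:R / 2) / power_sum.

Let nn : n%:R != 0 :> R. Proof. by rewrite pnatr_eq0. Qed.
Let half : n%:R / 2 * (2 / n%:R) = 1 :> R. Proof. by field. Qed.
Let half' : 2 / n%:R * (n%:R / 2) = 1 :> R. Proof. by field. Qed.

Lemma powR_halfK (x : R) : 0 <= x -> (x `^ (n%:R / 2)) `^ (2 / n%:R) = x.
Proof. by move=> x0; rewrite -powRrM half powRr1. Qed.

Lemma power_sum_gt0 : 0 < power_sum.
Proof.
rewrite /power_sum (bigD1 (Ordinal p0))//= ltr_wpDr ?powR_gt0//.
by apply: sumr_ge0 => j _; exact: powR_ge0.
Qed.

Lemma combined_level_gt0 : 0 < combined_level.
Proof. by rewrite powR_gt0// power_sum_gt0. Qed.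

Lemma combined_level_powR : combined_level `^ (n%:R / 2) = power_sum.
Proof. by rewrite /combined_level -powRrM half' powRr1// ltW// power_sum_gt0. Qed.

Lemma weight_gt0 j : 0 < weight j.
Proof. by rewrite divr_gt0 ?powR_gt0// power_sum_gt0. Qed.

Lemma sum_weight : \sum_j weight j = 1.
Proof. by rewrite -mulr_suml divff// gt_eqF// power_sum_gt0. Qed.

Lemma weight_powR j : weight j `^ (2 / n%:R) = L j / combined_level.
Proof.
have T0 := power_sum_gt0.
rewrite /weight powRM ?powR_ge0 ?invr_ge0 ?(ltW T0)// powR_halfK ?(ltW (L0 j))//.
congr (_ * _); rewrite /combined_level -powR_inv1 ?(ltW T0)//.
by rewrite -powRrM mulN1r powRN.
Qed.

End optimal_weights.

Section optimal_configurations.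
Context (R : realType) (n' p : nat) (i : 'I_p -> nat) (k : nat).
Local Notation n := n'.+1.
Hypotheses (i_gt0 : forall j, (0 < i j)%N) (i_sum : (\sum_(j < p) i j)%N = k) (k_gt0 : (0 < k)%N).

Let p0 : (0 < p)%N.
Proof.
move: i_sum; case: p i i_gt0 => // i' _; rewrite big_ord0 => k0.
by move: k_gt0; rewrite -k0.
Qed.

Let Lam j := lambda_star R n (i j).
Let Lam0 j : 0 < Lam j.
Proof. by rewrite /Lam -(prednK (i_gt0 j)); exact: lambda_star_gt0. Qed.

(** Scale almost optimal domains to the optimal weights. Then the [i j]-th
    eigenvalue of the piece [A j] is at most [(1 + e) * combined_level] for every
    [j], and the trial spaces of the pieces add up to dimension [k]. *)
Lemma dirichlet_configuration (e : R) : 0 < e -> exists A : 'I_p -> set 'rV[R]_n,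
  [/\ (forall j, domain (A j)) /\ trivIset setT A, unit_domains R n (\bigcup_j A j),
      dirichlet_eigenvalue k (\bigcup_j A j) <= (1 + e) * combined_level n' Lam,
      forall j, Lam j <= dirichlet_eigenvalue (i j) (A j) * volume (A j) `^ (2 / n%:R)
         <= (1 + e) * Lam j &
      forall j, volume (A j) = weight n' Lam j].
Proof.
move=> e0; have S0 := combined_level_gt0 n' p0 Lam0.
have e1 : 0 < 1 + e by rewrite ltr_wpDl.
have /choice[U HU] : forall j, exists U, unit_domains R n U /\
    dirichlet_eigenvalue (i j) U < (1 + e) * Lam j.
  move=> j; have lt : Lam j < (1 + e) * Lam j by rewrite ltr_pMl// ltrDl.
  move: lt; rewrite /Lam -(prednK (i_gt0 j)) => /lambda_star_approx[U UU H].
  by exists U.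
have w0 := weight_gt0 n' p0 Lam0; have w1 := sum_weight n' p0 Lam0.
have wS := weight_powR n' p0 Lam0.
have UU j : unit_domains R n (U j) by have [] := HU j.
have [A [dA tA dV vA eA]] := exists_scaled_union w0 w1 UU.
have eA' j : dirichlet_eigenvalue (i j) (A j) =
    combined_level n' Lam / Lam j * dirichlet_eigenvalue (i j) (U j).
  by rewrite /dirichlet_eigenvalue -(prednK (i_gt0 j)) eA wS invf_div.
have oA j : open (A j) by have [] := dA j.
exists A; split=> //.
- rewrite /dirichlet_eigenvalue -(prednK k_gt0); apply: (nth_eigenvalue_le (proj1 dV)).
  rewrite (prednK k_gt0) -i_sum; apply: dirichlet_union_trial_space => // j.
  have mA : measurable (A j) by exact: open_measurable_rV.
  have neA : A j !=set0.
    apply/set0P/eqP => A0; have := w0 j; rewrite -vA /volume A0 measure0/=.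
    by rewrite ltxx.
  have [C tr] := exists_trial_space Dirichlet (i j) (ltn0Sn n') (oA j) neA.
  have lt : dirichlet_eigenvalue (i j) (A j) < (1 + e) * combined_level n' Lam.
    have [_ H] := HU j; rewrite eA' mulrAC ltr_pdivrMr// mulrAC [X in _ < X]mulrC mulrA.
    by rewrite -[X in _ < X]mulrA ltr_pM2l// mulrC.
  have [t tlt trt] := nth_eigenvalue_lt (dA j) tr lt.
  exact: (trial_space_weaken (domain_subspace mA Dirichlet) (mass_form_domain mA Dirichlet) (ltW tlt) trt).
- move=> j; have [UUj lt] := HU j; rewrite vA wS eA'.
  have -> : combined_level n' Lam / Lam j * dirichlet_eigenvalue (i j) (U j) *
      (Lam j / combined_level n' Lam) = dirichlet_eigenvalue (i j) (U j).
    by field; rewrite (gt_eqF S0) (gt_eqF (Lam0 j)).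
  rewrite (ltW lt) andbT /Lam.
  by have := lambda_star_le (i j).-1 UUj; rewrite (prednK (i_gt0 j)).
Qed.

Let M j := mu_star R n (i j).
Let M0 j : 0 < M j. Proof. exact: mu_star_gt0. Qed.

(** The dual construction: the [i j]-th Neumann eigenvalue of every piece is at
    least [(1 - e) * combined_level], and a trial space of dimension [k + 1] on the
    union contains a function orthogonal to the lower eigenfunctions of all pieces. *)
Lemma neumann_configuration (e : R) : 0 < e < 1 -> exists A : 'I_p -> set 'rV[R]_n,
  [/\ (forall j, domain (A j)) /\ trivIset setT A, unit_domains R n (\bigcup_j A j),
      (1 - e) * combined_level n' M <= neumann_eigenvalue k (\bigcup_j A j),
      forall j, (1 - e) * M j <= neumann_eigenvalue (i j) (A j) * volume (A j) `^ (2 / n%:R)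
         <= M j &
      forall j, volume (A j) = weight n' M j].
Proof.
move=> /andP[e0 e1]; have S0 := combined_level_gt0 n' p0 M0.
have /choice[U HU] : forall j, exists U, unit_domains R n U /\
    (1 - e) * M j < neumann_eigenvalue (i j) U.
  move=> j; have lt : (1 - e) * M j < M j by rewrite gtr_pMl// gtrBl.
  by have [U UU H] := mu_star_approx lt; exists U.
have w0 := weight_gt0 n' p0 M0; have w1 := sum_weight n' p0 M0.
have wS := weight_powR n' p0 M0.
have UU j : unit_domains R n (U j) by have [] := HU j.
have [A [dA tA dV vA eA]] := exists_scaled_union w0 w1 UU.
have eA' j : neumann_eigenvalue (i j) (A j) =
    combined_level n' M / M j * neumann_eigenvalue (i j) (U j).
  by rewrite /neumann_eigenvalue eA wS invf_div.
have oA j : open (A j) by have [] := dA j.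
exists A; split=> //.
- have [C tr] := unit_domain_trial_space Neumann k.+1 dV.
  apply: (nth_eigenvalue_ge (proj1 dV) tr) => t trt.
  apply: (@neumann_union_lower_bound R n p A tA oA i) => //.
  + by rewrite mulr_ge0 ?(ltW S0)// subr_ge0 ltW.
  + move=> j C' ltC; apply: (no_trial_space (dA j)); apply: lt_le_trans ltC _.
    rewrite -[X in _ <= X]/(neumann_eigenvalue (i j) (A j)) eA'.
    have [_ /ltW H] := HU j; rewrite mulrAC ler_pdivlMr// mulrAC [X in _ <= X]mulrC.
    by rewrite ler_pM2r.
  + by rewrite i_sum.
- move=> j; have [UUj lt] := HU j; rewrite vA wS eA'.
  have -> : combined_level n' M / M j * neumann_eigenvalue (i j) (U j) *
      (M j / combined_level n' M) = neumann_eigenvalue (i j) (U j).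
    by field; rewrite (gt_eqF S0) (gt_eqF (M0 j)).
  by rewrite (ltW lt)/=; exact: mu_star_ge.
Qed.

Lemma lambda_star_le_combined_level : lambda_star R n k <= combined_level n' Lam.
Proof.
have S0 := combined_level_gt0 n' p0 Lam0.
apply/ler_addgt0Pr => e e0.
have [A [_ dV le _ _]] := dirichlet_configuration (divr_gt0 e0 S0).
have := lambda_star_le k.-1 dV; rewrite (prednK k_gt0) => /le_trans /(_ le).
by rewrite mulrDl mul1r divfK// gt_eqF.
Qed.

Lemma combined_level_le_mu_star : combined_level n' M <= mu_star R n k.
Proof.
have S0 := combined_level_gt0 n' p0 M0.
(* d must be smaller than 1, and d times the level at most e *)
apply/ler_addgt0Pr => e e0; pose d := Num.min (1 / 2) (e / combined_level n' M).
have d01 : 0 < d < 1.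
  by rewrite lt_min !divr_gt0//= gt_min; apply/orP; left; lra.
have [A [_ dV le _ _]] := neumann_configuration d01.
have := mu_star_ge k dV; move/(le_trans le) => H.
have de : d * combined_level n' M <= e.
  by rewrite -ler_pdivlMr// ge_min lexx orbT.
by move: H; rewrite mulrBl mul1r; lra.
Qed.

Lemma wolf_keller_dirichlet :
  lambda_star R n k `^ (n%:R / 2) <= \sum_(j < p) lambda_star R n (i j) `^ (n%:R / 2).
Proof.
rewrite -/(power_sum n' Lam) -(combined_level_powR n' p0 Lam0).
have lk : 0 < lambda_star R n k by rewrite -(prednK k_gt0); exact: lambda_star_gt0.
apply: ge0_ler_powR; rewrite ?nnegrE ?(ltW lk) ?divr_ge0//.
  exact/ltW/combined_level_gt0.
exact: lambda_star_le_combined_level.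
Qed.

Lemma wolf_keller_neumann :
  \sum_(j < p) mu_star R n (i j) `^ (n%:R / 2) <= mu_star R n k `^ (n%:R / 2).
Proof.
rewrite -/(power_sum n' M) -(combined_level_powR n' p0 M0).
apply: ge0_ler_powR; rewrite ?nnegrE ?divr_ge0//.
- exact/ltW/combined_level_gt0.
- exact/ltW/mu_star_gt0.
exact: combined_level_le_mu_star.
Qed.

(** Equality means that [combined_level] is [lambda_star R n k], so the
    configuration of almost optimal domains is itself almost optimal. *)
Lemma dirichlet_equality_case :
  lambda_star R n k `^ (n%:R / 2) = \sum_(j < p) lambda_star R n (i j) `^ (n%:R / 2) ->
  forall e : R, 0 < e -> exists A : 'I_p -> set 'rV[R]_n,
  [/\ forall j, domain (A j), trivIset setT A,
      dirichlet_eigenvalue k (\bigcup_j A j) <= (1 + e) * lambda_star R n k,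
      forall j, lambda_star R n (i j)
          <= dirichlet_eigenvalue (i j) (A j) * volume (A j) `^ (2 / n%:R)
          <= (1 + e) * lambda_star R n (i j) &
      \sum_(j < p) volume (A j) = 1 /\
      forall j, lambda_star R n (i j) / ((1 + e) * lambda_star R n k)
          <= volume (A j) `^ (2 / n%:R)
          <= (1 + e) * lambda_star R n (i j) / lambda_star R n k].
Proof.
move=> eqk e e0.
have lk : 0 < lambda_star R n k by rewrite -(prednK k_gt0); exact: lambda_star_gt0.
have SE : combined_level n' Lam = lambda_star R n k.
  by rewrite /combined_level /power_sum -eqk powR_halfK// ltW.
have [A [[dA tA] _ le two vA]] := dirichlet_configuration e0.
have e1 : 1 <= 1 + e by rewrite lerDl ltW.
have e1' : 0 < 1 + e by rewrite ltr_wpDl.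
exists A; split=> //; first by rewrite -SE.
split; first by rewrite -(sum_weight n' p0 Lam0); apply: eq_bigr => j _; exact: vA.
move=> j; rewrite vA (weight_powR n' p0 Lam0) SE -/(Lam j); apply/andP; split.
  rewrite ler_pM2l ?Lam0// lef_pV2 ?posrE ?mulr_gt0//.
  by rewrite ler_peMl// ltW.
by rewrite ler_pM2r ?invr_gt0// ler_peMl// ltW.
Qed.

Lemma neumann_equality_case :
  mu_star R n k `^ (n%:R / 2) = \sum_(j < p) mu_star R n (i j) `^ (n%:R / 2) ->
  forall e : R, 0 < e < 1 -> exists A : 'I_p -> set 'rV[R]_n,
  [/\ forall j, domain (A j), trivIset setT A,
      neumann_eigenvalue k (\bigcup_j A j) >= (1 - e) * mu_star R n k,
      forall j, (1 - e) * mu_star R n (i j)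
          <= neumann_eigenvalue (i j) (A j) * volume (A j) `^ (2 / n%:R)
          <= mu_star R n (i j) &
      \sum_(j < p) volume (A j) = 1 /\
      forall j, (1 - e) * mu_star R n (i j) / mu_star R n k
          <= volume (A j) `^ (2 / n%:R)
          <= mu_star R n (i j) / ((1 - e) * mu_star R n k)].
Proof.
move=> eqk e e01; have /andP[e0 e1] := e01.
have mk : 0 < mu_star R n k by exact: mu_star_gt0.
have SE : combined_level n' M = mu_star R n k.
  by rewrite /combined_level /power_sum -eqk powR_halfK// ltW.
have [A [[dA tA] _ le two vA]] := neumann_configuration e01.
have f0 : 0 < 1 - e by rewrite subr_gt0.
have f1 : 1 - e <= 1 by rewrite gerBl ltW.
exists A; split=> //; first by rewrite -SE.
split; first by rewrite -(sum_weight n' p0 M0); apply: eq_bigr => j _; exact: vA.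
move=> j; rewrite vA (weight_powR n' p0 M0) SE -/(M j); apply/andP; split.
  by rewrite ler_pM2r ?invr_gt0// ler_piMl// ltW.
rewrite ler_pM2l ?M0// lef_pV2 ?posrE ?mulr_gt0//.
by rewrite ler_piMl// ltW.
Qed.

End optimal_configurations.

Theorem theorem2p1 (R : realType) (n k p : nat) (i : 'I_p -> nat)
    (hn : (2 <= n)%N) (hk : (1 <= k)%N)
    (i_gt0 : forall j, (0 < i j)%N)
    (i_mono : forall a b : 'I_p, (a <= b)%N -> (i a <= i b)%N)
    (i_sum : (\sum_(j < p) i j)%N = k) :
  [/\ lambda_star R n k `^ (n%:R / 2)
        <= \sum_(j < p) lambda_star R n (i j) `^ (n%:R / 2) /\
      mu_star R n k `^ (n%:R / 2)
        >= \sum_(j < p) mu_star R n (i j) `^ (n%:R / 2),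
      lambda_star R n k `^ (n%:R / 2)
        = \sum_(j < p) lambda_star R n (i j) `^ (n%:R / 2) ->
      forall e : R, 0 < e ->
      exists A : 'I_p -> set 'rV[R]_n,
        [/\ forall j, domain (A j), trivIset setT A,
            dirichlet_eigenvalue k (\bigcup_j A j)
              <= (1 + e) * lambda_star R n k,
            forall j,
              lambda_star R n (i j)
                <= dirichlet_eigenvalue (i j) (A j) * volume (A j) `^ (2 / n%:R)
                <= (1 + e) * lambda_star R n (i j) &
            \sum_(j < p) volume (A j) = 1 /\
            forall j,
              lambda_star R n (i j) / ((1 + e) * lambda_star R n k)
                <= volume (A j) `^ (2 / n%:R)
                <= (1 + e) * lambda_star R n (i j) / lambda_star R n k] &
      mu_star R n k `^ (n%:R / 2)
        = \sum_(j < p) mu_star R n (i j) `^ (n%:R / 2) ->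
      forall e : R, 0 < e < 1 ->
      exists A : 'I_p -> set 'rV[R]_n,
        [/\ forall j, domain (A j), trivIset setT A,
            neumann_eigenvalue k (\bigcup_j A j) >= (1 - e) * mu_star R n k,
            forall j,
              (1 - e) * mu_star R n (i j)
                <= neumann_eigenvalue (i j) (A j) * volume (A j) `^ (2 / n%:R)
                <= mu_star R n (i j) &
            \sum_(j < p) volume (A j) = 1 /\
            forall j,
              (1 - e) * mu_star R n (i j) / mu_star R n k
                <= volume (A j) `^ (2 / n%:R)
                <= mu_star R n (i j) / ((1 - e) * mu_star R n k)]].

Proof.
have n0 : (0 < n)%N by exact: ltnW hn.
case: n n0 hn => [//|n'] _ _.
split.
- split; first exact: (wolf_keller_dirichlet R n' i_gt0 i_sum hk).
  exact: (wolf_keller_neumann R n' i_gt0 i_sum hk).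
- exact: (dirichlet_equality_case (n' := n') i_gt0 i_sum hk).
- exact: (neumann_equality_case (n' := n') i_gt0 i_sum hk).
Qed.
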